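(* Let $\lambda\in\mathbb{R}$, $\lambda\notin\sigma_{\mathrm{ess}}(A_{\mathrm{N}})\cup\sigma_{\mathrm{ess}}(A_{\mathrm{D}})$. Then for each sufficiently small $\varepsilon>0$ there exists $\delta>0$ such that the intersection $(-\varepsilon,\varepsilon)\cap\sigma(\mathcal{B}_\mu)$ consists of (1) $n_{\mathrm{N}}(\mu)+n_{\mathrm{D}}(\mu)+n_{\mathrm{N},\mathrm{D}}(\mu)$ zero eigenvalues if $\mu=\lambda$; (2) $n_{\mathrm{D}}(\lambda)$ negative and $n_{\mathrm{N}}(\lambda)$ positive eigenvalues if $\mu\in(\lambda-\delta,\lambda)$; (3) $n_{\mathrm{N}}(\lambda)$ negative and $n_{\mathrm{D}}(\lambda)$ positive eigenvalues if $\mu\in(\lambda,\lambda+\delta)$. Here eigenvalues are counted according to their multiplicities.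
   Context: Setting. $H$ is an infinite dimensional separable complex Hilbert space with inner product $(\cdot,\cdot)$ and norm $\|\cdot\|$. $H^1$ is a dense subspace of $H$, $\mathbf{a}[\cdot]$ is a closed positive quadratic form on $H^1$ with sesquilinear form $\mathbf{a}[\cdot,\cdot]$, and $H^1$ is considered as a Hilbert space with the inner product $\mathbf{a}[\cdot,\cdot]$ (in particular $\mathbf{a}[u]\geq c\|u\|^2$ for some $c>0$). $A_{\mathrm{N}}$ is the self-adjoint operator in $H$ generated by $\mathbf{a}$. $H_0^1$ is a closed subspace of $H^1$ which is dense in $H$, and $A_{\mathrm{D}}$ is the self-adjoint operator in $H$ generated by the restriction of $\mathbf{a}$ to $H_0^1$. For $\mathrm{B}\in\{\mathrm{N},\mathrm{D}\}$, $\sigma_{\mathrm{ess}}(A_{\mathrm{B}})$ is the essential spectrum of $A_{\mathrm{B}}$. Notation. $E_{\mathrm{B}}(\lambda)$ is the $H$-orthogonal projection onto $\ker(A_{\mathrm{B}}-\lambda I)$. $\mathcal{H}_0$ is the subspace of $H$ spanned by all common eigenvectors of $A_{\mathrm{N}}$ and $A_{\mathrm{D}}$, and $\mathcal{H}$ is the $H$-orthogonal complement of $\mathcal{H}_0$. $n_{\mathrm{N},\mathrm{D}}(\lambda):=\dim E_{\mathrm{B}}(\lambda)\mathcal{H}_0$ (the same for $\mathrm{B}=\mathrm{N}$ and $\mathrm{B}=\mathrm{D}$) and $n_{\mathrm{B}}(\lambda):=\dim E_{\mathrm{B}}(\lambda)\mathcal{H}$. $H_A^1$ is the set of $u\in H^1$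 such that the functional $v\mapsto\mathbf{a}[u,v]$ on $H_0^1$ is $H$-continuous, and $A:H_A^1\to H$ is the operator such that $(Au,v)=\mathbf{a}[u,v]$ for all $v\in H_0^1$. For $\lambda\in\mathbb{R}$, $G_\lambda:=\{u\in H_A^1: Au=\lambda u\}$, which is a closed subspace of $H^1$. $\Pi'_\lambda$ is the $H^1$-orthogonal projection onto $G_\lambda$, and $\mathcal{B}_\lambda:=(I-\lambda\Pi'_\lambda A_{\mathrm{N}}^{-1})|_{G_\lambda}$, considered as an operator in the Hilbert space $G_\lambda$ with inner product $\mathbf{a}[\cdot,\cdot]$; it is the bounded self-adjoint operator in $G_\lambda$ satisfying $\mathbf{a}[\mathcal{B}_\lambda u,v]=\mathbf{a}[u,v]-\lambda(u,v)$ for all $u,v\in G_\lambda$. $\sigma(\mathcal{B}_\lambda)$ is its spectrum. *)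

(* Defs.v *)
From HB Require Import structures.
From mathcomp Require Import all_boot all_order all_algebra.
From mathcomp Require Import complex.
From mathcomp Require Import all_classical all_reals all_analysis.

Set Implicit Arguments.
Unset Strict Implicit.
Unset Printing Implicit Defensive.

Import Order.TTheory GRing.Theory Num.Theory numFieldNormedType.Exports.

Local Open Scope complex_scope.
Local Open Scope classical_set_scope.
Local Open Scope ring_scope.

Section LinearAlgebra.
Context {R : realType} {H : lmodType R[i]}.

Definition is_subspace (V : set H) : Prop := GRing.submod_closed [in V].

Definition linspan (A : set H) : set H := smallest is_subspace A.

Definition lin_indep (n : nat) (f : 'I_n -> H) : Prop :=
  forall c : 'I_n -> R[i], \sum_(i < n) c i *: f i = 0 -> forall i, c i = 0.

(* Takes the value +oo on infinite dimensional subspaces. *)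
Definition hdim (V : set H) : \bar R :=
  ereal_sup [set n%:R%:E | n in
    [set n : nat | exists2 f : 'I_n -> H, (forall i, V (f i)) & lin_indep f]].

(* [ip] may be an inner product of H, or one defined on a subspace containing
   both u and V; the value is 0 if the projection does not exist. *)
Definition orth_proj (ip : H -> H -> R[i]) (V : set H) (u : H) : H :=
  xget 0 [set g | V g /\ forall v, V v -> ip (u - g) v = 0].

Definition orth_compl (ip : H -> H -> R[i]) (V : set H) : set H :=
  [set u | forall v, V v -> ip u v = 0].

End LinearAlgebra.

Section Operators.
Context {R : realType} {H : lmodType R[i]}.

(* A possibly unbounded operator; the values of [act] outside [dom] are
   irrelevant. *)
Record operator := Operator { dom : set H ; act :> H -> H }.

Definition op_eigenspace (T : operator) (z : R[i]) : set H :=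
  [set u | dom T u /\ T u = z *: u].

Definition op_eigenvalue (T : operator) (z : R[i]) : Prop :=
  exists2 u, u != 0 & op_eigenspace T z u.

Definition op_eigenvector (T : operator) (u : H) : Prop :=
  u != 0 /\ exists z, op_eigenspace T z u.

Definition inv_op (T : operator) (f : H) : H :=
  xget 0 [set u | dom T u /\ T u = f].

(* T is regarded as an operator in the Hilbert space (V, ip), so that
   [dom T] and the range of T are contained in V. *)
Definition resolvent_set (ip : H -> H -> R[i]) (V : set H) (T : operator) :
    set R[i] :=
  [set z | (forall f, V f -> exists! u, dom T u /\ T u - z *: u = f) /\
     exists M : R, forall u, dom T u ->
       ip u u <= M%:C * ip (T u - z *: u) (T u - z *: u)].

Definition op_spectrum (ip : H -> H -> R[i]) (V : set H) (T : operator) :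
    set R[i] :=
  ~` resolvent_set ip V T.

Definition discrete_spectrum (ip : H -> H -> R[i]) (V : set H) (T : operator) :
    set R[i] :=
  [set z | [/\ @isolated (R[i]^o) (op_spectrum ip V T) z,
               op_eigenvalue T z & (hdim (op_eigenspace T z) < +oo)%E]].

Definition ess_spectrum (ip : H -> H -> R[i]) (V : set H) (T : operator) :
    set R[i] :=
  op_spectrum ip V T `\` discrete_spectrum ip V T.

(* I `&` sigma(T) consists of n eigenvalues, counted with multiplicities. *)
Definition spectrum_in (ip : H -> H -> R[i]) (V : set H) (T : operator)
    (I : set R) (n : \bar R) : Prop :=
  (forall t, I t -> op_spectrum ip V T t%:C -> op_eigenvalue T t%:C) /\
  (\esum_(t in [set t | I t /\ op_spectrum ip V T t%:C])
      hdim (op_eigenspace T t%:C))%E = n.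

(* (- e, e) `&` sigma(T) consists of nneg negative, nzero zero and npos
   positive eigenvalues, counted with multiplicities. *)
Definition spectrum_near0 (ip : H -> H -> R[i]) (V : set H) (T : operator)
    (e : R) (nneg nzero npos : \bar R) : Prop :=
  [/\ spectrum_in ip V T [set t | - e < t < 0] nneg,
      spectrum_in ip V T [set 0] nzero &
      spectrum_in ip V T [set t | 0 < t < e] npos].

End Operators.
Arguments operator {R} H.

Section Forms.
Context {R : realType} {H : completeNormedModType R[i]}.
Implicit Types (a : H -> H -> R[i]) (D : set H).

(* A form with domain D is a function on H whose values outside D are
   irrelevant; forms are linear in the first argument. *)
Definition hermitian_on D a : Prop :=
  (forall (k : R[i]) u v w, D u -> D v -> D w ->
     a (k *: u + v) w = k * a u w + a v w) /\
  (forall u v, D u -> D v -> a v u = Num.conj (a u v)).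

Definition positive_on D a : Prop :=
  exists2 c : R, 0 < c & forall u, D u -> c%:C * `|u| ^+ 2 <= a u u.

Definition form_cvg a (x : nat -> H) (u : H) : Prop :=
  (fun n => a (x n - u) (x n - u) : R[i]^o) @ \oo --> (0 : R[i]^o).

Definition form_cauchy a (x : nat -> H) : Prop :=
  forall e : R, 0 < e ->
    \forall m & n \near \oo, a (x m - x n) (x m - x n) < e%:C.

Definition closed_form D a : Prop :=
  forall (x : nat -> H) (u : H), (forall n, D (x n)) ->
    x @ \oo --> u -> form_cauchy a x -> D u /\ form_cvg a x u.

(* D0 is closed in the Hilbert space (D, a). *)
Definition form_closed_subset D a D0 : Prop :=
  forall (x : nat -> H) (u : H), (forall n, D0 (x n)) -> D u ->
    form_cvg a x u -> D0 u.

Definition separable_space : Prop :=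
  exists2 S : set H, countable S & dense S.

End Forms.
Arguments separable_space {R} H.

Section Comparison.
Context {R : realType} {H : completeNormedModType R[i]}.
Variable dot : {dot H for @Num.conj R[i]}.
Variables (H1 H01 : set H) (a : H -> H -> R[i]).

(* The operator T with domain {u in D | a[u, .] is H-continuous on E} such that
   (T u, v) = a[u, v] for all v in E. *)
Definition form_operator (D E : set H) : operator H := {|
  dom := [set u | D u /\ {within E, continuous (a u : H -> R[i]^o)}];
  act := fun u => xget 0 [set f | forall v, E v -> dot f v = a u v] |}.

Definition A_N := form_operator H1 H1.
Definition A_D := form_operator H01 H01.
Definition A_max := form_operator H1 H01.

Definition sigma_ess (T : operator H) : set R[i] := ess_spectrum dot setT T.

(* The closed linear span of the common eigenvectors. *)
Definition calH0 : set H :=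
  closure (linspan [set u | op_eigenvector A_N u /\ op_eigenvector A_D u]).

Definition calH : set H := orth_compl dot calH0.

Definition E_proj (T : operator H) (l : R) : H -> H :=
  orth_proj dot (op_eigenspace T l%:C).

Definition n_N (l : R) : \bar R := hdim (E_proj A_N l @` calH).
Definition n_D (l : R) : \bar R := hdim (E_proj A_D l @` calH).
Definition n_ND (l : R) : \bar R := hdim (E_proj A_N l @` calH0).

Definition G_eig (l : R) : set H := op_eigenspace A_max l%:C.

Definition calB (l : R) : operator H := {|
  dom := G_eig l;
  act := fun u => u - l%:C *: orth_proj a (G_eig l) (inv_op A_N u) |}.

(* The spectrum of calB l in the Hilbert space G_eig l with inner product a. *)
Definition calB_spectrum_near0 (l e : R) (nneg nzero npos : \bar R) : Prop :=
  spectrum_near0 a (G_eig l) (calB l) e nneg nzero npos.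

End Comparison.

(* Main.v *)
Require Import Defs.
From HB Require Import structures.
From mathcomp Require Import all_boot all_order all_algebra.
From mathcomp Require Import complex ring lra zify.
From mathcomp Require Import all_classical all_reals all_analysis.

(** Write q_mu = a - mu (., .). The space Gs mu is the q_mu-orthogonal complement
    of H01 in H1, and calB mu is the restriction of q_mu to it. Let N, D be the
    eigenspaces of A_N, A_D for lam, both finite dimensional and isolated from
    the rest of the spectra.

    If u in Gs mu is orthogonal to N and D, then |calB mu u| >= c |u| with c
    independent of mu near lam. So at most dim (N + D) eigenvalues lie near 0,
    and those of mu <> lam are further restricted because Gs mu is orthogonal to
    the common eigenvectors in N and D. For mu = lam the form q_lam vanishes on
    N + D, which is contained in Gs lam. For mu <> lam, each n in N orthogonal
    to the common eigenvectors is corrected by an element of H01 to a vector w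
    of Gs mu on which q_mu (w, y) = (lam - mu) (n, y), hence q_mu (w, w) is
    comparable to (lam - mu) |n|^2 while |calB mu w| = O (|lam - mu| |n|); each
    such d in D similarly gives a vector with the opposite sign. A variational
    count on the two families then shows that both bounds are attained. *)

Set Implicit Arguments.
Unset Strict Implicit.
Unset Printing Implicit Defensive.

Import Order.TTheory GRing.Theory Num.Theory numFieldNormedType.Exports.

Local Open Scope complex_scope.
Local Open Scope classical_set_scope.
Local Open Scope ring_scope.

(** * Inner products on subspaces *)

(** The unbounded $A - \mu$ is replaced throughout by the bounded symmetric [Tmu mu] $= I - \mu
    A^{-1}$ in the form space, which represents $q_\mu$ there and has the same kernel. Its gap at
    [lam] is extracted from invertibility of its small shifts alone.

    The correction of [n] has two pieces of different size: [e], the projection of [n] on the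
    eigenspace of the other operator, which is not small, and [h], which is $O(|\lambda-\mu|)$.
    Hence $(n,w)$ is close to $\|n-e\|^2$, and the orthogonality of [n] to the common eigenvectors
    is what makes this comparable to $\|n\|^2$.

    The count rests on the polynomial $t^2 - \epsilon t$, negative exactly on $(0,\epsilon)$:
    vectors with $\|Tw\|^2 < \epsilon (Tw,w)$ detect positive eigenvalues inside the window and
    ignore the spectrum beyond it. The left side is $O(|\lambda-\mu|^2)$ and the right side of order
    $|\lambda-\mu|$, so this holds for [mu] near [lam]. *)

Section Subspace.
Context {R : realType} {H : lmodType R[i]} {V : set H}.
Hypothesis sV : is_subspace V.

Lemma sub_lin k u v : V u -> V v -> V (k *: u + v).
Proof.
case: sV => _ h Vu Vv; have := h k u v; rewrite !inE; exact.
Qed.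

Lemma sub0 : V 0.
Proof. by case: sV => h _; rewrite inE in h. Qed.

Lemma subD u v : V u -> V v -> V (u + v).
Proof. by move=> Vu Vv; rewrite -(scale1r u); exact: sub_lin. Qed.

Lemma subZ k u : V u -> V (k *: u).
Proof. by move=> Vu; rewrite -[_ *: _]addr0; apply: sub_lin => //; exact: sub0. Qed.

Lemma subN u : V u -> V (- u).
Proof. by move=> Vu; rewrite -scaleN1r; exact: subZ. Qed.

Lemma subB u v : V u -> V v -> V (u - v).
Proof. by move=> Vu Vv; apply: subD => //; exact: subN. Qed.

Lemma sub_sum (I : Type) (r : seq I) (P : pred I) (F : I -> H) :
  (forall i, P i -> V (F i)) -> V (\sum_(i <- r | P i) F i).
Proof.
by move=> VF; elim/big_ind : _ => //; [exact: sub0|exact: subD].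
Qed.

End Subspace.

Lemma is_subspaceP {R : realType} {H : lmodType R[i]} (V : set H) :
  V 0 -> (forall k u v, V u -> V v -> V (k *: u + v)) -> is_subspace V.
Proof.
move=> V0 VD; split; first by rewrite inE.
by move=> k u v; rewrite !inE; exact: VD.
Qed.

Ltac mem := lazymatch goal with
  | |- ?V 0 => apply: (@sub0 _ _ V); assumption
  | |- ?V (?u - ?v) => apply: (@subB _ _ V); [assumption|mem|mem]
  | |- ?V (?u + ?v) => apply: (@subD _ _ V); [assumption|mem|mem]
  | |- ?V (- ?v) => apply: (@subN _ _ V); [assumption|mem]
  | |- ?V (?k *: ?v) => apply: (@subZ _ _ V); [assumption|mem]
  | |- _ => solve [assumption | by auto]
  end.

Section PreHilbert.
Context {R : realType} {H : completeNormedModType R[i]}.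
Implicit Types (ip : H -> H -> R[i]) (V W : set H).

Definition prehilbert V ip : Prop :=
  [/\ is_subspace V, hermitian_on V ip &
      forall u, V u -> u != 0 -> 0 < ip u u].

(** Minimisation and norm estimates involve only the real part; complex identities are recovered by
    testing also with ['i *: v]. *)
Definition rp ip u v : R := complex.Re (ip u v).
Definition nm ip u : R := Num.sqrt (rp ip u u).

Lemma rpE ip u v : rp ip u v = complex.Re (ip u v).
Proof. by []. Qed.

(** Two sets, because [W] may be the range of an operator or a dense domain, whose Cauchy sequences
    have limits only in the larger [V]. *)
Definition complete_in ip W V : Prop :=
  forall x : nat -> H, (forall n, W (x n)) ->
    (forall e, 0 < e -> exists N, forall m n, (N <= m)%N -> (N <= n)%N ->
       nm ip (x m - x n) < e) ->
    exists2 u, V u & forall e, 0 < e -> exists N, forall n, (N <= n)%N ->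
       nm ip (x n - u) < e.

Lemma prehilbertS V W ip : prehilbert V ip -> is_subspace W -> W `<=` V ->
  prehilbert W ip.
Proof.
move=> [sV [hl hc] hp] sW WV; split=> //; last by move=> u /WV; exact: hp.
by split=> [k u v w /WV ? /WV ? /WV ?|u v /WV ? /WV ?]; [exact: hl|exact: hc].
Qed.

Section Real.
Variables (V : set H) (ip : H -> H -> R[i]).
Hypothesis hV : prehilbert V ip.
Let sV : is_subspace V. Proof. by case: hV. Qed.
Local Notation rp := (rp ip).
Local Notation nm := (nm ip).

Lemma ip_lin k u v w : V u -> V v -> V w ->
  ip (k *: u + v) w = k * ip u w + ip v w.
Proof. by case: hV => _ [h _] _; exact: h. Qed.

Lemma ipC u v : V u -> V v -> ip v u = (ip u v)^*%C.
Proof. by case: hV => _ [_ h] _; exact: h. Qed.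

Lemma ipDl u v w : V u -> V v -> V w -> ip (u + v) w = ip u w + ip v w.
Proof. by move=> *; rewrite -(scale1r u) ip_lin // mul1r scale1r. Qed.

Lemma ip0l w : V w -> ip 0 w = 0.
Proof.
move=> Vw; have V0 := sub0 sV; have := ipDl V0 V0 Vw.
by rewrite addr0 => /esym/eqP; rewrite addrC -subr_eq0 addrK => /eqP.
Qed.

Lemma ipZl k u w : V u -> V w -> ip (k *: u) w = k * ip u w.
Proof.
move=> Vu Vw; rewrite -[k *: u]addr0 ip_lin ?ip0l ?addr0 //; exact: sub0.
Qed.

Lemma ipNl u w : V u -> V w -> ip (- u) w = - ip u w.
Proof. by move=> *; rewrite -scaleN1r ipZl // mulN1r. Qed.

Lemma ipBl u v w : V u -> V v -> V w -> ip (u - v) w = ip u w - ip v w.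
Proof. by move=> *; rewrite ipDl ?ipNl //; mem. Qed.

Lemma ip_suml (I : Type) (r : seq I) (P : pred I) (F : I -> H) w : V w ->
  (forall i, P i -> V (F i)) ->
  ip (\sum_(i <- r | P i) F i) w = \sum_(i <- r | P i) ip (F i) w.
Proof.
move=> Vw VF; elim: r => [|i r IH]; first by rewrite !big_nil ip0l.
rewrite !big_cons; case: ifPn => // Pi; rewrite ipDl ?IH //; first exact: VF.
exact: sub_sum.
Qed.

Lemma ipDr u v w : V u -> V v -> V w -> ip w (u + v) = ip w u + ip w v.
Proof.
by move=> *; rewrite ipC ?ipDl // 1?rmorphD /= -?ipC //; mem.
Qed.

Lemma ip0r w : V w -> ip w 0 = 0.
Proof. by move=> *; rewrite ipC ?ip0l ?conjc0 //; mem. Qed.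

Lemma ipZr k u w : V u -> V w -> ip w (k *: u) = k^*%C * ip w u.
Proof. by move=> *; rewrite ipC ?ipZl // 1?rmorphM /= -?ipC //; mem. Qed.

Lemma ipNr u w : V u -> V w -> ip w (- u) = - ip w u.
Proof. by move=> *; rewrite ipC ?ipNl // 1?rmorphN /= -?ipC //; mem. Qed.

Lemma ipBr u v w : V u -> V v -> V w -> ip w (u - v) = ip w u - ip w v.
Proof. by move=> *; rewrite ipDr ?ipNr //; mem. Qed.

Lemma ip_eq0C u v : V u -> V v -> ip u v = 0 -> ip v u = 0.
Proof. by move=> Vu Vv h; rewrite ipC // h conjc0. Qed.

Lemma rpC u v : V u -> V v -> rp u v = rp v u.
Proof. by move=> *; rewrite /rp ipC //; case: (ip v u). Qed.

Lemma rpDl u v w : V u -> V v -> V w -> rp (u + v) w = rp u w + rp v w.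
Proof. by move=> *; rewrite /rp ipDl // raddfD. Qed.

Lemma rpZl (r : R) u w : V u -> V w -> rp (r%:C *: u) w = r * rp u w.
Proof. by move=> *; rewrite /rp ipZl //; case: (ip u w) => x y /=; rewrite mul0r subr0. Qed.

Lemma rpNl u w : V u -> V w -> rp (- u) w = - rp u w.
Proof. by move=> *; rewrite /rp ipNl // raddfN. Qed.

Lemma rpBl u v w : V u -> V v -> V w -> rp (u - v) w = rp u w - rp v w.
Proof. by move=> *; rewrite /rp ipBl // raddfB. Qed.

Lemma rpDr u v w : V u -> V v -> V w -> rp w (u + v) = rp w u + rp w v.
Proof. by move=> *; rewrite /rp ipDr // raddfD. Qed.

Lemma rpZr (r : R) u w : V u -> V w -> rp w (r%:C *: u) = r * rp w u.
Proof. by move=> *; rewrite rpC ?rpZl // 1?rpC //; mem. Qed.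

Lemma rpNr u w : V u -> V w -> rp w (- u) = - rp w u.
Proof. by move=> *; rewrite /rp ipNr // raddfN. Qed.

Lemma rpBr u v w : V u -> V v -> V w -> rp w (u - v) = rp w u - rp w v.
Proof. by move=> *; rewrite /rp ipBr // raddfB. Qed.

Lemma rp0l u : V u -> rp 0 u = 0.
Proof. by move=> *; rewrite /rp ip0l. Qed.

Lemma rp0r u : V u -> rp u 0 = 0.
Proof. by move=> *; rewrite /rp ip0r. Qed.

Lemma ip_ge0 u : V u -> 0 <= ip u u.
Proof.
move=> Vu; have [->|u0] := eqVneq u 0; first by rewrite ip0l //; mem.
by case: hV => _ _ hp; exact/ltW/hp.
Qed.

Lemma rp_gt0 u : V u -> u != 0 -> 0 < rp u u.
Proof.
move=> Vu u0; case: hV => _ _ /(_ u Vu u0); rewrite /rp ltcE => /andP[_].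
by [].
Qed.

Lemma rp_ge0 u : V u -> 0 <= rp u u.
Proof. by move=> /ip_ge0; rewrite /rp lecE => /andP[_]. Qed.

Lemma ipE u : V u -> ip u u = (rp u u)%:C.
Proof.
move=> /ip_ge0; rewrite /rp lecE => /andP[/eqP h _]; move: h.
by case: (ip u u) => x y /= ->.
Qed.

Lemma nm_ge0 u : 0 <= nm u.
Proof. exact: sqrtr_ge0. Qed.

Lemma sqr_nm u : V u -> nm u ^+ 2 = rp u u.
Proof. by move=> Vu; rewrite sqr_sqrtr //; exact: rp_ge0. Qed.

Lemma nm0 : nm 0 = 0.
Proof. by rewrite /nm rp0l ?sqrtr0 //; mem. Qed.

Lemma nm_gt0 u : V u -> u != 0 -> 0 < nm u.
Proof. by move=> Vu u0; rewrite sqrtr_gt0; exact: rp_gt0. Qed.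

Lemma nm_eq0 u : V u -> nm u = 0 -> u = 0.
Proof.
move=> Vu h; apply/eqP; apply: contra_eqT h => u0.
by rewrite gt_eqF // nm_gt0.
Qed.

Lemma nmZ (k : R[i]) u : V u -> nm (k *: u) = ComplexField.Normc.normc k * nm u.
Proof.
move=> Vu; apply/eqP; rewrite -(@eqrXn2 _ 2) ?nm_ge0 //; last first.
  by rewrite mulr_ge0 ?nm_ge0 //; case: k => x y; exact: sqrtr_ge0.
rewrite exprMn !sqr_nm //; last by mem.
rewrite /rp ipZl ?ipZr //; last by mem.
rewrite ipE // /rp; case: k => x y /=.
rewrite sqr_sqrtr; last by rewrite addr_ge0 ?sqr_ge0.
by apply/eqP; ring.
Qed.

Lemma nmZr (r : R) u : V u -> nm (r%:C *: u) = `|r| * nm u.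
Proof. by move=> *; rewrite nmZ //= expr0n /= addr0 sqrtr_sqr. Qed.

Lemma nmN u : V u -> nm (- u) = nm u.
Proof. by move=> *; rewrite /nm rpNl ?rpNr ?opprK //; mem. Qed.

Lemma nmBC u v : V u -> V v -> nm (u - v) = nm (v - u).
Proof. by move=> *; rewrite -nmN ?opprB //; mem. Qed.

Lemma rp_le_nm u v : V u -> V v -> rp u v <= nm u * nm v.
Proof.
move=> Vu Vv; have [->|v0] := eqVneq v 0.
  by rewrite rp0r // nm0 mulr0.
have v0' := nm_gt0 Vv v0.
(* The weights make the expansion equal to $2\|u\|\|v\|(\|u\|\|v\| - (u,v))$. *)
have : 0 <= rp ((nm v)%:C *: u - (nm u)%:C *: v) ((nm v)%:C *: u - (nm u)%:C *: v).
  by apply: rp_ge0; mem.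
rewrite !(rpBl, rpBr, rpZl, rpZr) //; [|mem..].
rewrite -!sqr_nm // (rpC Vv Vu) => h.
have [->|u0] := eqVneq u 0; first by rewrite rp0l // nm0 mul0r.
have u0' := nm_gt0 Vu u0.
have uv := mulr_gt0 u0' v0'.
rewrite -(ler_pM2r uv); nra.
Qed.

Lemma normr_rp u v : V u -> V v -> `|rp u v| <= nm u * nm v.
Proof.
move=> Vu Vv; rewrite ler_norml rp_le_nm // andbT lerNl.
by rewrite -rpNl // -(nmN Vu) rp_le_nm //; mem.
Qed.

Lemma nm_triangle u v : V u -> V v -> nm (u + v) <= nm u + nm v.
Proof.
move=> Vu Vv; rewrite -(@ler_pXn2r _ 2) ?nnegrE ?addr_ge0 ?nm_ge0 //.
rewrite sqr_nm; last by mem.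
rewrite rpDl ?rpDr //; last by mem.
rewrite -!sqr_nm // (rpC Vv Vu); have := rp_le_nm Vu Vv; nra.
Qed.

Lemma nm_triangleB u v : V u -> V v -> nm (u - v) <= nm u + nm v.
Proof. by move=> Vu Vv; rewrite -(nmN Vv) nm_triangle //; mem. Qed.

Lemma nm_le u v : V u -> V v -> nm u <= nm (u - v) + nm v.
Proof. by move=> Vu Vv; rewrite -{1}(subrK v u) nm_triangle //; mem. Qed.

Lemma nm_dist u v : V u -> V v -> nm u - nm v <= nm (u - v).
Proof. by move=> Vu Vv; rewrite lerBlDr nm_le. Qed.

Lemma nm_le_orth u v : V u -> V v -> rp u v = 0 -> nm u <= nm (u + v).
Proof.
move=> Vu Vv uv; rewrite -(@ler_pXn2r _ 2) ?nnegrE ?nm_ge0 // !sqr_nm //; last by mem.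
rewrite rpDl ?(rpDr _ _ Vu) ?(rpDr _ _ Vv) //; last by mem.
by rewrite (rpC Vv Vu) uv addr0 add0r lerDl rp_ge0.
Qed.

Lemma rp_orth_ip (W : set H) u : is_subspace W -> W `<=` V -> V u ->
  (forall v, W v -> rp u v = 0) -> forall v, W v -> ip u v = 0.
Proof.
move=> sW WV Vu h v Wv; have Vv := WV _ Wv.
have h1 := h _ Wv; have /h : W ('i *: v) by exact: subZ.
rewrite /rp ipZr //; move: h1; rewrite /rp; case: (ip u v) => x y /= ->.
by rewrite mul0r sub0r mulNr mul1r opprK => ->.
Qed.

End Real.
End PreHilbert.

(** * Riesz representation *)

Lemma invSn_lt {R : realType} (e : R) : 0 < e ->
  exists N, forall n, (N <= n)%N -> n.+1%:R^-1 < e.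
Proof.
move=> e0; have [N] := @ltr_add_invr R 0 e e0.
rewrite add0r => h; exists N => n Nn; apply: le_lt_trans h.
by rewrite lef_pV2 ?posrE ?ltr0n // ler_nat.
Qed.

Section Riesz.
Context {R : realType} {H : completeNormedModType R[i]}.
Variables (V W : set H) (ip : H -> H -> R[i]).
Hypotheses (hV : prehilbert V ip) (sW : is_subspace W) (WV : W `<=` V).
Local Notation rp := (rp ip).
Local Notation nm := (nm ip).
Let sV : is_subspace V. Proof. by case: hV. Qed.

(** A minimising sequence of $\|x\|^2 - 2 l(x)$ over [W] is Cauchy, and its limit represents [l].
    When [W] is not closed the limit may lie outside it; the last clause records that it is in the
    closure. *)
Lemma riesz (l : H -> R) (C : R) : complete_in ip W V ->
  (forall u v, W u -> W v -> l (u + v) = l u + l v) ->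
  (forall (r : R) u, W u -> l (r%:C *: u) = r * l u) ->
  (forall u, W u -> l u <= C * nm u) ->
  exists g, [/\ V g, forall v, W v -> rp g v = l v &
    forall e, 0 < e -> exists2 y, W y & nm (g - y) < e].
Proof.
move=> cW lD lZ lb.
pose J x := rp x x - 2 * l x.
have J_ge x : W x -> - (C ^+ 2) <= J x.
  move=> Wx; have := lb _ Wx; rewrite /J -(sqr_nm hV) //; last exact: WV.
  by have := sqr_ge0 (nm x - C); nra.
have JD x v (t : R) : W x -> W v ->
    J (x + t%:C *: v) = J x + 2 * t * (rp x v - l v) + t ^+ 2 * rp v v.
  move=> Wx Wv; have Vx := WV Wx; have Vv := WV Wv; rewrite /J lD ?lZ //; last by mem.
  rewrite (rpDl hV) ?(rpDr hV) ?(rpZl hV) ?(rpZr hV) //; try by mem.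
  by rewrite (rpC hV Vv Vx); ring.
pose A := [set J x | x in W].
have hA : has_inf A.
  split; first by exists (J 0); exists 0 => //; mem.
  by exists (- (C ^+ 2)) => _ [x Wx <-]; exact: J_ge.
pose m := inf A.
have mJ x : W x -> m <= J x.
  by move=> Wx; apply: ge_inf; [case: hA|exists x].
pose e_ (n : nat) : R := n.+1%:R^-1.
have e_gt0 n : 0 < e_ n by rewrite invr_gt0 ltr0n.
have /choice[x xP] n : exists x, W x /\ J x < m + e_ n ^+ 2.
  have [_ [x Wx <-] h] := inf_adherent (exprn_gt0 2 (e_gt0 n)) hA.
  by exists x.
have Wx n : W (x n) by case: (xP n).
have Jx n : J (x n) < m + e_ n ^+ 2 by case: (xP n).
(* Parallelogram identity: at the midpoint [J] is the mean of the two values minus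
   $\frac14\|x_j-x_k\|^2$, and it cannot fall below [m]. *)
have xx j k : rp (x j - x k) (x j - x k) <= 2 * e_ j ^+ 2 + 2 * e_ k ^+ 2.
  have := JD _ _ (1/2) (Wx k) (subB sW (Wx j) (Wx k)).
  have := JD _ _ 1 (Wx k) (subB sW (Wx j) (Wx k)).
  have -> : x k + 1%:C *: (x j - x k) = x j.
    by rewrite rmorph1 scale1r addrC subrK.
  have := mJ (x k + (1/2)%:C *: (x j - x k)).
  have Wm : W (x k + (1 / 2)%:C *: (x j - x k)).
    by apply: subD => //; apply: subZ => //; exact: subB.
  move=> /(_ Wm) h1 h2 h3; have := Jx j; have := Jx k; rewrite h3 in h1.
  move: h1 h2; set a := rp _ _; set b := _ - l _; set c := J (x k); set d := J (x j).
  by move=> h1 h2 h4 h5; lra.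
have [g Vg xg] : exists2 u, V u & forall e, 0 < e ->
    exists N, forall n, (N <= n)%N -> nm (x n - u) < e.
  apply: cW => // e e0; have [N hN] := @invSn_lt R (e / 2) (divr_gt0 e0 (ltr0Sn R 1)).
  exists N => j k Nj Nk.
  have Vjk : V (x j - x k) by apply: WV; exact: subB.
  rewrite -(@ltr_pXn2r _ 2) ?nnegrE ?nm_ge0 ?(ltW e0) // (sqr_nm hV) //.
  apply: le_lt_trans (xx j k) _.
  have := hN _ Nj; have := hN _ Nk; rewrite -/(e_ j) -/(e_ k).
  by have := e_gt0 j; have := e_gt0 k; nra.
exists g; split=> //; last first.
  move=> e e0; have [N hN] := xg e e0; exists (x N) => //.
  by rewrite (nmBC hV) //; [exact: hN|exact: WV].
move=> v Wv; have Vv := WV Wv.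
have dv n : `|rp (x n) v - l v| <= e_ n * nm v.
  have [->|v0] := eqVneq v 0.
    have -> : l 0 = 0 by have := lZ 0 0 (sub0 sW); rewrite scaler0 mul0r.
    by rewrite (rp0r hV) ?(nm0 hV) ?subr0 ?normr0 ?mulr0 //; exact: WV.
  set d := _ - l v.
  rewrite -(@ler_pXn2r _ 2) ?nnegrE ?mulr_ge0 ?nm_ge0 ?(ltW (e_gt0 n)) //.
  rewrite real_normK ?num_real // exprMn (sqr_nm hV) //.
  have vv := rp_gt0 hV Vv v0.
  (* This step length minimises [J] along [v] and lowers it by $d^2/\|v\|^2$, while [J (x n)]
     exceeds the infimum by less than [e_ n ^+ 2]. *)
  have := mJ (x n + (- (d / rp v v))%:C *: v).
  rewrite JD //.
  have Wm : W (x n + (- (d / rp v v))%:C *: v).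
    by apply: subD => //; exact: subZ.
  move=> /(_ Wm); rewrite -/d => h; have h2 := Jx n.
  have h3 : d * d / rp v v <= e_ n ^+ 2.
    have E : 2 * - (d / rp v v) * d + (- (d / rp v v)) ^+ 2 * rp v v = - (d * d / rp v v).
      by field; rewrite gt_eqF.
    by rewrite -addrA E in h; lra.
  move: h3; rewrite ler_pdivrMr // -expr2.
apply/eqP; rewrite -subr_eq0 -normr_le0; apply/ler_addgt0Pl => e e0.
rewrite addr0.
have nv1 : 0 < nm v + 1 by have := nm_ge0 ip v; lra.
have e1 : 0 < e / 2 / (nm v + 1) by rewrite !divr_gt0.
have [N1 h1] := xg _ e1; have [N2 h2] := invSn_lt e1.
pose n := maxn N1 N2.
have Vx : V (x n) by exact: WV.
have -> : rp g v - l v = - rp (x n - g) v + (rp (x n) v - l v).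
  by rewrite (rpBl hV) //; ring.
apply: le_trans (ler_normD _ _) _; rewrite normrN.
have h3 : `|rp (x n - g) v| <= nm (x n - g) * nm v.
  by apply: (normr_rp hV) => //; mem.
have := dv n; have := h1 n (leq_maxl _ _); have := h2 n (leq_maxr _ _).
rewrite -/(e_ n) !ltr_pdivlMr //; have := nm_ge0 ip v; have := e_gt0 n.
have := nm_ge0 ip (x n - g).
by nra.
Qed.

End Riesz.

(** * Symmetric operators bounded below *)

Section SymmetricOperators.
Context {R : realType} {H : completeNormedModType R[i]}.
Implicit Types (V : set H) (ip : H -> H -> R[i]) (S : H -> H) (s c : R).

Definition symop V ip S : Prop :=
  [/\ forall u, V u -> V (S u),
      forall k u v, V u -> V v -> S (k *: u + v) = k *: S u + S v,
      forall u v, V u -> V v -> rp ip (S u) v = rp ip u (S v) &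
      exists2 b, 0 < b & forall u, V u -> nm ip (S u) <= b * nm ip u].

Definition bdd_below V ip S : Prop :=
  exists2 c, 0 < c & forall u, V u -> c * nm ip u <= nm ip (S u).

Definition opshift S s : H -> H := fun u => S u - s%:C *: u.

Section Fixed.
Variables (V : set H) (ip : H -> H -> R[i]).
Hypothesis hV : prehilbert V ip.
Let sV : is_subspace V. Proof. by case: hV. Qed.
Local Notation rp := (rp ip).
Local Notation nm := (nm ip).

Lemma symop_shift S s : symop V ip S -> symop V ip (opshift S s).
Proof.
case=> SV Sl Ss [b b0 Sb]; split.
- by move=> u Vu; apply: subB => //; [exact: SV|exact: subZ].
- move=> k u v Vu Vv; rewrite /opshift Sl // scalerDr !scalerBr !scalerA.
  by rewrite (mulrC s%:C) opprD addrACA.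
- move=> u v Vu Vv; have VSu := SV _ Vu; have VSv := SV _ Vv; rewrite /opshift.
  by rewrite (rpBl hV) ?(rpBr hV) ?(rpZl hV) ?(rpZr hV) ?Ss //; mem.
- exists (b + `|s|); first by rewrite ltr_wpDr.
  move=> u Vu; have VSu := SV _ Vu.
  apply: (le_trans (nm_triangleB hV VSu (subZ sV _ Vu))).
  by rewrite (nmZr hV) // mulrDl lerD2r Sb.
Qed.

Lemma symop_comp S T : symop V ip S -> symop V ip T ->
  (forall u, V u -> S (T u) = T (S u)) -> symop V ip (S \o T).
Proof.
case=> SV Sl Ss [b b0 Sb] [TV Tl Ts [b' b'0 Tb]] ST; split=> /=.
- by move=> u /TV/SV.
- move=> k u v Vu Vv; have VTu := TV _ Vu; have VTv := TV _ Vv.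
  by rewrite Tl ?Sl.
- move=> u v Vu Vv; have VTu := TV _ Vu; have VSv := SV _ Vv.
  by rewrite Ss ?Ts -?ST.
- exists (b * b'); first exact: mulr_gt0.
  move=> u Vu; apply: le_trans (Sb _ (TV _ Vu)) _.
  by rewrite -mulrA ler_pM2l // Tb.
Qed.

Lemma symop0 S : symop V ip S -> S 0 = 0.
Proof.
case=> _ Sl _ _; have V0 := sub0 sV.
have /eqP := Sl 1 0 0 V0 V0; rewrite !scale1r addr0.
by rewrite -[X in X == _]addr0 (inj_eq (addrI _)) eq_sym => /eqP.
Qed.

Lemma symopZ S k u : symop V ip S -> V u -> S (k *: u) = k *: S u.
Proof.
move=> hS Vu; case: (hS) => _ Sl _ _.
by rewrite -[k *: u]addr0 Sl ?(symop0 hS) ?addr0 //; mem.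
Qed.

Lemma symopD S u v : symop V ip S -> V u -> V v -> S (u + v) = S u + S v.
Proof. by case=> _ Sl _ _ Vu Vv; rewrite -[u in LHS]scale1r Sl // scale1r. Qed.

Lemma symopB S u v : symop V ip S -> V u -> V v -> S (u - v) = S u - S v.
Proof.
move=> hS Vu Vv; rewrite (symopD hS) //; last by mem.
by rewrite -scaleN1r (symopZ _ hS) // scaleN1r.
Qed.

Lemma symop_ip S u v : symop V ip S -> V u -> V v -> ip (S u) v = ip u (S v).
Proof.
move=> hS Vu Vv; have [SV _ Ss _] := hS.
have VSu := SV _ Vu; have VSv := SV _ Vv.
have := Ss _ _ Vu Vv; have := Ss _ _ Vu (subZ sV 'i Vv).
rewrite (symopZ _ hS) // /rp !(ipZr hV) //.
case: (ip (S u) v) => x y; case: (ip u (S v)) => x' y' /=.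
by rewrite !mul0r !sub0r !mulNr !opprK !mul1r => -> ->.
Qed.

Lemma bdd_below_inj S u : bdd_below V ip S -> V u -> S u = 0 -> u = 0.
Proof.
case=> c c0 Sc Vu Su; apply: (nm_eq0 hV) => //; apply/eqP.
have := Sc _ Vu; rewrite Su (nm0 hV) pmulr_rle0 // => h.
by rewrite eq_le h nm_ge0.
Qed.

Lemma bdd_below_comp S T : symop V ip T -> bdd_below V ip S ->
  bdd_below V ip T -> bdd_below V ip (S \o T).
Proof.
case=> TV _ _ _ [c c0 Sc] [d d0 Td]; exists (c * d); first exact: mulr_gt0.
move=> u Vu /=; apply: le_trans (Sc _ (TV _ Vu)).
by rewrite -mulrA ler_pM2l // Td.
Qed.

(** The lower bound makes the range closed, here in the form of completeness of [W]. What the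
    projection of [f] on the range misses is orthogonal to the range, hence killed by the symmetric
    [S], hence zero. *)
Lemma symop_surj S : complete_in ip V V -> symop V ip S -> bdd_below V ip S ->
  forall f, V f -> exists2 u, V u & S u = f.
Proof.
move=> cV hS bS f Vf; have [SV Sl Ss [b b0 Sb]] := hS; case: (bS) => c c0 Sc.
pose W := S @` V.
have WV : W `<=` V by move=> _ [u Vu <-]; exact: SV.
have sW : is_subspace W.
  apply: is_subspaceP; first by exists 0; [mem|exact: symop0].
  move=> k _ _ [u Vu <-] [v Vv <-]; exists (k *: u + v); first by mem.
  exact: Sl.
have cW : complete_in ip W W.
  move=> x Wx xC.
  have /choice[y yP] n : exists y, V y /\ S y = x n.
    by have [y] := Wx n; exists y.
  have Vy n : V (y n) by case: (yP n).
  have [||u Vu yu] := cV y; first by [].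
    move=> e e0; have [N hN] := xC _ (mulr_gt0 c0 e0); exists N => m n Nm Nn.
    rewrite -(ltr_pM2l c0); apply: le_lt_trans (Sc _ _) _; first by mem.
    have [_ xm] := yP m; have [_ xn] := yP n.
    by rewrite (symopB hS) // xm xn; exact: hN.
  exists (S u); first by exists u.
  move=> e e0; have [N hN] := yu _ (divr_gt0 e0 b0); exists N => n Nn.
  have [_ <-] := yP n; rewrite -(symopB hS) //.
  apply: le_lt_trans (Sb _ _) _; first by mem.
  by have := hN n Nn; rewrite ltr_pdivlMr // mulrC.
have hW := prehilbertS hV sW WV.
have [|||g [Wg gf _]] := @riesz _ _ _ _ _ hW sW (@subset_refl _ W) (rp f) (nm f) cW.
- by move=> u v /WV ? /WV ?; rewrite (rpDr hV).
- by move=> r u /WV ?; rewrite (rpZr hV).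
- by move=> u /WV ?; exact: (rp_le_nm hV).
have Vg := WV _ Wg; case: (Wg) => u Vu ug; exists u => //.
rewrite ug; apply/eqP; rewrite -subr_eq0; apply/eqP.
have Vgf : V (g - f) by mem.
apply: (bdd_below_inj bS) => //.
have VSgf := SV _ Vgf.
apply: (nm_eq0 hV) => //; apply/eqP; rewrite -sqrf_eq0 (sqr_nm hV) // Ss //.
rewrite (rpBl hV) //; last exact: SV.
by rewrite gf ?subrr //; exists (S (g - f)).
Qed.

(* Cauchy-Schwarz for the nonnegative form [rp (P u) v]. *)
Lemma nonneg_op_bound P b : symop V ip P -> 0 < b ->
  (forall u, V u -> nm (P u) <= b * nm u) ->
  (forall u, V u -> 0 <= rp (P u) u) ->
  forall u, V u -> nm (P u) ^+ 2 <= b * rp (P u) u.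
Proof.
move=> hP b0 Pb P0 u Vu; have [PV _ Ps _] := hP.
have VPu := PV _ Vu; have VPPu := PV _ VPu.
have := P0 (u - (b^-1)%:C *: P u) (subB sV Vu (subZ sV _ VPu)).
rewrite (symopB hP) ?(symopZ _ hP) //; last by mem.
rewrite !(rpBl hV) ?(rpBr hV) ?(rpZl hV) ?(rpZr hV) //; try by mem.
rewrite (Ps (P u) u) // -(sqr_nm hV) //.
have h : rp (P (P u)) (P u) <= b * nm (P u) ^+ 2.
  apply: le_trans (rp_le_nm hV VPPu VPu) _.
  by rewrite expr2 mulrA ler_wpM2r ?nm_ge0 // Pb.
have : b^-1 * rp (P (P u)) (P u) <= nm (P u) ^+ 2 by rewrite ler_pdivrMl.
have bi : 0 < b^-1 by rewrite invr_gt0.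
set z := rp _ _; set w := nm _ ^+ 2; set y := rp _ _.
move=> h1 h2; rewrite -ler_pdivrMl //.
by have := ler_wpM2l (ltW bi) h1; lra.
Qed.

(* With m the infimum of |S u| over unit vectors, the form of S^2 - m^2 is
   nonnegative with infimum 0, so one of S - m, S + m is not bounded below. *)
Lemma symop_lower_bound S (r : R) : symop V ip S ->
  (forall s, `|s| < r -> bdd_below V ip (opshift S s)) ->
  forall u, V u -> r * nm u <= nm (S u).
Proof.
move=> hS hs u0 Vu0; rewrite leNgt; apply/negP => lt0.
have [SV Sl Ss [b b0 Sb]] := hS.
have u0_neq0 : u0 != 0.
  by apply: contraTneq lt0 => ->; rewrite (symop0 hS) (nm0 hV) mulr0 ltxx.
have n0 := nm_gt0 hV Vu0 u0_neq0.
pose A := [set x | exists u, [/\ V u, nm u = 1 & nm (S u) = x]].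
have unit u : V u -> u != 0 -> A (nm (S u) / nm u).
  move=> Vu un0; have n1 := nm_gt0 hV Vu un0.
  exists ((nm u)^-1%:C *: u); split; first by mem.
    by rewrite (nmZr hV) // gtr0_norm ?invr_gt0 // mulVf // gt_eqF.
  rewrite (symopZ _ hS) // (nmZr hV) ?gtr0_norm ?invr_gt0 1?mulrC //.
  exact: SV.
have lA : lbound A 0 by move=> _ [u [_ _ <-]]; exact: nm_ge0.
have hA : has_inf A.
  by split; [exists (nm (S u0) / nm u0); exact: unit|exists 0].
pose m := inf A.
have m0 : 0 <= m by apply: lb_le_inf => //; case: hA.
have mA x : A x -> m <= x by apply: ge_inf; case: hA.
have mS u : V u -> m * nm u <= nm (S u).
  move=> Vu; have [->|un0] := eqVneq u 0.
    by rewrite (symop0 hS) !(nm0 hV) mulr0.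
  by rewrite -ler_pdivlMr ?(nm_gt0 hV) //; apply: mA; exact: unit.
have mr : m < r.
  apply: le_lt_trans (mA _ (unit _ Vu0 u0_neq0)) _.
  by rewrite ltr_pdivrMr.
have Em : (- m)%:C = - m%:C :> R[i] by exact: rmorphN.
(* As $m<r$, both factors are bounded below, hence so is their product $S^2-m^2$; the contradiction
   comes from unit vectors that nearly attain [m]. *)
pose P := opshift S m \o opshift S (- m).
have PE u : V u -> P u = S (S u) - (m ^+ 2)%:C *: u.
  move=> Vu; have VSu := SV _ Vu.
  rewrite /P /opshift /= Em scaleNr opprK (symopD hS) ?(symopZ _ hS) //.
    by rewrite scalerDr scalerA -expr2 rmorphXn /= opprD addrA addrK.
  by mem.
have hPc u : V u -> opshift S m (opshift S (- m) u) = opshift S (- m) (opshift S m u).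
  move=> Vu; have VSu := SV _ Vu.
  rewrite [LHS]PE // /opshift /= Em scaleNr opprK (symopB hS) ?(symopZ _ hS) //.
    by rewrite scalerBr scalerA -expr2 rmorphXn /= addrA subrK.
  by mem.
have hP : symop V ip P by apply: symop_comp => //; exact: symop_shift.
have [c c0 Pc] : bdd_below V ip P.
  apply: bdd_below_comp; first exact: symop_shift.
    by apply: hs; rewrite ger0_norm.
  by apply: hs; rewrite normrN ger0_norm.
have [_ _ _ [bP bP0 Pb]] := hP.
have PP u : V u -> rp (P u) u = nm (S u) ^+ 2 - m ^+ 2 * nm u ^+ 2.
  move=> Vu; have VSu := SV _ Vu; have VSSu := SV _ VSu.
  rewrite PE // (rpBl hV) //; last by mem.
  by rewrite (rpZl hV) // Ss // !(sqr_nm hV).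
have P0 u : V u -> 0 <= rp (P u) u.
  move=> Vu; rewrite PP // -exprMn subr_ge0 ler_pXn2r ?nnegrE ?mulr_ge0 ?nm_ge0 //.
  exact: mS.
have key eta : 0 < eta -> eta <= 1 -> c ^+ 2 <= bP * ((2 * m + 1) * eta).
  move=> eta0 eta1; have [_ [u [Vu u1 <-]] hu] := inf_adherent eta0 hA.
  have h1 := nonneg_op_bound hP bP0 Pb P0 Vu.
  have h2 : c ^+ 2 <= nm (P u) ^+ 2.
    by rewrite ler_pXn2r ?nnegrE ?nm_ge0 ?(ltW c0) // -[c]mulr1 -u1 Pc.
  apply: le_trans h2 (le_trans h1 _); rewrite ler_pM2l // PP // u1.
  rewrite -/m in hu; have := nm_ge0 ip (S u); nra.
have c20 : 0 < c ^+ 2 by exact: exprn_gt0.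
pose d := bP * (2 * m + 1).
have d0 : 0 < d by apply: mulr_gt0 => //; lra.
(* The choice $\eta = c^2/(2d)$ turns [key] into $c^2 \le c^2/2$; if that value is at least 1, then
   $\eta = 1$ already suffices. *)
have [h|h] := leP 1 (c ^+ 2 / (2 * d)).
  have := key _ ltr01 (lexx _); rewrite mulr1 -/d.
  move: h; rewrite ler_pdivlMr ?mul1r ?mulr_gt0 //; lra.
have := key (c ^+ 2 / (2 * d)) (divr_gt0 c20 (mulr_gt0 (ltr0Sn R 1) d0)) (ltW h).
rewrite mulrA -/d.
have -> : d * (c ^+ 2 / (2 * d)) = c ^+ 2 / 2 by field; rewrite gt_eqF.
lra.
Qed.

Lemma shiftD S s t u : opshift (opshift S s) t u = opshift S (s + t) u.
Proof. by rewrite /opshift rmorphD /= scalerDl opprD addrA. Qed.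

End Fixed.
End SymmetricOperators.

(** * Isolated spectral values *)

Section Gap.
Context {R : realType} {H : completeNormedModType R[i]}.
Variables (V : set H) (ip : H -> H -> R[i]).
Hypothesis hV : prehilbert V ip.
Let sV : is_subspace V. Proof. by case: hV. Qed.
Local Notation rp := (rp ip).
Local Notation nm := (nm ip).

(* [symop_lower_bound] for S - t, |t| < k / 2, gives |S u|^2 >= k/2 |(S u, u)|.
   Applied to (S - k/2) x and (S + k/2) x this yields |S^2 x| >= k/2 |S x|,
   and the range of S is dense in the orthogonal complement of its kernel. *)
Lemma isolated_gap S (k : R) : complete_in ip V V -> symop V ip S -> 0 < k ->
  (forall s, 0 < `|s| < k -> bdd_below V ip (opshift S s)) ->
  exists2 c, 0 < c & forall u, V u ->
    (forall n, V n -> S n = 0 -> rp u n = 0) -> c * nm u <= nm (S u).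
Proof.
move=> cV hS k0 hs; have [SV Sl Ss [b b0 Sb]] := hS.
(* Shifting [S - t] by less than [|t|] gives shifts of [S] that are nonzero and smaller than [k].
   Squaring $|t|\|u\| \le \|(S-t)u\|$ then cancels $t^2\|u\|^2$. *)
have h1 t u : V u -> 0 < `|t| < k / 2 -> 2 * t * rp (S u) u <= nm (S u) ^+ 2.
  move=> Vu /andP[t0 tk]; have VSu := SV _ Vu.
  suff : `|t| * nm u <= nm (opshift S t u).
    have tn : 0 <= `|t| * nm u by rewrite mulr_ge0 ?nm_ge0.
    move=> h; have : (`|t| * nm u) ^+ 2 <= nm (opshift S t u) ^+ 2.
      by rewrite ler_pXn2r ?nnegrE ?nm_ge0.
    rewrite exprMn real_normK ?num_real // !(sqr_nm hV) //; last by rewrite /opshift; mem.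
    rewrite /opshift !(rpBl hV) ?(rpBr hV) ?(rpZl hV) ?(rpZr hV) //; try by mem.
    by rewrite (rpC hV Vu VSu); lra.
  apply: (symop_lower_bound hV (symop_shift hV t hS)) => // s st.
  have [c c0 hc] : bdd_below V ip (opshift S (t + s)).
    apply: hs; apply/andP; split.
      rewrite normr_gt0; apply: contraTneq st => /eqP.
      by rewrite addr_eq0 => /eqP ->; rewrite normrN ltxx.
    by apply: le_lt_trans (ler_normD _ _) _; lra.
  by exists c => // v Vv; rewrite shiftD; exact: hc.
have [d dE d0] : exists2 d, d = k / 2 & 0 < d by exists (k / 2); rewrite ?divr_gt0.
have h2 u : V u -> d * rp (S u) u <= nm (S u) ^+ 2.
  move=> Vu; have := @h1 (k / 4) u Vu; rewrite ger0_norm; last lra.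
  by move=> h; rewrite dE; have := h _; lra.
have h3 u : V u -> - d * rp (S u) u <= nm (S u) ^+ 2.
  move=> Vu; have := @h1 (- (k / 4)) u Vu; rewrite normrN ger0_norm; last lra.
  by move=> h; rewrite dE; have := h _; lra.
(* Adding [h3] at $(S-d)x$ and [h2] at $(S+d)x$ leaves $4d^2\|Sx\|^2 \le 2\|S^2x\|^2 +
   2d^2\|Sx\|^2$. *)
have h4 x : V x -> d * nm (S x) <= nm (S (S x)).
  move=> Vx; have VSx := SV _ Vx; have VSSx := SV _ VSx.
  have V1 : V (S x - d%:C *: x) by mem.
  have V2 : V (S x + d%:C *: x) by mem.
  rewrite -(@ler_pXn2r _ 2) ?nnegrE ?mulr_ge0 ?nm_ge0 ?(ltW d0) //.
  rewrite exprMn !(sqr_nm hV) //.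
  have := h3 _ V1; have := h2 _ V2; rewrite !(sqr_nm hV) //; try exact: SV.
  have -> : S (S x - d%:C *: x) = S (S x) - d%:C *: S x.
    by rewrite (symopB hV hS) ?(symopZ hV _ hS) //; mem.
  have -> : S (S x + d%:C *: x) = S (S x) + d%:C *: S x.
    by rewrite (symopD hS) ?(symopZ hV _ hS) //; mem.
  rewrite !(rpBl hV, rpBr hV, rpDl hV, rpDr hV, rpNl hV, rpNr hV, rpZl hV, rpZr hV) //;
    try by mem.
  rewrite (Ss (S x) x) // (rpC hV VSx VSSx) => a1 a2.
  have := sqr_ge0 d; nra.
exists d => // w Vw wk.
pose W := S @` V.
have WV : W `<=` V by move=> _ [u Vu <-]; exact: SV.
have sW : is_subspace W.
  apply: is_subspaceP; first by exists 0; [mem|exact: (symop0 hV hS)].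
  by move=> c _ _ [u Vu <-] [v Vv <-]; exists (c *: u + v); [mem|exact: Sl].
have cW : complete_in ip W V by move=> x Wx; apply: cV => n; exact: WV.
have [|||g [Vg gw gW]] := @riesz _ _ _ _ _ hV sW WV (rp w) (nm w) cW.
- by move=> u v /WV ? /WV ?; rewrite (rpDr hV).
- by move=> r u /WV ?; rewrite (rpZr hV).
- by move=> u /WV ?; exact: (rp_le_nm hV).
have Vwg : V (w - g) by mem.
have VSwg := SV _ Vwg.
have Swg : S (w - g) = 0.
  apply: (nm_eq0 hV) => //; apply/eqP; rewrite -sqrf_eq0 (sqr_nm hV) // Ss //.
  by rewrite (rpBl hV) ?gw ?subrr //; [exists (S (w - g))|exact: SV].
have gk n : V n -> S n = 0 -> rp g n = 0.
  move=> Vn Sn; apply/eqP; rewrite -normr_le0; apply/ler_addgt0Pl => e e0.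
  rewrite addr0.
  have n1 : 0 < nm n + 1 by have := nm_ge0 ip n; lra.
  have [y Wy gy] := gW _ (divr_gt0 e0 n1); have Vy := WV _ Wy.
  have yn : rp y n = 0 by case: Wy => v Vv <-; rewrite Ss // Sn (rp0r hV).
  have -> : rp g n = rp (g - y) n by rewrite (rpBl hV) // yn subr0.
  have Vgy : V (g - y) by mem.
  apply: le_trans (normr_rp hV Vgy Vn) _.
  by rewrite ltr_pdivlMr // in gy; have := nm_ge0 ip n; have := nm_ge0 ip (g - y); lra.
(* [w - g] lies in the kernel, and both [w] and [g] are orthogonal to it. So [w] is a limit of
   points of the range, where [h4] applies. *)
have wg : w = g.
  apply/eqP; rewrite -subr_eq0; apply/eqP; apply: (nm_eq0 hV) => //; apply/eqP.
  by rewrite -sqrf_eq0 (sqr_nm hV) // (rpBl hV) // wk ?gk ?subrr.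
have VSg := SV _ Vg.
rewrite wg; apply/ler_addgt0Pl => e e0.
have db : 0 < d + b by lra.
have [y Wy gy] := gW _ (divr_gt0 e0 db); have Vy := WV _ Wy; have VSy := SV _ Vy.
have hy : d * nm y <= nm (S y) by case: Wy => v Vv <-; exact: h4.
have Vgy : V (g - y) by mem.
have l1 := nm_le hV Vg Vy.
have l2 := nm_le hV VSy VSg.
have := Sb _ Vgy; rewrite (symopB hV hS) // (nmBC hV VSg VSy) => l3.
rewrite ltr_pdivlMr // in gy.
have := ler_wpM2l (ltW d0) l1; nra.
Qed.

End Gap.

(** * Orthogonal complements and finite projections *)

Section Orthogonality.
Context {R : realType} {H : completeNormedModType R[i]}.
Implicit Types (V : set H) (ip : H -> H -> R[i]) (r : seq H).

Definition perp V ip r : set H := [set u | V u /\ forall g, g \in r -> ip u g = 0].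

Lemma perpS V ip r : perp V ip r `<=` V.
Proof. by move=> u []. Qed.

Lemma linspan_sub (A V : set H) : is_subspace V -> A `<=` V -> linspan A `<=` V.
Proof. by move=> sV AV u; apply. Qed.

Lemma linspan_subspace (A : set H) : is_subspace (linspan A).
Proof.
apply: is_subspaceP; first by move=> V [sV _]; mem.
move=> k u v hu hv V VA; have [sV _] := VA.
by have := hu _ VA; have := hv _ VA => *; apply: (sub_lin sV).
Qed.

Lemma linspan_gen (A : set H) : A `<=` linspan A.
Proof. by move=> u Au V [_]; apply. Qed.

Section Fixed.
Variables (V : set H) (ip : H -> H -> R[i]).
Hypothesis hV : prehilbert V ip.
Let sV : is_subspace V. Proof. by case: hV. Qed.
Local Notation rp := (rp ip).
Local Notation nm := (nm ip).

Lemma perp_subspace r : (forall g, g \in r -> V g) -> is_subspace (perp V ip r).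
Proof.
move=> rV; apply: is_subspaceP.
  by split=> [|g gr]; [mem|rewrite (ip0l hV) //; exact: rV].
move=> k u v [Vu hu] [Vv hv]; split=> [|g gr]; first by mem.
by rewrite (ip_lin hV) ?hu ?hv ?mulr0 ?addr0 //; exact: rV.
Qed.

(** For an arbitrary set [B], because [Gs mu] and parts of eigenspaces are later recognised as
    complements of ranges and inherit completeness this way. *)
Lemma orth_complete (B : set H) : B `<=` V -> complete_in ip V V ->
  let Z := [set u | V u /\ forall g, B g -> ip u g = 0] in complete_in ip Z Z.
Proof.
move=> rV cV Z x px xC; have Vx n : V (x n) by case: (px n).
have [u Vu xu] := cV x Vx xC; exists u => //; split=> // g gr.
have Vg := rV _ gr.
have h W : is_subspace W -> W `<=` V -> (forall v n, W v -> rp (x n) v = 0) ->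
    forall v, W v -> ip u v = 0.
  move=> sW WV hW; apply: (rp_orth_ip hV sW WV) => // v Wv; have Vv := WV _ Wv.
  apply/eqP; rewrite -normr_le0; apply/ler_addgt0Pl => e e0; rewrite addr0.
  have n1 : 0 < nm v + 1 by have := nm_ge0 ip v; lra.
  have [N hN] := xu _ (divr_gt0 e0 n1); have := hN N (leqnn _).
  have -> : rp u v = - rp (x N - u) v by rewrite (rpBl hV) // hW // sub0r opprK.
  have VxN : V (x N - u) by mem.
  rewrite normrN ltr_pdivlMr // => h; apply: le_trans (normr_rp hV VxN Vv) _.
  by have := nm_ge0 ip v; have := nm_ge0 ip (x N - u); lra.
apply: (h [set v | exists k, v = k *: g]); last by exists 1; rewrite scale1r.
- apply: is_subspaceP; first by exists 0; rewrite scale0r.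
  by move=> k _ _ [k1 ->] [k2 ->]; exists (k * k1 + k2); rewrite scalerDl scalerA.
- by move=> _ [k ->]; mem.
- move=> _ n [k ->]; case: (px n) => _ /(_ g gr) h'.
  by rewrite rpE (ipZr hV) // h' mulr0.
Qed.

Lemma perp_complete r : (forall g, g \in r -> V g) -> complete_in ip V V ->
  complete_in ip (perp V ip r) (perp V ip r).
Proof. exact: (@orth_complete [set` r]). Qed.

(** One Gram-Schmidt step per vector: [x - y1] is the part of [x] orthogonal to the earlier vectors,
    and the projection of [w] gains its component along it. *)
Lemma fin_proj r w : (forall g, g \in r -> V g) -> V w ->
  exists2 y, linspan [set` r] y & forall g, g \in r -> ip (w - y) g = 0.
Proof.
elim: r w => [|x r IH] w rV Vw.
  by exists 0 => //; apply: sub0; exact: linspan_subspace.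
have rV' g : g \in r -> V g by move=> gr; apply: rV; rewrite in_cons gr orbT.
have Vx : V x by apply: rV; rewrite mem_head.
have sp : linspan [set` r] `<=` linspan [set` x :: r].
  apply: linspan_sub; first exact: linspan_subspace.
  by move=> u ur; apply: linspan_gen; rewrite /= in_cons ur orbT.
have sL := linspan_subspace [set` x :: r].
have spV : linspan [set` r] `<=` V by apply: linspan_sub.
have [y1 y1r hy1] := IH x rV' Vx; have Vy1 := spV _ y1r.
have [y2 y2r hy2] := IH w rV' Vw; have Vy2 := spV _ y2r.
have Vxy1 : V (x - y1) by mem.
have orth g z : V g -> (forall g', g' \in r -> ip g g' = 0) -> linspan [set` r] z ->
    ip g z = 0.
  move=> Vg hg zr.
  suff : [set v | V v /\ ip g v = 0] z by case.
  apply: (linspan_sub _ _ zr); last by move=> v vr; split; [exact: rV'|exact: hg].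
  apply: is_subspaceP; first by split; [mem|rewrite (ip0r hV)].
  move=> k u v [Vu hu] [Vv hv]; split; first by mem.
  by rewrite (ipDr hV) ?(ipZr hV) ?hu ?hv ?mulr0 ?addr0 //; mem.
have [x0|x0] := eqVneq (x - y1) 0.
  exists y2; first exact: sp.
  move=> g; rewrite in_cons => /orP[/eqP->|]; last exact: hy2.
  move/eqP: x0; rewrite subr_eq0 => /eqP->; apply: orth => //; mem.
have xx := rp_gt0 hV Vxy1 x0.
pose k := ip w (x - y1) / ip (x - y1) (x - y1).
exists (y2 + k *: (x - y1)).
  apply: (subD sL); first exact: sp.
  apply: (subZ sL); apply: (subB sL); last exact: sp.
  by apply: linspan_gen; rewrite /= mem_head.
have main g : g \in r -> ip (w - (y2 + k *: (x - y1))) g = 0.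
  move=> gr; have Vg := rV' _ gr.
  rewrite opprD addrA (ipBl hV) ?(ipZl hV) ?hy2 ?hy1 //; try by mem.
  by rewrite mulr0 subrr.
move=> g; rewrite in_cons => /orP[/eqP->|]; last exact: main.
have Vall : V (w - (y2 + k *: (x - y1))) by mem.
rewrite -{2}(subrK y1 x) (ipDr hV) // (orth _ y1) // addr0.
rewrite opprD addrA (ipBl hV) ?(ipZl hV) //; try by mem.
rewrite (ipBl hV) // [ip y2 _](ip_eq0C hV) //; last first.
  by rewrite orth.
rewrite subr0 /k divfK ?subrr // (ipE hV) //.
by apply/eqP => /(congr1 (@complex.Re R)) /= h; rewrite h ltxx in xx.
Qed.

End Fixed.
End Orthogonality.

(** * Finite codimension *)

Section FiniteCodimension.
Context {R : realType} {H : completeNormedModType R[i]}.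
Variables (V V' : set H) (ip ip' : H -> H -> R[i]) (S : H -> H).
Hypotheses (hV : prehilbert V ip) (hV' : prehilbert V' ip').
Hypothesis cV : complete_in ip V V.
Hypothesis SV : forall u, V u -> V' (S u).
Hypothesis Sl : forall k u v, V u -> V v -> S (k *: u + v) = k *: S u + S v.
Hypothesis Sb : exists2 b, 0 < b & forall u, V u -> nm ip' (S u) <= b * nm ip u.
Let sV : is_subspace V. Proof. by case: hV. Qed.
Let sV' : is_subspace V'. Proof. by case: hV'. Qed.

Let SZ k u : V u -> S (k *: u) = k *: S u.
Proof.
move=> Vu; have V0 := sub0 sV.
have S0 : S 0 = 0.
  have /eqP := Sl 1 V0 V0; rewrite !scale1r addr0.
  by rewrite -[X in X == _]addr0 (inj_eq (addrI _)) eq_sym => /eqP.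
by rewrite -[k *: u]addr0 Sl // S0 addr0.
Qed.

Let SB u v : V u -> V v -> S (u - v) = S u - S v.
Proof.
move=> Vu Vv; rewrite addrC -scaleN1r Sl // scaleN1r addrC //.
Qed.

(** One vector [g] of [r] is released at a time. This adds at most one dimension, spanned by some
    [e], and injectivity keeps [S e] at positive distance from the image of the old space. *)
Lemma bdd_below_finite_codim r0 r : (forall g, g \in r0 -> V g) ->
  (forall g, g \in r -> V g) ->
  (forall u, perp V ip r0 u -> S u = 0 -> u = 0) ->
  (exists2 c, 0 < c & forall u, perp V ip (r ++ r0) u -> c * nm ip u <= nm ip' (S u)) ->
  exists2 c, 0 < c & forall u, perp V ip r0 u -> c * nm ip u <= nm ip' (S u).
Proof.
move=> r0V rV inj; elim: r rV => [//|g r IH] rV [c c0 hc].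
have rV' g' : g' \in r -> V g' by move=> gr; apply: rV; rewrite in_cons gr orbT.
have Vg : V g by apply: rV; rewrite mem_head.
apply: IH => //.
have r1V g' : g' \in r ++ r0 -> V g'.
  by rewrite mem_cat => /orP[/rV'|/r0V].
have r2V g' : g' \in (g :: r) ++ r0 -> V g'.
  by rewrite in_cons => /orP[/eqP->//|]; exact: r1V.
have [b b0 Sbb] := Sb.
have [h|/existsNP[e1]] := pselect (forall u, perp V ip (r ++ r0) u -> ip u g = 0).
  exists c => // u pu; apply: hc; case: (pu) => Vu hu; split=> // g'.
  by rewrite in_cons => /orP[/eqP->|]; [exact: h|exact: hu].
move=> /not_implyP[pe1 /eqP e1g].
pose e := (ip e1 g)^-1 *: e1.
have sp1 := perp_subspace hV r1V.
have sp2 := perp_subspace hV r2V.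
have pe : perp V ip (r ++ r0) e by exact: (subZ sp1).
have Ve : V e by case: pe.
have eg : ip e g = 1 by case: pe1 => Ve1 _; rewrite /e (ipZl hV) // mulVf.
have sub12 : perp V ip ((g :: r) ++ r0) `<=` perp V ip (r ++ r0).
  by move=> u [Vu hu]; split=> // g' g'r; apply: hu; rewrite in_cons g'r orbT.
(* Otherwise some $S v_n$ tend to $S e$; the old lower bound makes $v_n$ Cauchy, and its limit [u]
   satisfies $S(e-u)=0$. Then $u=e$, against $(u,g)=0$ and $(e,g)=1$. *)
have [rho rho0 hrho] : exists2 rho, 0 < rho & forall v,
    perp V ip ((g :: r) ++ r0) v -> rho <= nm ip' (S (e - v)).
  apply: contrapT => hn.
  have /choice[v vP] n : exists v, perp V ip ((g :: r) ++ r0) v /\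
      nm ip' (S (e - v)) < n.+1%:R^-1.
    apply: contrapT => hn2; apply: hn; exists n.+1%:R^-1; first by rewrite invr_gt0 ltr0n.
    by move=> v pv; rewrite leNgt; apply/negP => lt; apply: hn2; exists v.
  have pv n : perp V ip ((g :: r) ++ r0) (v n) by case: (vP n).
  have Vv n : V (v n) by case: (pv n).
  have Vev n : V (e - v n) by mem.
  have VS n : V' (S (e - v n)) by exact: SV.
  have [||u pu hu] := @perp_complete _ _ _ _ hV ((g :: r) ++ r0) r2V cV v.
  - exact: pv.
  - move=> eps eps0; have ce : 0 < c * eps / 2 by rewrite divr_gt0 // mulr_gt0.
    have [N hN] := invSn_lt ce; exists N => m n Nm Nn.
    rewrite -(ltr_pM2l c0); apply: le_lt_trans (hc _ _) _.
      by apply: (subB sp2).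
    have -> : S (v m - v n) = S (e - v n) - S (e - v m).
      rewrite -SB //; congr S.
      by rewrite opprB [RHS]addrC addrA subrK.
    apply: le_lt_trans (nm_triangleB hV' (VS n) (VS m)) _.
    have [_ a1] := vP m; have [_ a2] := vP n.
    move: (hN _ Nm) (hN _ Nn) a1 a2; move: (m.+1%:R^-1) (n.+1%:R^-1) => y z; lra.
  have Vu : V u by case: pu.
  have Veu : V (e - u) by mem.
  have eu0 : e - u = 0.
    apply: inj.
      have [_ hpu] := pu; have [_ hpe] := pe.
      split=> // g' g'r; rewrite (ipBl hV) ?hpe ?hpu ?subrr //; try exact: r0V.
        by rewrite !mem_cat g'r orbT.
      by rewrite mem_cat g'r orbT.
    apply: (nm_eq0 hV'); first exact: SV.
    apply/eqP; rewrite eq_le nm_ge0 andbT; apply/ler_addgt0Pl => eps eps0.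
    rewrite addr0; have e2 : 0 < eps / 2 by rewrite divr_gt0.
    have [N1 hN1] := invSn_lt e2; have [N2 hN2] := hu _ (divr_gt0 e2 b0).
    pose n := maxn N1 N2.
    have -> : S (e - u) = S (e - v n) + S (v n - u).
      rewrite -[S (e - v n)]scale1r -Sl //; last by mem.
      by rewrite scale1r addrA subrK.
    have Vvu : V (v n - u) by mem.
    apply: le_trans (nm_triangle hV' (VS n) (SV Vvu)) _.
    have := Sbb _ Vvu; have := hN2 n (leq_maxr _ _).
    rewrite ltr_pdivlMr // => a1 a2; have := hN1 n (leq_maxl _ _).
    have [_] := vP n; move: (n.+1%:R^-1) => z; lra.
  have : ip (e - u) g = 0 by rewrite eu0 (ip0l hV).
  rewrite (ipBl hV) // eg; have [_ ->] := pu; last by rewrite mem_head.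
  by rewrite subr0 => /eqP; rewrite oner_eq0.
(* With $u = ke + v$ and $k=(u,g)$, the bounds $|k| \le \rho^{-1}\|Su\|$ and $c\|v\| \le \|Su\| +
   |k|\|Se\|$ add up to [K]. *)
pose K := rho^-1 * nm ip e + c^-1 * (1 + rho^-1 * nm ip' (S e)).
have ri : 0 < rho^-1 by rewrite invr_gt0.
have ci : 0 < c^-1 by rewrite invr_gt0.
have K0 : 0 < K.
  have := nm_ge0 ip e; have := nm_ge0 ip' (S e) => a1 a2; rewrite /K.
  have := mulr_ge0 (ltW ri) a1; have := mulr_ge0 (ltW ri) a2 => a3 a4.
  have : 0 < c^-1 * (1 + rho^-1 * nm ip' (S e)) by apply: mulr_gt0 => //; lra.
  by lra.
exists K^-1; first by rewrite invr_gt0.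
move=> u pu; have Vu : V u by case: pu.
rewrite ler_pdivrMl //.
pose k := ip u g; pose v := u - k *: e.
have pv : perp V ip ((g :: r) ++ r0) v.
  have pv1 : perp V ip (r ++ r0) v by apply: (subB sp1) => //; exact: (subZ sp1).
  case: pv1 => Vv hv; split=> // g'; rewrite in_cons => /orP[/eqP->|]; last exact: hv.
  rewrite /v (ipBl hV) //; last by mem.
  by rewrite (ipZl hV) // eg mulr1 subrr.
have Vv : V v by case: pv.
have VSu := SV Vu; have VSe := SV Ve; have VSv := SV Vv.
have kr : ComplexField.Normc.normc k * rho <= nm ip' (S u).
  have [k0|k0] := eqVneq k 0.
    by rewrite k0 ComplexField.Normc.normc0 mul0r nm_ge0.
  have -> : u = k *: (e - (- k^-1) *: v).
    by rewrite scaleNr opprK scalerDr (scalerA k k^-1) mulfV // scale1r /v addrC subrK.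
  have Vw : V (e - - k^-1 *: v) by mem.
  rewrite SZ // (nmZ hV'); last exact: SV.
  rewrite ler_wpM2l //; last by apply: hrho; exact: (subZ sp2).
  by case: (k) => x y; exact: sqrtr_ge0.
have hu : nm ip u <= ComplexField.Normc.normc k * nm ip e + nm ip v.
  rewrite -(nmZ hV) // -{1}(subrK (k *: e) u) addrC.
  by apply: (nm_triangle hV); mem.
have hv : c * nm ip v <= nm ip' (S u) + ComplexField.Normc.normc k * nm ip' (S e).
  apply: le_trans (hc _ pv) _.
  rewrite -(nmZ hV') // /v SB //; last by mem.
  by rewrite SZ //; apply: (nm_triangleB hV'); mem.
have hk : ComplexField.Normc.normc k <= rho^-1 * nm ip' (S u).
  by rewrite ler_pdivlMl // mulrC.
have hv' : nm ip v <= c^-1 * (nm ip' (S u) + ComplexField.Normc.normc k * nm ip' (S e)).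
  by rewrite ler_pdivlMl.
apply: le_trans hu _; apply: le_trans (lerD (ler_wpM2r (nm_ge0 _ _) hk) hv') _.
rewrite /K -lerBrDl.
have -> : (rho^-1 * nm ip e + c^-1 * (1 + rho^-1 * nm ip' (S e))) * nm ip' (S u) -
  rho^-1 * nm ip' (S u) * nm ip e = c^-1 * (nm ip' (S u) + rho^-1 * nm ip' (S u) * nm ip' (S e)).
  by ring.
by rewrite ler_pM2l // lerD2l ler_wpM2r ?nm_ge0.
Qed.

End FiniteCodimension.

Lemma underdetermined {K : fieldType} (n m : nat) (A : 'I_n -> 'I_m -> K) :
  (m < n)%N -> exists c : 'I_n -> K, (exists i, c i != 0) /\
    forall j, \sum_i c i * A i j = 0.
Proof.
move=> mn; pose M := (\matrix_(i, j) A i j)%R : 'M[K]_(n, m).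
have kM : kermx M != 0.
  rewrite -mxrank_eq0 mxrank_ker subn_eq0 -ltnNge.
  exact: leq_ltn_trans (rank_leq_col _) mn.
have [i ri] : exists i, row i (kermx M) != 0.
  apply: contrapT => h; move/eqP: kM; apply; apply/row_matrixP => i.
  by rewrite row0; apply/eqP/negPn/negP => ri; apply: h; exists i.
pose c j := row i (kermx M) 0 j.
exists c; split.
  apply: contrapT => h; move/eqP: ri; apply; apply/rowP => j; rewrite [RHS]mxE.
  by apply/eqP/negPn/negP => cj; apply: h; exists j.
move=> j; have : row i (kermx M) *m M = 0 by rewrite -row_mul mulmx_ker row0.
move=> /rowP/(_ j); rewrite mxE [RHS]mxE => h.
by rewrite -[RHS]h; apply: eq_bigr => l _; rewrite [M l j]mxE.
Qed.

(** * Orthonormal sequences and dimension *)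

Section Orthonormal.
Context {R : realType} {H : completeNormedModType R[i]}.
Variables (V : set H) (ip : H -> H -> R[i]).
Hypothesis hV : prehilbert V ip.
Let sV : is_subspace V. Proof. by case: hV. Qed.
Local Notation rp := (rp ip).
Local Notation nm := (nm ip).
Implicit Types (b r : seq H).

(** [uniq] lets coefficients be indexed by the vectors themselves rather than by positions. *)
Definition onseq b : Prop :=
  [/\ uniq b, forall x, x \in b -> V x &
      forall x y, x \in b -> y \in b -> ip x y = (x == y)%:R].

Definition fourier b u : H := \sum_(x <- b) ip u x *: x.

Lemma onseq_ip_suml b (c : H -> R[i]) y : onseq b -> y \in b ->
  ip (\sum_(x <- b) c x *: x) y = c y.
Proof.
move=> [ub bV bo] yb; have Vy := bV _ yb.
rewrite big_seq (ip_suml hV) //; last by move=> x xb; apply: (subZ sV); exact: bV.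
rewrite -big_seq (bigD1_seq y) //= (ipZl hV) // bo // eqxx mulr1.
rewrite big_seq_cond big1 ?addr0 // => x /andP[xb xy].
by rewrite (ipZl hV) ?bo // ?(negbTE xy) ?mulr0 //; exact: bV.
Qed.

Lemma onseq_sum_in b (c : H -> R[i]) : onseq b -> V (\sum_(x <- b) c x *: x).
Proof.
move=> [ub bV bo]; rewrite big_seq; apply: (sub_sum sV) => x xb.
by apply: (subZ sV); exact: bV.
Qed.

Lemma onseq_ip_sumr b (c : H -> R[i]) w : onseq b -> V w ->
  ip w (\sum_(x <- b) c x *: x) = \sum_(x <- b) (c x)^*%C * ip w x.
Proof.
move=> ob Vw; have [ub bV bo] := ob.
rewrite (ipC hV) //; last exact: onseq_sum_in.
rewrite big_seq (ip_suml hV) //; last by move=> x xb; apply: (subZ sV); exact: bV.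
rewrite rmorph_sum [RHS]big_seq; apply: eq_bigr => x xb.
have Vx := bV _ xb.
by rewrite (ipZl hV) // rmorphM /= -(ipC hV).
Qed.

(** With weights equal to eigenvalues or to 1, this yields $\|f\|^2$, $(Tf,f)$ and $\|Tf\|^2$ for a
    combination [f] of eigenvectors. *)
Lemma onseq_rp_sum b (s t : H -> R) (c : H -> R[i]) : onseq b ->
  rp (\sum_(x <- b) ((s x)%:C * c x) *: x) (\sum_(x <- b) ((t x)%:C * c x) *: x) =
  \sum_(x <- b) s x * t x * complex.Re (c x * (c x)^*%C).
Proof.
move=> ob; rewrite rpE onseq_ip_sumr //; last exact: onseq_sum_in.
rewrite raddf_sum [RHS]big_seq big_seq; apply: eq_bigr => x xb.
rewrite (onseq_ip_suml _ ob) //=; case: (c x) => y z /=; ring.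
Qed.

Lemma Re_mul_conj_ge0 (z : R[i]) : 0 <= complex.Re (z * z^*%C).
Proof. by case: z => x y /=; rewrite mulrN opprK -!expr2 addr_ge0 ?sqr_ge0. Qed.

Lemma fourier_in b u : onseq b -> V (fourier b u).
Proof. exact: onseq_sum_in. Qed.

Lemma fourier_ip b u y : onseq b -> y \in b -> ip (fourier b u) y = ip u y.
Proof. exact: onseq_ip_suml. Qed.

Lemma fourier_perp b u : onseq b -> V u -> perp V ip b (u - fourier b u).
Proof.
move=> ob Vu; have Vf := fourier_in u ob; have [_ bV _] := ob.
split=> [|g gb]; first by mem.
by rewrite (ipBl hV) ?fourier_ip ?subrr //; exact: bV.
Qed.

Lemma onseq_cat b r : onseq b -> onseq r ->
  (forall x y, x \in b -> y \in r -> ip x y = 0) -> onseq (b ++ r).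
Proof.
move=> [ub bV bo] [ur rV ro] br.
have neq x y : x \in b -> y \in r -> (x == y) = false.
  move=> xb yr; apply/eqP => xy; have := br x y xb yr.
  by rewrite -xy bo // eqxx => /eqP; rewrite oner_eq0.
split.
- rewrite cat_uniq ub ur andbT /=; apply/hasPn => x xr; apply/negP => xb.
  by have := neq x x xb xr; rewrite eqxx.
- by move=> x; rewrite mem_cat => /orP[/bV|/rV].
- move=> x y; rewrite !mem_cat => /orP[xb|xr] /orP[yb|yr].
  + by rewrite bo.
  + by rewrite br // neq.
  + rewrite (ip_eq0C hV _ _ (br _ _ yb xr)); [|exact: bV|exact: rV].
    by rewrite eq_sym neq.
  + by rewrite ro.
Qed.

Lemma onseq1 x : V x -> ip x x = 1 -> onseq [:: x].
Proof.
move=> Vx x1; split=> //; first by move=> y; rewrite inE => /eqP->.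
by move=> y z; rewrite !inE => /eqP-> /eqP->; rewrite eqxx.
Qed.

Lemma onseq_normalize u : V u -> u != 0 -> exists k, ip (k *: u) (k *: u) = 1.
Proof.
move=> Vu u0; have n0 := nm_gt0 hV Vu u0; exists (nm u)^-1%:C.
have Vk : V ((nm u)^-1%:C *: u) by mem.
rewrite (ipE hV) // -(sqr_nm hV) // (nmZr hV) // ger0_norm ?invr_ge0 ?nm_ge0 //.
by rewrite mulVf ?gt_eqF // expr1n.
Qed.

Lemma onseq_filter b (p : pred H) : onseq b -> onseq (seq.filter p b).
Proof.
move=> [ub bV bo]; split; first exact: filter_uniq.
  by move=> x; rewrite mem_filter => /andP[_ /bV].
by move=> x y; rewrite !mem_filter => /andP[_ ?] /andP[_ ?]; exact: bo.
Qed.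

(** [P] is only stable under scalars because it will be the union of the eigenspaces for all
    eigenvalues in the window, which is not a subspace. A longest sequence exists by the bound [M]
    and cannot be extended. *)
Lemma max_onseq (P : set H) (M : nat) : P `<=` V ->
  (forall k u, P u -> P (k *: u)) ->
  (forall b, onseq b -> (forall x, x \in b -> P x) -> (size b <= M)%N) ->
  exists b, [/\ onseq b, forall x, x \in b -> P x &
    forall u, P u -> (forall x, x \in b -> ip u x = 0) -> u = 0].
Proof.
move=> PV PZ bM.
pose Q n := `[< exists b, [/\ onseq b, forall x, x \in b -> P x & size b = n] >].
have Q0 : exists n, Q n by exists 0%N; apply/asboolP; exists [::]; split.
have QM n : Q n -> (n <= M)%N by move=> /asboolP[b [ob bP <-]]; exact: bM.
case: (ex_maxnP Q0 QM) => n /asboolP[b [ob bP bn]] maxn.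
exists b; split=> // u Pu ub; apply/eqP/negPn/negP => u0.
have Vu := PV _ Pu; have [k k1] := onseq_normalize Vu u0.
have Vk : V (k *: u) by mem.
have [_ bV _] := ob.
suff : Q n.+1 by move=> /maxn; rewrite ltnn.
apply/asboolP; exists ([:: k *: u] ++ b); split; last by rewrite /= bn.
  apply: onseq_cat => //; first exact: onseq1.
  move=> x y; rewrite inE => /eqP-> yb.
  by rewrite (ipZl hV) ?ub ?mulr0 //; exact: bV.
by move=> x; rewrite inE => /orP[/eqP->|/bP //]; exact: PZ.
Qed.

Lemma onseq_lin_indep b : onseq b -> lin_indep (fun i : 'I_(size b) => b`_i).
Proof.
move=> ob c; have [ub bV bo] := ob.
move=> h i; have bi : b`_i \in b by exact: mem_nth.
have : ip (\sum_i c i *: b`_i) b`_i = 0 by rewrite h (ip0l hV) //; exact: bV.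
have Vb j : V b`_(nat_of_ord (j : 'I_(size b))) by apply: bV; exact: mem_nth.
rewrite (ip_suml hV) //; last by move=> j _; mem.
rewrite (bigD1 i) //= big1 => [|j ji].
  by rewrite addr0 (ipZl hV) // bo // eqxx mulr1.
rewrite (ipZl hV) // bo //; last exact: mem_nth.
by rewrite nth_uniq // (negbTE ji : (j == i :> nat) = false) mulr0.
Qed.

Lemma orthogonal_combination n (w : 'I_n -> H) r : (forall i, V (w i)) ->
  (forall g, g \in r -> V g) -> (size r < n)%N ->
  exists k : 'I_n -> R[i], (exists i, k i != 0) /\
    forall g, g \in r -> ip (\sum_i k i *: w i) g = 0.
Proof.
move=> wV rV rn.
have [k [k0 hk]] := underdetermined (fun i (j : 'I_(size r)) => ip (w i) r`_j) rn.
exists k; split=> // g gr; have Vg := rV _ gr.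
rewrite (ip_suml hV) //; last by move=> i _; apply: (subZ sV).
have gi : (index g r < size r)%N by rewrite index_mem.
have := hk (Ordinal gi); rewrite /= nth_index // => h; rewrite -[RHS]h.
by apply: eq_bigr => i _; rewrite (ipZl hV).
Qed.

Lemma onseq_combination b r : onseq b -> (forall g, g \in r -> V g) ->
  (size r < size b)%N -> exists u, [/\ V u, u = fourier b u, u != 0 &
    forall g, g \in r -> ip u g = 0].
Proof.
move=> ob rV rb; have [ub bV bo] := ob.
have Vb (i : 'I_(size b)) : V b`_i by apply: bV; exact: mem_nth.
have [k [[i0 k0] hk]] := orthogonal_combination Vb rV rb.
have Vu : V (\sum_i k i *: b`_i).
  by apply: (sub_sum sV) => i _; apply: (subZ sV).
exists (\sum_i k i *: b`_i); split=> //.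
  have E j : ip (\sum_i k i *: b`_i) b`_(nat_of_ord (j : 'I_(size b))) = k j.
    rewrite (ip_suml hV) //; last by move=> i _; apply: (subZ sV).
    rewrite (bigD1 j) //= big1 => [|i ij].
      by rewrite addr0 (ipZl hV) // bo ?mem_nth // eqxx mulr1.
    rewrite (ipZl hV) // bo ?mem_nth //.
    by rewrite nth_uniq // (negbTE ij : (i == j :> nat) = false) mulr0.
  rewrite /fourier (big_nth 0) big_mkord; apply: eq_bigr => j _.
  by rewrite E.
by apply/eqP => /(onseq_lin_indep ob) /(_ i0) => h; rewrite h eqxx in k0.
Qed.

Lemma hdim_ge (W : set H) n (f : 'I_n -> H) : (forall i, W (f i)) ->
  lin_indep f -> (n%:R%:E <= hdim W)%E.
Proof. by move=> Wf lf; apply: ereal_sup_ubound; exists n => //; exists f. Qed.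

Lemma hdim_onseq (W : set H) b : W `<=` V -> is_subspace W ->
  onseq b -> (forall x, x \in b -> W x) ->
  (forall u, W u -> (forall x, x \in b -> ip u x = 0) -> u = 0) ->
  hdim W = (size b)%:R%:E.
Proof.
move=> WV sW ob bW hW; apply/eqP; rewrite eq_le; apply/andP; split; last first.
  by apply: (hdim_ge _ (onseq_lin_indep ob)) => i; apply: bW; exact: mem_nth.
apply: ub_ereal_sup => _ [n [f Wf lf] <-]; rewrite lee_fin ler_nat leqNgt.
apply/negP => bn; have [_ bV _] := ob.
have [k [[i k0] hk]] := orthogonal_combination (fun i => WV _ (Wf i)) bV bn.
have := lf k; rewrite (hW (\sum_i k i *: f i)) //; last first.
  by apply: (sub_sum sW) => j _; apply: (subZ sW).
by move=> /(_ erefl i) h; rewrite h eqxx in k0.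
Qed.

Lemma hdim_fin_onseq (W : set H) : W `<=` V -> is_subspace W ->
  (hdim W < +oo)%E ->
  exists b, [/\ onseq b, forall x, x \in b -> W x &
    forall u, W u -> (forall x, x \in b -> ip u x = 0) -> u = 0].
Proof.
move=> WV sW fW.
have [M hM] : exists M : nat, (hdim W <= M%:R%:E)%E.
  have h0 : (0 <= hdim W)%E.
    by apply: ereal_sup_ubound; exists 0%N => //; exists (fun=> 0) => //; [case|move=> c _ []].
  move: h0 fW; case: (hdim W) => // x; rewrite lee_fin => x0 _.
  by exists (Num.truncn x).+1; rewrite lee_fin; apply/ltW/truncnS_gt.
apply: (max_onseq WV (M := M)); first by move=> k u Wu; mem.
move=> b ob bW; have : ((size b)%:R%:E <= hdim W)%E.
  by apply: (hdim_ge _ (onseq_lin_indep ob)) => i; apply: bW; exact: mem_nth.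
by move=> /le_trans/(_ hM); rewrite lee_fin ler_nat.
Qed.

Lemma onseq_expansion (W : set H) b u : W `<=` V -> is_subspace W ->
  onseq b -> (forall x, x \in b -> W x) ->
  (forall u, W u -> (forall x, x \in b -> ip u x = 0) -> u = 0) ->
  W u -> u = fourier b u.
Proof.
move=> WV sW ob bW hW Wu; apply/eqP; rewrite -subr_eq0; apply/eqP.
have Wf : W (fourier b u).
  by rewrite /fourier big_seq; apply: (sub_sum sW) => x /bW Wx; mem.
apply: hW; first by mem.
by case: (fourier_perp ob (WV _ Wu)).
Qed.

End Orthonormal.

(** * Counting eigenvalues in a window *)

Section SpectrumCount.
Context {R : realType} {H : completeNormedModType R[i]}.
Variables (V : set H) (ip : H -> H -> R[i]) (T : operator H).
Hypotheses (hV : prehilbert V ip) (cV : complete_in ip V V).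
Hypotheses (domT : dom T = V) (hT : symop V ip T).
Let sV : is_subspace V. Proof. by case: hV. Qed.
Let TV u : V u -> V (T u). Proof. by case: hT => h _ _ _; exact: h. Qed.
Local Notation rp := (rp ip).
Local Notation nm := (nm ip).

Lemma bdd_below_resolvent t : bdd_below V ip (opshift T t) ->
  resolvent_set ip V T t%:C.
Proof.
move=> bT; have hS := symop_shift hV t hT.
split.
  move=> f Vf; have [u Vu uf] := symop_surj hV cV hS bT Vf.
  exists u; split=> [|v []]; rewrite domT => //.
  move=> Vv vf; apply/eqP; rewrite -subr_eq0; apply/eqP.
  have Vuv : V (u - v) by mem.
  by apply: (bdd_below_inj hV bT Vuv); rewrite (symopB hV hS) // uf -vf subrr.
have [c c0 hc] := bT.
exists (c^-1 ^+ 2) => u; rewrite domT => Vu; have VTu := TV Vu.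
have VS : V (T u - t%:C *: u) by mem.
rewrite !(ipE hV) // -rmorphM lecR -!(sqr_nm hV) // -exprMn.
have c1 : 0 <= c^-1 by rewrite invr_ge0 ltW.
rewrite ler_pXn2r ?nnegrE ?nm_ge0 ?mulr_ge0 //; last exact: nm_ge0.
by rewrite ler_pdivlMl // hc.
Qed.

Lemma eigenvalue_spectrum z : op_eigenvalue T z -> op_spectrum ip V T z.
Proof.
move=> [u u0 [du Tu]] [h _]; have [v [_ hv]] := h 0 (sub0 sV).
have V0 := sub0 sV.
move/eqP: u0; apply; rewrite -(hv u); last by split=> //; rewrite Tu subrr.
by apply: hv; rewrite domT (symop0 hV hT) scaler0 subr0.
Qed.

Section Window.
Variables (e c : R) (r : seq H).
Hypotheses (e0 : 0 < e) (ec : e < c) (rV : forall g, g \in r -> V g).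
Hypothesis hr : forall u, perp V ip r u -> c * nm u <= nm (T u).

Let P u := V u /\ exists2 t, `|t| < e & T u = t%:C *: u.
Let ev u := rp (T u) u.

Section Basis.
Variable b : seq H.
Hypotheses (ob : onseq V ip b) (bP : forall x, x \in b -> P x).

Let bV x : x \in b -> V x. Proof. by case: ob => _ h _; exact: h. Qed.

Let evP x : x \in b -> `|ev x| < e /\ T x = (ev x)%:C *: x.
Proof.
move=> xb; have Vx := bV xb; have [_ [t te Tx]] := bP xb.
suff -> : ev x = t by [].
rewrite /ev Tx (rpZl hV) // rpE; case: ob => _ _ -> //.
by rewrite eqxx mulr1.
Qed.

Lemma T_fourier u : T (fourier ip b u) = \sum_(x <- b) ((ev x)%:C * ip u x) *: x.
Proof.
rewrite /fourier.
suff h s : (forall x, x \in s -> x \in b) ->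
    T (\sum_(x <- s) ip u x *: x) = \sum_(x <- s) ((ev x)%:C * ip u x) *: x by exact: h.
elim: s => [|x s IH] sb; first by rewrite !big_nil (symop0 hV hT).
have xb : x \in b by apply: sb; rewrite mem_head.
have sb' y : y \in s -> y \in b by move=> ys; apply: sb; rewrite in_cons ys orbT.
have [_ Tx] := evP xb.
have Vx := bV xb; have [_ Tl _ _] := hT.
rewrite !big_cons Tl //; first by rewrite IH // {1}Tx scalerA mulrC.
by rewrite big_seq; apply: (sub_sum sV) => y /sb'/bV Vy; mem.
Qed.

Let nmf u : V u -> nm (fourier ip b u) ^+ 2 =
  \sum_(x <- b) complex.Re (ip u x * (ip u x)^*%C).
Proof.
move=> Vu; rewrite (sqr_nm hV); last exact: fourier_in.
have := onseq_rp_sum hV (fun=> 1) (fun=> 1) (ip u) ob.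
rewrite (eq_bigr (fun x => ip u x *: x)) => [->|x _]; last by rewrite mul1r.
by apply: eq_bigr => x _; rewrite !mul1r.
Qed.

Let nmTf u : V u -> nm (T (fourier ip b u)) ^+ 2 =
  \sum_(x <- b) ev x * ev x * complex.Re (ip u x * (ip u x)^*%C).
Proof.
move=> Vu; rewrite (sqr_nm hV); last by apply: TV; exact: fourier_in.
by rewrite T_fourier (onseq_rp_sum hV _ _ _ ob).
Qed.

Let rpTf u : V u -> rp (T (fourier ip b u)) (fourier ip b u) =
  \sum_(x <- b) ev x * complex.Re (ip u x * (ip u x)^*%C).
Proof.
move=> Vu; rewrite T_fourier.
have := onseq_rp_sum hV ev (fun=> 1) (ip u) ob.
rewrite [X in rp _ X](eq_bigr (fun x => ip u x *: x)) => [->|x _]; last by rewrite mul1r.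
by apply: eq_bigr => x _; rewrite mulr1.
Qed.

(** More than [size r] eigenvectors would have a nonzero combination orthogonal to [r], which [T]
    stretches by at most [e] and by at least [c > e]. *)
Lemma eigenvectors_bound : (size b <= size r)%N.
Proof.
rewrite leqNgt; apply/negP => rb.
have [u [Vu uf u0 ur]] := onseq_combination hV ob rV rb.
have h1 : c * nm u <= nm (T u) by apply: hr.
have h2 : nm (T u) ^+ 2 <= e ^+ 2 * nm u ^+ 2.
  rewrite uf nmTf // nmf // mulr_sumr big_seq [leRHS]big_seq; apply: ler_sum => x xb.
  rewrite ler_wpM2r ?Re_mul_conj_ge0 // -expr2 -real_normK ?num_real //.
  have [ee _] := evP xb.
  by rewrite ler_pXn2r ?nnegrE ?(ltW e0) ?(ltW ee).
rewrite -exprMn ler_pXn2r ?nnegrE ?nm_ge0 ?mulr_ge0 ?(ltW e0) ?nm_ge0 // in h2.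
have := le_trans h1 h2; rewrite ler_pM2r ?(nm_gt0 hV) // => h3.
by have := lt_le_trans ec h3; rewrite ltxx.
Qed.

Hypothesis maxb : forall u, P u -> (forall x, x \in b -> ip u x = 0) -> u = 0.

Let perp_T u : perp V ip b u -> perp V ip b (T u).
Proof.
move=> [Vu ub]; split=> [|g gb]; first exact: TV.
have Vg := bV gb; have [_ Tg] := evP gb.
by rewrite (symop_ip hV hT) // Tg (ipZr hV) // ub // mulr0.
Qed.

(** On the complement of [r], [T - s] is bounded below by $c - |s|$; the remaining constraints are
    finitely many, so injectivity alone upgrades to a lower bound. *)
Let bdd_perp (r0 : seq H) s : `|s| < e -> (forall g, g \in r0 -> V g) ->
  (forall u, perp V ip r0 u -> opshift T s u = 0 -> u = 0) ->
  exists2 d, 0 < d & forall u, perp V ip r0 u -> d * nm u <= nm (opshift T s u).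
Proof.
move=> se r0V inj; have [SV Sl Ss Sb] := symop_shift hV s hT.
apply: (bdd_below_finite_codim hV hV cV SV Sl Sb r0V rV inj).
exists (c - `|s|); first by rewrite subr_gt0 (lt_trans se).
move=> u [Vu hu]; have VTu := TV Vu.
have h : perp V ip r u by split=> // g gr; apply: hu; rewrite mem_cat gr.
rewrite mulrBl; apply: le_trans (lerB (hr h) (lexx _)) _.
by rewrite -(nmZr hV) // (nm_dist hV) //; mem.
Qed.

(** By maximality of [b] its complement contains no eigenvector for [|s| < e]. So every such [T - s]
    is bounded below there, and [symop_lower_bound] applies with this complement as the whole
    space. *)
Let perp_lower u : perp V ip b u -> e * nm u <= nm (T u).
Proof.
move=> pu; have pV := @perpS _ _ V ip b.
have sp := perp_subspace hV bV.
have hp := prehilbertS hV sp pV.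
have hTp : symop (perp V ip b) ip T.
  case: hT => _ Tl Ts [k k0 Tk]; split.
  - exact: perp_T.
  - by move=> a v w /pV ? /pV ?; exact: Tl.
  - by move=> v w /pV ? /pV ?; exact: Ts.
  - by exists k => // v /pV ?; exact: Tk.
apply: (symop_lower_bound hp hTp) pu => s se.
apply: bdd_perp => // v pv; case: (pv) => Vv vb.
rewrite /opshift => /eqP; rewrite subr_eq0 => /eqP Tv.
by apply: maxb => //; split=> //; exists s.
Qed.

Let spectrum_eigenvalue t : `|t| < e -> op_spectrum ip V T t%:C ->
  op_eigenvalue T t%:C.
Proof.
move=> te st; apply: contrapT => hn; apply: st; apply: bdd_below_resolvent.
have [||d d0 hd] := @bdd_perp [::] t te => //.
  move=> u [Vu _] /eqP; rewrite /opshift subr_eq0 => /eqP Tu.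
  apply/eqP/negPn/negP => u0; apply: hn; exists u => //; split=> //.
  by rewrite domT.
by exists d => // u Vu; apply: hd.
Qed.

Let eig_sub t : is_subspace (op_eigenspace T t%:C).
Proof.
rewrite /op_eigenspace domT; apply: is_subspaceP.
  by split; [mem|rewrite (symop0 hV hT) scaler0].
move=> k u v [Vu Tu] [Vv Tv]; split; first by mem.
case: hT => _ -> // _ _; rewrite Tu Tv scalerDr !scalerA.
by rewrite (mulrC k).
Qed.

Let eig_orth t u x : V u -> T u = t%:C *: u -> x \in b -> ev x != t -> ip u x = 0.
Proof.
move=> Vu Tu xb xt; have [_ Tx] := evP xb; have Vx := bV xb.
have := symop_ip hV hT Vu Vx; rewrite Tu Tx (ipZl hV) // (ipZr hV) //.
rewrite conjc_real => /eqP; rewrite -subr_eq0 -mulrBl mulf_eq0 => /orP[|/eqP //].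
by rewrite -rmorphB /= => /eqP/complexI/eqP; rewrite subr_eq0 eq_sym (negbTE xt).
Qed.

Let hdim_eig t : `|t| < e ->
  hdim (op_eigenspace T t%:C) = (count (fun x => ev x == t) b)%:R%:E.
Proof.
move=> te; rewrite -size_filter; apply: (hdim_onseq hV).
- by move=> u []; rewrite domT.
- exact: eig_sub.
- exact: onseq_filter.
- move=> x; rewrite mem_filter => /andP[/eqP xt xb]; split; first by rewrite domT; exact: bV.
  by rewrite -xt; case: (evP xb).
- move=> u [du Tu] hu; have Vu : V u by rewrite -domT.
  apply: maxb; first by split=> //; exists t.
  move=> x xb; have [xt|] := eqVneq (ev x) t; last exact: eig_orth.
  by apply: hu; rewrite mem_filter xt eqxx.
Qed.

Let ev_spectrum x : x \in b -> op_spectrum ip V T (ev x)%:C.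
Proof.
move=> xb; apply: eigenvalue_spectrum; have [_ Tx] := evP xb; have Vx := bV xb.
exists x; last by split=> //; rewrite domT.
case: ob => _ _ bo; apply/eqP => x0; have := bo x x xb xb.
by rewrite {1}x0 (ip0l hV) // eqxx => /esym/eqP; rewrite oner_eq0.
Qed.

Let spectrum_inE (I : set R) (p : pred R) : (forall t, I t -> `|t| < e) ->
  (forall t, `|t| < e -> I t <-> p t) ->
  spectrum_in ip V T I (count (p \o ev) b)%:R%:E.
Proof.
move=> Ie Ip; split; first by move=> t It; apply: spectrum_eigenvalue; exact: Ie.
set D := [set t | _].
have De t : D t -> `|t| < e by move=> [/Ie].
(* Each multiplicity becomes a sum over [b] of indicators of [ev x == t]. After exchanging the sums,
   [x] contributes one exactly when its own eigenvalue lies in [I]. *)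
rewrite (eq_esum (b := fun t => (\sum_(x <- b) (ev x == t)%:R%:E)%E)); last first.
  move=> t /De te; rewrite hdim_eig // sumEFin -sum1_count natr_sum big_mkcond /=.
  by congr EFin; apply: eq_bigr => x _; case: ifP.
rewrite esum_sum; last by move=> t x _ _; rewrite lee_fin.
rewrite -sum1_count natr_sum -sumEFin [RHS]big_mkcond /= big_seq [RHS]big_seq.
apply: eq_bigr => x xb; have [xe _] := evP xb.
have -> : \esum_(t in D) (ev x == t)%:R%:E = \esum_(t in D `&` [set ev x]) (1 : \bar R)%E.
  rewrite [RHS]esum_mkcondr; apply: eq_esum => t _; case: ifPn.
    by rewrite inE => /= ->; rewrite eqxx.
  by rewrite notin_setE /= eq_sym => /eqP/negbTE ->.
case: ifPn => px.
  rewrite (_ : D `&` _ = [set ev x]) ?esum_set1 //.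
  apply/seteqP; split=> [t []//|t ->]; split=> //; split; first by apply/Ip.
  exact: ev_spectrum.
rewrite (_ : D `&` _ = set0) ?esum_set0 //.
apply/seteqP; split=> // t [[It _] /= tx]; move/negP: px; apply.
by apply/(Ip _ xe); rewrite -tx.
Qed.

(** Split [u] into [f] in the span of [b] and [g] orthogonal to it. The part [f] contributes a
    nonpositive amount to $s(Tu,u)$, and on [g] one has $e\|g\| \le \|Tg\|$. *)
Let signed_bound (s : R) u : `|s| = 1 -> V u ->
  (forall x, x \in b -> 0 < s * ev x -> ip u x = 0) ->
  e * (s * rp (T u) u) <= nm (T u) ^+ 2.
Proof.
move=> s1 Vu us; pose f := fourier ip b u.
have [g gE] : exists g, g = u - f by exists (u - f).
have Vf : V f by exact: (fourier_in hV u ob).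
have pg : perp V ip b g by rewrite gE; exact: (fourier_perp hV ob Vu).
have Vg : V g by case: pg.
have pTg := perp_T pg; have VTg := TV Vg; have VTf := TV Vf; have VTu := TV Vu.
have ug : u = f + g by rewrite gE addrC subrK.
have orth v (d : H -> R[i]) : perp V ip b v -> ip v (\sum_(x <- b) d x *: x) = 0.
  move=> [Vv hv]; rewrite (onseq_ip_sumr hV) // big_seq big1 // => x xb.
  by rewrite hv // mulr0.
have o1 : rp (T g) f = 0 by rewrite rpE orth.
have o2 : rp (T g) (T f) = 0 by rewrite rpE T_fourier orth.
have o3 : rp (T f) g = 0.
  by rewrite (rpC hV) // rpE T_fourier orth.
have Tu : T u = T f + T g by rewrite {1}ug (symopD hT).
have E1 : rp (T u) u = rp (T f) f + rp (T g) g.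
  rewrite Tu {1}ug (rpDl hV) ?(rpDr hV) ?(rpDr hV) //; try by mem.
  by rewrite o1 o3 addr0 add0r.
have E2 : nm (T u) ^+ 2 = nm (T f) ^+ 2 + nm (T g) ^+ 2.
  rewrite !(sqr_nm hV) //.
  rewrite Tu (rpDl hV) ?(rpDr hV) ?(rpDr hV) //; try by mem.
  by rewrite (rpC hV VTf VTg) o2 add0r addr0.
have l1 : s * rp (T f) f <= 0.
  rewrite rpTf // mulr_sumr big_seq; apply: sumr_le0 => x xb; rewrite mulrA.
  have [lt|le] := ltP 0 (s * ev x); first by rewrite us // mul0r mulr0.
  by rewrite mulr_le0_ge0 // Re_mul_conj_ge0.
have l2 : s * rp (T g) g <= nm (T g) * nm g.
  apply: le_trans (ler_norm _) _; rewrite normrM s1 mul1r.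
  exact: (normr_rp hV).
have l3 := perp_lower pg.
have := nm_ge0 ip (T g); have := sqr_ge0 (nm (T f)); rewrite E2 E1 mulrDr.
have a1 := ler_wpM2l (ltW e0) l1; have a2 := ler_wpM2l (ltW e0) l2.
move=> a3 a4; have a5 := ler_wpM2l a4 l3; rewrite mulr0 in a1.
by rewrite mulrDr expr2; lra.
Qed.

Variables (p0 n0 z0 : nat).
Variables (wp : 'I_p0 -> H) (wn : 'I_n0 -> H) (wz : 'I_z0 -> H).
Hypothesis wpV : forall i, V (wp i).
Hypothesis wnV : forall i, V (wn i).
Hypothesis wzV : forall i, V (wz i).
Hypothesis wpP : forall k : 'I_p0 -> R[i], (exists i, k i != 0) ->
  let u := \sum_i k i *: wp i in nm (T u) ^+ 2 < e * rp (T u) u.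
Hypothesis wnP : forall k : 'I_n0 -> R[i], (exists i, k i != 0) ->
  let u := \sum_i k i *: wn i in nm (T u) ^+ 2 < e * - rp (T u) u.
Hypothesis wzP : forall k : 'I_z0 -> R[i], (exists i, k i != 0) ->
  let u := \sum_i k i *: wz i in u != 0 /\ T u = 0.
Hypothesis size_r : (size r <= p0 + n0 + z0)%N.

(** With fewer positive eigenvectors than test vectors, some nontrivial combination of the latter is
    orthogonal to all of the former, against [signed_bound]. *)
Let pos_ge : (p0 <= count (fun x => 0 < ev x)%R b)%N.
Proof.
rewrite leqNgt -size_filter; apply/negP => lt.
have fV x : x \in [seq x <- b | (0 < ev x)%R] -> V x.
  by rewrite mem_filter => /andP[_ /bV].
have [k [k0 hk]] := orthogonal_combination hV wpV fV lt.
have := wpP k0; set u := \sum_i _ => /= h.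
have Vu : V u by apply: (sub_sum sV) => i _; apply: (subZ sV).
have := @signed_bound 1 u (normr1 _) Vu; rewrite mul1r => h2.
have : e * rp (T u) u <= nm (T u) ^+ 2.
  by apply: h2 => x xb; rewrite mul1r => x0; apply: hk; rewrite mem_filter x0.
by rewrite leNgt h.
Qed.

Let neg_ge : (n0 <= count (fun x => ev x < 0)%R b)%N.
Proof.
rewrite leqNgt -size_filter; apply/negP => lt.
have fV x : x \in [seq x <- b | (ev x < 0)%R] -> V x.
  by rewrite mem_filter => /andP[_ /bV].
have [k [k0 hk]] := orthogonal_combination hV wnV fV lt.
have := wnP k0; set u := \sum_i _ => /= h.
have Vu : V u by apply: (sub_sum sV) => i _; apply: (subZ sV).
have := @signed_bound (-1) u (normrN1 _) Vu; rewrite mulN1r => h2.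
have : e * - rp (T u) u <= nm (T u) ^+ 2.
  apply: h2 => x xb; rewrite mulN1r oppr_gt0 => x0.
  by apply: hk; rewrite mem_filter x0.
by rewrite leNgt h.
Qed.

Let zero_ge : (z0 <= count (fun x => ev x == 0)%R b)%N.
Proof.
rewrite leqNgt -size_filter; apply/negP => lt.
have fV x : x \in [seq x <- b | (ev x == 0)%R] -> V x.
  by rewrite mem_filter => /andP[_ /bV].
have [k [k0 hk]] := orthogonal_combination hV wzV fV lt.
have := wzP k0; set u := \sum_i _ => /= -[u0 Tu].
have Vu : V u by apply: (sub_sum sV) => i _; apply: (subZ sV).
have Tu0 : T u = 0%:C *: u by rewrite scale0r.
move/eqP: u0; apply; apply: maxb.
  by split=> //; exists 0; rewrite ?normr0.
move=> x xb; have [x0|x0] := eqVneq (ev x) 0; last exact: eig_orth Tu0 xb x0.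
by apply: hk; rewrite mem_filter x0 eqxx.
Qed.

(** The three lower counts add up to at least [size r], which bounds [size b] from above, so all
    three are equalities. *)
Lemma spectrum_near0_basis : spectrum_near0 ip V T e n0%:R%:E z0%:R%:E p0%:R%:E.
Proof.
have cnt : (count (fun x => 0 < ev x)%R b + count (fun x => ev x < 0)%R b +
    count (fun x => ev x == 0)%R b = size b)%N.
  elim: (b) => //= x s <-; case: (ltgtP (ev x) 0) => _ /=; lia.
have sz := eigenvectors_bound.
have Ep : p0 = count (fun x => 0 < ev x)%R b.
  move: pos_ge neg_ge zero_ge size_r; lia.
have En : n0 = count (fun x => ev x < 0)%R b.
  move: pos_ge neg_ge zero_ge size_r; lia.
have Ez : z0 = count (fun x => ev x == 0)%R b.
  move: pos_ge neg_ge zero_ge size_r; lia.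
split.
- rewrite {1}En; apply: (spectrum_inE (p := fun t => t < 0)).
    by move=> t /= /andP[h1 h2]; rewrite ltr0_norm // ltrNl.
  move=> t; rewrite ltr_norml => /andP[h1 h2] /=.
  by split=> [/andP[]|h3]; rewrite ?h1.
- rewrite {1}Ez; apply: (spectrum_inE (p := fun t => t == 0)).
    by move=> t /= ->; rewrite normr0.
  by move=> t _ /=; split=> [->|/eqP].
- rewrite {1}Ep; apply: (spectrum_inE (p := fun t => 0 < t)).
    by move=> t /= /andP[h1 h2]; rewrite gtr0_norm.
  move=> t; rewrite ltr_norml => /andP[h1 h2] /=.
  by split=> [/andP[]|h3] //; rewrite h3.
Qed.

End Basis.

Lemma spectrum_near0_count (p0 n0 z0 : nat)
    (wp : 'I_p0 -> H) (wn : 'I_n0 -> H) (wz : 'I_z0 -> H) :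
  (forall i, V (wp i)) -> (forall i, V (wn i)) -> (forall i, V (wz i)) ->
  (forall k : 'I_p0 -> R[i], (exists i, k i != 0) ->
    let u := \sum_i k i *: wp i in nm (T u) ^+ 2 < e * rp (T u) u) ->
  (forall k : 'I_n0 -> R[i], (exists i, k i != 0) ->
    let u := \sum_i k i *: wn i in nm (T u) ^+ 2 < e * - rp (T u) u) ->
  (forall k : 'I_z0 -> R[i], (exists i, k i != 0) ->
    let u := \sum_i k i *: wz i in u != 0 /\ T u = 0) ->
  (size r <= p0 + n0 + z0)%N ->
  spectrum_near0 ip V T e n0%:R%:E z0%:R%:E p0%:R%:E.
Proof.
move=> wpV wnV wzV wpP wnP wzP sr.
have PV : P `<=` V by move=> u [].
have PZ k u : P u -> P (k *: u).
  move=> [Vu [t te Tu]]; split; first by mem.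
  by exists t => //; rewrite (symopZ hV _ hT) // Tu !scalerA mulrC.
have [b [ob bP maxb]] := max_onseq hV PV PZ (fun b ob bP => eigenvectors_bound ob bP).
exact: (spectrum_near0_basis ob bP maxb wpV wnV wzV wpP wnP wzP sr).
Qed.

End Window.
End SpectrumCount.

(** * Operators generated by forms *)

Lemma gt0_complexP {R : realType} (e : R[i]) : 0 < e -> exists2 r : R, 0 < r & e = r%:C.
Proof.
move=> e0; exists (complex.Re e); first by move: e0; rewrite ltcE => /andP[].
by rewrite RRe_real // gtr0_real.
Qed.

Section Ambient.
Context {R : realType} {H : completeNormedModType R[i]}.
Variable dot : {dot H for @Num.conj R[i]}.
Hypothesis dot_norm : forall u : H, `|u| ^+ 2 = dot u u.
Local Notation nmH := (nm dot).
Local Notation rpH := (rp dot).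

Lemma prehilbert_dot : prehilbert setT dot.
Proof.
split; first by apply: is_subspaceP.
- split=> [k u v w _ _ _|u v _ _]; first by rewrite linearPl.
  by rewrite hermC expr0 mul1r.
- by move=> u _; exact: neq0_dnorm_gt0.
Qed.
Let hD := prehilbert_dot.

Lemma normE u : `|u| = (nmH u)%:C.
Proof.
apply/eqP; rewrite -(@eqrXn2 _ 2) ?normr_ge0 ?ler0c ?nm_ge0 //.
by rewrite dot_norm -rmorphXn /= (sqr_nm hD) // (ipE hD).
Qed.

Lemma ball_nmH u (r : R) v : ball u r%:C v <-> nmH (u - v) < r.
Proof. by rewrite -ball_normE /= normE ltcR. Qed.

Lemma cvg_nmH (x : nat -> H) u : x @ \oo --> u <->
  forall e, 0 < e -> exists N, forall n, (N <= n)%N -> nmH (x n - u) < e.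
Proof.
split.
  move/cvgrPdist_lt => h e e0; have : 0 < e%:C by rewrite ltcR.
  move=> /h [N _ hN]; exists N => n /hN; rewrite normE ltcR.
  by rewrite (nmBC hD).
move=> h; apply/cvgrPdist_lt => e /gt0_complexP[r r0 ->].
have [N hN] := h r r0; exists N => // n /= Nn.
by rewrite normE ltcR (nmBC hD) //; exact: hN.
Qed.

Lemma complete_dot E : complete_in dot E setT.
Proof.
move=> x _ xC.
have : cauchy (x @ \oo).
  apply: cauchy_exP => e /gt0_complexP[r r0 ->]; have [N hN] := xC r r0.
  by exists (x N); exists N => // n /= Nn; apply/ball_nmH; exact: hN.
by move/cauchy_cvgP/cvg_ex => [u /cvg_nmH xu]; exists u.
Qed.

Lemma dense_approx (E : set H) g (e : R) : dense E -> 0 < e ->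
  exists2 v, E v & nmH (g - v) < e.
Proof.
move=> dE e0; have e0' : 0 < e%:C by rewrite ltcR.
have [|v [vb Ev]] := dE (ball g e%:C)° _ (open_interior _).
  by exists g; exact: nbhsx_ballx.
by exists v => //; apply/ball_nmH; exact: interior_subset.
Qed.

Lemma dense_orth (E : set H) f : dense E -> (forall v, E v -> dot f v = 0) -> f = 0.
Proof.
move=> dE h; apply: (nm_eq0 hD) => //; apply/eqP; rewrite eq_le nm_ge0 andbT.
apply/ler_addgt0Pl => e e0; rewrite addr0.
have [v Ev fv] := dense_approx f dE e0.
have := rp_le_nm hD (u := f) (v := f - v) I I.
rewrite (rpBr hD) // [rpH f v]rpE h // subr0 -(sqr_nm hD) // expr2.
have [->|f0] := eqVneq f 0; first by move=> _; rewrite (nm0 hD) (ltW e0).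
by rewrite ler_pM2l ?(nm_gt0 hD) // => h2; apply: ltW; exact: le_lt_trans h2 fv.
Qed.

Lemma norm_le_ReIm (z : R[i]) : `|z| <= (`|complex.Re z| + `|complex.Im z|)%:C.
Proof.
case: z => x y; rewrite normc_def /= lecR.
rewrite -(@ler_pXn2r _ 2) ?nnegrE ?sqrtr_ge0 ?addr_ge0 // sqr_sqrtr ?addr_ge0 ?sqr_ge0 //.
rewrite -(real_normK (num_real x)) -(real_normK (num_real y)).
by have := mulr_ge0 (normr_ge0 x) (normr_ge0 y); lra.
Qed.

(** The factor 2 comes from bounding real and imaginary parts separately; continuity arguments
    tolerate it. *)
Lemma normr_dot f v : `|dot f v| <= (2 * (nmH f * nmH v))%:C.
Proof.
apply: le_trans (norm_le_ReIm _) _; rewrite lecR mulr_natl mulr2n lerD //.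
  exact: (normr_rp hD).
have -> : complex.Im (dot f v) = rpH f ('i *: v).
  by rewrite rpE (ipZr hD) //; case: (dot f v) => x y /=; ring.
apply: le_trans (normr_rp hD _ _) _ => //.
by rewrite (nmZ hD) //= expr0n /= expr1n add0r sqrtr1 mul1r.
Qed.

Lemma closure_orth (A : set H) u n : closure A u -> (forall w, A w -> dot w n = 0) ->
  dot u n = 0.
Proof.
move=> cu h; apply/eqP; rewrite -normr_le0.
have : forall e, 0 < e -> `|dot u n| <= (2 * (e * nmH n))%:C.
  move=> e e0; have e0' : 0 < e%:C by rewrite ltcR.
  have [w [Aw /ball_nmH uw]] := cu _ (nbhsx_ballx u _ e0').
  have -> : dot u n = dot (u - w) n by rewrite (ipBl hD) // (h w) // subr0.
  apply: le_trans (normr_dot _ _) _; rewrite lecR ler_pM2l // ler_wpM2r ?nm_ge0 //.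
  exact: ltW.
rewrite normc_def; set m := Num.sqrt _ => key; have -> : 0 = (0 : R)%:C by [].
rewrite lecR.
apply/ler_addgt0Pl => e e0; rewrite addr0.
have n1 : 0 < 2 * (nmH n + 1) by have := nm_ge0 dot n; lra.
have := key _ (divr_gt0 e0 n1); rewrite lecR => h2; apply: le_trans h2 _.
have -> : 2 * (e / (2 * (nmH n + 1)) * nmH n) = e * (nmH n / (nmH n + 1)).
  by field; have := nm_ge0 dot n; lra.
rewrite ler_piMr ?(ltW e0) // ler_pdivrMr ?mul1r; last by have := nm_ge0 dot n; lra.
by rewrite lerDl.
Qed.

Section FormOperator.
Variables (H1 D E : set H) (a : H -> H -> R[i]).
Hypotheses (h1 : prehilbert H1 a) (DH1 : D `<=` H1) (EH1 : E `<=` H1).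
Hypotheses (sE : is_subspace E) (dE : dense E).

(** Continuity at 0 bounds [a u] on vectors of [E] shorter than [d]; rescaling to length [d / 2]
    gives a functional of norm at most [2 / d]. As [E] is dense, the representing vector is sought
    in all of [H]. *)
Lemma form_operator_repr u : D u -> {within E, continuous (a u : H -> R[i]^o)} ->
  exists f, forall v, E v -> dot f v = a u v.
Proof.
move=> Du /subspace_continuousP cu; have E0 := sub0 sE.
have Hu := DH1 Du.
have := cu 0 E0 => /cvgrPdist_lt /(_ 1 ltr01).
rewrite near_withinE => /nbhs_ballP[_ /= /gt0_complexP[d d0 ->] hd].
have bd v : E v -> nmH v < d -> rp a u v <= 1.
  move=> Ev vd; have := hd v; rewrite ball_nmH sub0r (nmN hD) // => /(_ vd Ev) /=.
  have Hv := EH1 Ev.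
  rewrite /from_subspace (ip0r h1) // sub0r normrN => /ltW h.
  have := le_trans (normc_ge_Re (a u v)) h.
  have -> : 1 = (1 : R)%:C by [].
  by rewrite lecR rpE; apply: le_trans; exact: ler_norm.
have [||||g [_ gv _]] := @riesz _ _ setT E dot hD sE (fun _ _ => I) (rp a u) (2 / d).
- exact: complete_dot.
- by move=> v w /EH1 ? /EH1 ?; rewrite (rpDr h1).
- by move=> r v /EH1 ?; rewrite (rpZr h1).
- move=> v Ev; have Hv := EH1 Ev.
  have [->|v0] := eqVneq v 0; first by rewrite (rp0r h1) // (nm0 hD) mulr0.
  have nv := nm_gt0 hD (I : setT v) v0.
  have nd : 0 < d / (2 * nmH v) by rewrite divr_gt0 ?mulr_gt0.
  have := bd ((d / (2 * nmH v))%:C *: v) (subZ sE _ Ev).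
  rewrite (nmZr hD) // (rpZr h1) // gtr0_norm //.
  have -> : d / (2 * nmH v) * nmH v = d / 2 by field; rewrite gt_eqF.
  move=> h; have : d / (2 * nmH v) * rp a u v <= 1 by apply: h; lra.
  rewrite mulrAC ler_pdivrMr ?mulr_gt0 // mul1r => h3.
  by rewrite mulrAC ler_pdivlMr // mulrC.
exists g => v Ev; have Hv := EH1 Ev.
have := gv v Ev; have := gv _ (subZ sE 'i Ev).
rewrite !rpE (ipZr hD) // (ipZr h1) //.
case: (dot g v) => x y; case: (a u v) => x' y' /=.
by rewrite !mul0r !sub0r !mulNr !opprK !mul1r => -> ->.
Qed.

(** Frees later arguments from [xget] and from the continuity condition; density of [E] makes the
    chosen value unique. [D] and [E] are kept apart for [A_max], whose domain lies in [H1] while its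
    test vectors lie in [H01]. *)
Lemma form_operatorP u f :
  (dom (form_operator dot a D E) u /\ form_operator dot a D E u = f) <->
  (D u /\ forall v, E v -> dot f v = a u v).
Proof.
split.
  move=> [[Du cu] /= <-]; split=> //; have [g hg] := form_operator_repr Du cu.
  exact: (@xgetPex _ 0 [set f | forall v, E v -> dot f v = a u v] (ex_intro _ g hg)).
move=> [Du hf]; split; last first.
  apply: xget_unique => // g hg /=.
  apply/eqP; rewrite -subr_eq0; apply/eqP; apply: (dense_orth dE) => v Ev.
  by rewrite linearBl /= hf // hg // subrr.
split=> //; apply/subspace_continuousP => w Ew.
rewrite /from_subspace -(hf w Ew); apply/cvgrPdist_lt => e /gt0_complexP[r r0 ->].
have n1 : 0 < 2 * (nmH f + 1) by have := nm_ge0 dot f; lra.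
have d0 : 0 < (r / (2 * (nmH f + 1)))%:C by rewrite ltcR divr_gt0.
rewrite near_withinE; apply/nbhs_ballP; exists (r / (2 * (nmH f + 1)))%:C => //= v /ball_nmH.
rewrite ltr_pdivlMr // => hv Ev; rewrite -(hf v Ev) -(ipBr hD) //.
apply: le_lt_trans (normr_dot _ _) _; rewrite ltcR.
by have := nm_ge0 dot (w - v); lra.
Qed.

End FormOperator.
End Ambient.

(** * The resolvent near lam *)

Lemma rp_eq_ip {R : realType} {H : completeNormedModType R[i]} (V V' W : set H)
    (ip ip' : H -> H -> R[i]) x y :
  prehilbert V ip -> prehilbert V' ip' -> is_subspace W -> W `<=` V -> W `<=` V' ->
  V x -> V' y -> (forall v, W v -> rp ip x v = rp ip' y v) ->
  forall v, W v -> ip x v = ip' y v.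
Proof.
move=> hV hV' sW WV WV' Vx Vy h v Wv.
have := h v Wv; have := h _ (subZ sW 'i Wv).
rewrite !rpE (ipZr hV) ?(ipZr hV') //; [|exact: WV'|exact: WV].
case: (ip x v) => p q; case: (ip' y v) => p' q' /=.
by rewrite !mul0r !sub0r !mulNr !opprK !mul1r => -> ->.
Qed.

Section Elliptic.
Context {R : realType} {H : completeNormedModType R[i]}.
Variable dot : {dot H for @Num.conj R[i]}.
Hypothesis dot_norm : forall u : H, `|u| ^+ 2 = dot u u.
Variables (E : set H) (a : H -> H -> R[i]) (ga : R).
Hypotheses (hE : prehilbert E a) (cE : complete_in a E E) (dE : dense E).
Hypotheses (ga0 : 0 < ga) (hga : forall u, E u -> nm dot u <= ga * nm a u).
Let hD := prehilbert_dot dot.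
Let sE : is_subspace E. Proof. by case: hE. Qed.
Local Notation nmH := (nm dot).
Local Notation rpH := (rp dot).
Local Notation nma := (nm a).
Local Notation rpa := (rp a).
Local Notation A := (form_operator dot a E E).

Let opP u f := form_operatorP dot_norm hE (@subset_refl _ E) (@subset_refl _ E) sE dE u f.

Lemma form_repr f : exists g, E g /\ forall v, E v -> dot f v = a g v.
Proof.
have [|||g [Eg gv _]] := @riesz _ _ E E a hE sE (@subset_refl _ E) (rpH f) (nmH f * ga) cE.
- by move=> u v _ _; rewrite (rpDr hD).
- by move=> r u _; rewrite (rpZr hD).
- move=> u Eu; apply: le_trans (rp_le_nm hD I I) _.
  by rewrite -mulrA ler_wpM2l ?nm_ge0 // hga.
exists g; split=> //.
by apply: (rp_eq_ip hD hE sE _ _ I Eg) => // v Ev; rewrite gv.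
Qed.

(** Coercivity makes the form operator a bijection onto [H], so this is an everywhere defined
    inverse, bounded by [ga] from [H] to the form space. *)
Definition Kinv : H -> H := inv_op A.

Lemma KinvP f : E (Kinv f) /\ forall v, E v -> a (Kinv f) v = dot f v.
Proof.
have [g [Eg hg]] := form_repr f.
have h : exists u, [set u | dom A u /\ A u = f] u by exists g; apply/opP.
have := xgetPex 0 h => /opP[EK hK]; split=> // v Ev.
by rewrite hK.
Qed.

Lemma Kinv_in f : E (Kinv f). Proof. by case: (KinvP f). Qed.

Lemma Kinv_ip f v : E v -> a (Kinv f) v = dot f v.
Proof. by case: (KinvP f) => _; exact. Qed.

Lemma form_inj u u' : E u -> E u' -> (forall v, E v -> a u v = a u' v) -> u = u'.
Proof.
move=> Eu Eu' h; apply/eqP; rewrite -subr_eq0; apply/eqP.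
have Ed : E (u - u') by mem.
apply: (nm_eq0 hE) => //; apply/eqP; rewrite -sqrf_eq0 (sqr_nm hE) //.
by rewrite rpE (ipBl hE) // h // subrr.
Qed.

Lemma Kinv_lin k u v : Kinv (k *: u + v) = k *: Kinv u + Kinv v.
Proof.
have Ku := Kinv_in u; have Kv := Kinv_in v.
apply: form_inj; [exact: Kinv_in|mem|] => w Ew.
by rewrite Kinv_ip // (ip_lin hE) // !Kinv_ip // (ip_lin hD).
Qed.

Lemma Kinv_bound f : nma (Kinv f) <= ga * nmH f.
Proof.
have EK := Kinv_in f.
have [->|K0] := eqVneq (Kinv f) 0; first by rewrite (nm0 hE) mulr_ge0 ?nm_ge0 ?ltW.
rewrite -(ler_pM2l (nm_gt0 hE EK K0)) -expr2 (sqr_nm hE) // rpE Kinv_ip // -rpE.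
apply: le_trans (rp_le_nm hD I I) _.
have := hga EK; have := nm_ge0 dot f => h1 h2.
by have := ler_wpM2l h1 h2; lra.
Qed.

Lemma symop_Kinv : symop E a Kinv.
Proof.
split.
- by move=> u _; exact: Kinv_in.
- by move=> k u v _ _; exact: Kinv_lin.
- move=> u v Eu Ev; have Ku := Kinv_in u; have Kv := Kinv_in v.
  rewrite [RHS](rpC hE) // !rpE !Kinv_ip // -!rpE.
  by rewrite (rpC hD).
- exists (ga * ga); first exact: mulr_gt0.
  move=> u Eu; apply: le_trans (Kinv_bound u) _.
  by rewrite -mulrA ler_pM2l // hga.
Qed.

(** Formally $A^{-1}(A-\mu)$: the operator that represents the form $a - \mu(\cdot,\cdot)$ in
    [(E, a)]. *)
Definition Tmu (mu : R) (u : H) : H := u - mu%:C *: Kinv u.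

Lemma Tmu_in mu u : E u -> E (Tmu mu u).
Proof. by move=> Eu; have := Kinv_in u => ?; rewrite /Tmu; mem. Qed.

Lemma Tmu_ip mu u v : E u -> E v -> a (Tmu mu u) v = a u v - mu%:C * dot u v.
Proof.
move=> Eu Ev; have Ku := Kinv_in u.
by rewrite /Tmu (ipBl hE) ?(ipZl hE) ?Kinv_ip //; mem.
Qed.

Lemma Tmu_diff mu nu u : Tmu mu u = Tmu nu u + (nu - mu)%:C *: Kinv u.
Proof.
by rewrite /Tmu rmorphB /= scalerBl addrA subrK.
Qed.

Lemma symop_Tmu mu : symop E a (Tmu mu).
Proof.
have [KE Kl Ks [b b0 Kb]] := symop_Kinv; split.
- by move=> u; exact: Tmu_in.
- move=> k u v Eu Ev; rewrite /Tmu Kl // scalerDr scalerBr !scalerA (mulrC mu%:C).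
  by rewrite opprD addrACA.
- move=> u v Eu Ev; have Ku := Kinv_in u; have Kv := Kinv_in v.
  by rewrite /Tmu (rpBl hE) ?(rpBr hE) ?(rpZl hE) ?(rpZr hE) ?Ks //; mem.
- exists (1 + `|mu| * b); first by rewrite ltr_wpDr // mulr_ge0 // ltW.
  move=> u Eu; have Ku := Kinv_in u.
  apply: le_trans (nm_triangleB hE Eu (subZ sE _ Ku)) _.
  by rewrite (nmZr hE) // mulrDl mul1r lerD2l -mulrA ler_wpM2l // Kb.
Qed.

Definition feig (mu : R) : set H :=
  [set u | E u /\ forall v, E v -> a u v = mu%:C * dot u v].

Lemma op_eigenspaceE mu : op_eigenspace A mu%:C = feig mu.
Proof.
apply/seteqP; split=> u.
  move=> /opP[Eu h]; split=> // v Ev.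
  by rewrite -(ipZl hD) // h.
move=> [Eu h]; apply/opP; split=> // v Ev.
by rewrite (ipZl hD) // h.
Qed.

Lemma feig_subspace mu : is_subspace (feig mu).
Proof.
apply: is_subspaceP.
  by split=> [|v Ev]; [mem|rewrite (ip0l hE) // (ip0l hD) // mulr0].
move=> k u v [Eu hu] [Ev hv]; split=> [|w Ew]; first by mem.
by rewrite (ip_lin hE) // (ip_lin hD) // hu // hv // mulrDr mulrCA.
Qed.

Lemma Tmu_eq0 mu u : E u -> Tmu mu u = 0 <-> feig mu u.
Proof.
move=> Eu; split=> [h|[_ h]].
  split=> // v Ev; apply/eqP; rewrite -subr_eq0 -Tmu_ip // h.
  by rewrite (ip0l hE).
apply: form_inj; [exact: Tmu_in|mem|] => v Ev.
by rewrite Tmu_ip // h // subrr (ip0l hE).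
Qed.

Lemma feig_neq0 mu u : feig mu u -> u != 0 -> mu != 0.
Proof.
move=> [Eu h] u0; apply/eqP => mu0; move: (rp_gt0 hE Eu u0).
by rewrite rpE h // mu0 mul0r ltxx.
Qed.

(** The two products with [n] differ by the factor [mu], which is nonzero for a nonzero eigenvector
    because the form is positive. *)
Lemma feig_orth mu n u : feig mu n -> E u -> a u n = 0 <-> dot u n = 0.
Proof.
move=> hn Eu; have [En h] := hn.
have -> : a u n = mu%:C * dot u n.
  rewrite (ipC hE) // h // [dot u n](ipC hD) //.
  by rewrite (rmorphM (@conjc R)); congr (_ * _); exact: conjc_real.
split=> [/eqP|->]; last by rewrite mulr0.
rewrite mulf_eq0 => /orP[/eqP mu0|/eqP //].
have [->|n0] := eqVneq n 0; first by rewrite (ip0r hD).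
by have := feig_neq0 hn n0; case: mu0 => ->; rewrite eqxx.
Qed.

(** $A-\mu$ maps [Kinv y] to [Tmu mu y], so the resolvent estimate controls $\|A^{-1}y\|$ by
    $\|T_\mu y\|$ in [H]; the identity $y = T_\mu y + \mu A^{-1}y$ carries this over to the form
    norm. *)
Lemma resolvent_bdd_below mu : resolvent_set dot setT A mu%:C ->
  bdd_below E a (Tmu mu).
Proof.
(* [M] compares squared norms and has no sign; [M'] is positive with $M \le M'^2$. *)
move=> [_ [M hM]]; pose M' := `|M| + 1.
have M'0 : 0 < M' by rewrite ltr_wpDl.
have k1 y : nmH (Kinv y) <= M' * nmH (Tmu mu y).
  have [dK AK] : dom A (Kinv y) /\ A (Kinv y) = y.
    by apply/opP; split=> [|v Ev]; [exact: Kinv_in|rewrite Kinv_ip].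
  have := hM _ dK; rewrite AK -/(Tmu mu y) !(ipE hD) // -rmorphM lecR => h.
  rewrite -(@ler_pXn2r _ 2) ?nnegrE ?nm_ge0 ?mulr_ge0 ?nm_ge0 ?(ltW M'0) //.
  rewrite exprMn !(sqr_nm hD) //; apply: le_trans h _.
  rewrite ler_wpM2r ?(rp_ge0 hD) // /M'.
  by have := ler_norm M; have := normr_ge0 M; nra.
pose C := 1 + `|mu| * (ga * ((1 + `|mu| * M') * ga)).
have C0 : 0 < C.
  rewrite /C ltr_wpDr // !(mulr_ge0, addr_ge0) //; exact: ltW.
exists C^-1; first by rewrite invr_gt0.
move=> y Ey; rewrite ler_pdivrMl //.
have Ky := Kinv_in y; have ETy := Tmu_in mu Ey.
have yE : y = Tmu mu y + mu%:C *: Kinv y by rewrite /Tmu subrK.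
have h1 : nma y <= nma (Tmu mu y) + `|mu| * nma (Kinv y).
  by rewrite {1}yE -(nmZr hE) //; apply: (nm_triangle hE) => //; mem.
have h2 : nmH y <= nmH (Tmu mu y) + `|mu| * nmH (Kinv y).
  by rewrite {1}yE -(nmZr hD) //; apply: (nm_triangle hD).
have h3 := Kinv_bound y; have h4 := hga ETy; have h5 := k1 y.
have m0 := normr_ge0 mu.
have h6 : nmH y <= (1 + `|mu| * M') * (ga * nma (Tmu mu y)).
  apply: le_trans h2 (le_trans (lerD (lexx _) (ler_wpM2l m0 h5)) _).
  rewrite mulrA -[X in X + _]mul1r -mulrDl ler_wpM2l //.
  by rewrite addr_ge0 // mulr_ge0 // ltW.
apply: le_trans h1 _; rewrite /C mulrDl mul1r lerD2l -mulrA ler_wpM2l //.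
apply: le_trans h3 _; rewrite -!mulrA ler_pM2l //.
Qed.

Section Gap.
Variable lam : R.
Let sN := feig_subspace lam.

(** [ga * ga] bounds the norm of [Kinv] in the form space, so the condition on [mu] keeps [Tmu mu]
    within [c] of [Tmu lam]. The same [c] serves as radius and as lower bound. *)
Definition spectral_gap b c : Prop :=
  [/\ onseq setT dot b, forall x, x \in b -> feig lam x,
  forall u, feig lam u -> (forall x, x \in b -> dot u x = 0) -> u = 0, 0 < c &
  forall mu, `|lam - mu| * (ga * ga) <= c ->
    (forall u, E u -> (forall n, feig lam n -> a u n = 0) -> c * nma u <= nma (Tmu mu u)) /\
    (forall g, E g -> (forall n, feig lam n -> a g n = 0) ->
       exists h, [/\ E h, forall n, feig lam n -> a h n = 0 & Tmu mu h = g])].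

Section NotEssential.
Hypothesis lam_ess : ~ ess_spectrum dot setT A lam%:C.

(** Shifts of [Tmu lam] are rescaled operators for other parameters, $T_\lambda - s =
    (1-s)\,T_{\lambda/(1-s)}$, so isolation of [lam] in the spectrum makes small nonzero shifts
    bounded below. *)
Lemma feig_gap : (hdim (feig lam) < +oo)%E /\
  exists2 c, 0 < c & forall u, E u ->
    (forall n, feig lam n -> a u n = 0) -> c * nma u <= nma (Tmu lam u).
Proof.
have [hr|hr] := pselect (resolvent_set dot setT A lam%:C).
  have bT := resolvent_bdd_below hr; split; last first.
    by case: bT => c c0 hc; exists c => // u Eu _; exact: hc.
  rewrite (hdim_onseq hD (b := [::])) ?ltry //.
  move=> u hu _; have [Eu _] := hu; apply: (bdd_below_inj hE bT) => //.
  exact/Tmu_eq0.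
have [iso ev fin] : discrete_spectrum dot setT A lam%:C.
  by apply: contrapT => hd; apply: lam_ess; split.
rewrite op_eigenspaceE in fin; split=> //.
have lam0 : lam != 0.
  by case: ev => u u0; rewrite op_eigenspaceE => hu; exact: feig_neq0 hu u0.
have [_ [U /nbhs_ballP[_ /= /gt0_complexP[r r0 ->] rU] UE]] := iso.
have res mu : 0 < `|mu - lam| < r -> resolvent_set dot setT A mu%:C.
  move=> /andP[ml mr]; apply: contrapT => hn.
  have : (U `&` op_spectrum dot setT A) mu%:C.
    split=> //; apply: rU; rewrite -ball_normE /= -rmorphB /= normc_def /=.
    by rewrite expr0n /= addr0 sqrtr_sqr ltcR distrC.
  rewrite UE => /complexI e; move: ml; rewrite e subrr normr0 ltxx //.
have l0 : 0 < `|lam| by rewrite normr_gt0.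
(* For $|s|<k$ this gives $1-s>1/2$ and places $\lambda/(1-s)$ within [r] of [lam]. *)
pose k := Num.min (1 / 2) (r / (2 * `|lam|)).
have k0 : 0 < k by rewrite lt_min divr_gt0 //= divr_gt0 // mulr_gt0.
have [s|c c0 hc] := isolated_gap hE cE (symop_Tmu lam) k0; last first.
  exists c => // u Eu un; apply: hc => // n En Tn; rewrite rpE un //.
  exact/Tmu_eq0.
move=> /andP[s0]; rewrite lt_min => /andP[s1 s2].
have s3 : 0 < 1 - s by have := ler_norm s; lra.
have s4 : 1 / 2 < 1 - s by have := ler_norm s; lra.
have [|c c0 hc] := @resolvent_bdd_below (lam / (1 - s)).
  apply: res; have -> : lam / (1 - s) - lam = lam * s / (1 - s).
    by field; rewrite gt_eqF.
  rewrite !normrM normfV (gtr0_norm s3); apply/andP; split.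
    by rewrite divr_gt0 // mulr_gt0.
  move: s2; rewrite ltr_pdivrMr // ltr_pdivlMr ?mulr_gt0 //.
  by have := mulr_gt0 l0 s0; nra.
exists ((1 - s) * c); first exact: mulr_gt0.
move=> u Eu; have ET := Tmu_in (lam / (1 - s)) Eu.
have -> : opshift (Tmu lam) s u = (1 - s)%:C *: Tmu (lam / (1 - s)) u.
  rewrite /opshift /Tmu scalerBr scalerA -rmorphM /= mulrC divfK ?gt_eqF //.
  by rewrite rmorphB /= scalerBl rmorph1 scale1r addrAC.
by rewrite (nmZr hE) // gtr0_norm // -mulrA ler_pM2l // hc.
Qed.

Lemma form_gap : exists b c, spectral_gap b c.
Proof.
have [fin [c c0 hc]] := feig_gap.
have [b [ob bN hb]] := hdim_fin_onseq hD (@subsetT _ _) sN fin.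
have NE n : feig lam n -> E n by case.
have bE x : x \in b -> E x by move=> /bN/NE.
(* Half of the gap at [lam] is spent on absorbing $|\lambda-\mu|\,\|A^{-1}u\|$. *)
exists b, (c / 2); split=> //; first exact: divr_gt0.
move=> mu mul.
have lower u : E u -> (forall n, feig lam n -> a u n = 0) -> c / 2 * nma u <= nma (Tmu mu u).
  move=> Eu un; have h1 := hc u Eu un.
  have Ku := Kinv_in u; have ET := Tmu_in mu Eu.
  have : nma (Tmu lam u) <= nma (Tmu mu u) + `|lam - mu| * nma (Kinv u).
    rewrite (Tmu_diff lam mu) distrC -(nmZr hE) //.
    by apply: (nm_triangle hE) => //; mem.
  have h2 := Kinv_bound u; have h3 := hga Eu.
  have h4 : nma (Kinv u) <= ga * ga * nma u.
    by apply: le_trans h2 _; rewrite -mulrA ler_pM2l.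
  have := ler_wpM2l (normr_ge0 (lam - mu)) h4; rewrite mulrA => h5 h6.
  by have := ler_wpM2r (nm_ge0 a u) mul; lra.
split=> // g Eg gn.
have pE u : perp E a b u <-> E u /\ forall n, feig lam n -> a u n = 0.
  split=> [[Eu ub]|[Eu un]]; last by split=> // x /bN/un.
  split=> // n hn; rewrite (onseq_expansion hD _ sN ob bN hb hn) //.
  rewrite /fourier big_seq (ipC hE) //; last first.
    by apply: (sub_sum sE) => x /bE Ex; mem.
  rewrite (ip_suml hE) //; last by move=> x /bE Ex; mem.
  rewrite big1 ?conjc0 // => x xb; have Ex := bE _ xb.
  by rewrite (ipZl hE) // (ip_eq0C hE Eu Ex) ?mulr0 //; exact: ub.
have sp := perp_subspace hE bE.
have hp := prehilbertS hE sp (@perpS _ _ E a b).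
have hS : symop (perp E a b) a (Tmu mu).
  have [TE Tl Ts [M M0 TM]] := symop_Tmu mu; split.
  - move=> u /pE[Eu un]; apply/pE; split=> [|n hn]; first exact: TE.
    rewrite Tmu_ip //; last exact: NE.
    by rewrite un // (feig_orth hn Eu).1 ?mulr0 ?subrr //; exact: un.
  - by move=> k u v [Eu _] [Ev _]; exact: Tl.
  - by move=> u v [Eu _] [Ev _]; exact: Ts.
  - by exists M => // u [Eu _]; exact: TM.
have bS : bdd_below (perp E a b) a (Tmu mu).
  by exists (c / 2); [exact: divr_gt0|move=> u /pE[Eu un]; exact: lower].
have pg : perp E a b g by apply/pE.
have [h /pE[Eh hn] hg] := symop_surj hp (perp_complete hE bE cE) hS bS pg.
by exists h.
Qed.

End NotEssential.

Section Deflation.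
Variables (b : seq H) (c : R).
Hypothesis gap : spectral_gap b c.

Lemma feig_linspan u : feig lam u -> linspan [set` b] u.
Proof.
case: gap => ob bN hb _ _ hu.
rewrite (onseq_expansion hD (@subsetT _ _) sN ob bN hb hu) /fourier big_seq.
have sL := linspan_subspace [set` b].
by apply: (sub_sum sL) => x xb; apply: (subZ sL); exact: linspan_gen.
Qed.

Lemma feig_proj w : exists2 e, feig lam e & forall x, feig lam x -> dot (w - e) x = 0.
Proof.
case: gap => ob bN hb _ _.
have bT x : x \in b -> [set: H] x by [].
have [e eb he] := fin_proj hD bT (I : setT w).
exists e; first by apply: (linspan_sub sN _ eb) => x; exact: bN.
move=> x /feig_linspan; apply: (@linspan_sub _ _ _ [set x | dot (w - e) x = 0]).
  apply: is_subspaceP; first by rewrite /= (ip0r hD).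
  move=> k u v /= hu hv.
  by rewrite (ipDr hD) // (ipZr hD) // hu hv mulr0 addr0.
by move=> y yb; exact: he.
Qed.

Lemma feig_proj_le w e : feig lam e -> (forall x, feig lam x -> dot (w - e) x = 0) ->
  nmH e <= nmH w /\ nmH (w - e) <= nmH w.
Proof.
move=> hN he.
have o : rpH (w - e) e = 0 by rewrite rpE he.
split; last by rewrite -{2}(subrK e w) (nm_le_orth hD).
by rewrite -(subrK e w) addrC (nm_le_orth hD) // (rpC hD).
Qed.

(* With [E] = [H01] and [n] in ker (A_N - lam), or [E] = [H1] and [n] in
   ker (A_D - lam), the vector [n - e - h] is the correction of [n] to [Gs mu]. *)
Definition deflated mu n e h : Prop :=
  [/\ feig lam e, forall x, feig lam x -> dot (n - e) x = 0,
      E h, forall x, feig lam x -> a h x = 0 &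
      forall x, E x -> a h x - mu%:C * dot h x = (lam - mu)%:C * dot (n - e) x].

(** [h] solves $T_\mu h = (\lambda-\mu)A^{-1}(n-e)$ in the complement of the eigenspace, where
    [Tmu mu] is invertible uniformly in [mu]. Subtracting [e] is what puts the right side into that
    complement. *)
Lemma deflated_exists mu n : `|lam - mu| * (ga * ga) <= c -> exists e h, deflated mu n e h.
Proof.
case: gap => _ _ _ _ /(_ mu) h /h[_ surj].
have [e he hne] := feig_proj n.
have EK := Kinv_in (n - e).
have Eg : E ((lam - mu)%:C *: Kinv (n - e)) by mem.
have [|hh [Eh hN Th]] := surj _ Eg.
  move=> x hx; have Ex : E x by case: hx.
  by rewrite (ipZl hE) // Kinv_ip // hne // mulr0.
exists e, hh; split=> // x Ex.
by rewrite -Tmu_ip // Th (ipZl hE) // Kinv_ip.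
Qed.

Lemma deflated_bound mu n e h : `|lam - mu| * (ga * ga) <= c -> deflated mu n e h ->
  c * nma h <= `|lam - mu| * (ga * nmH n).
Proof.
case: gap => _ _ _ _ /(_ mu) hm /hm[low _] [he hne Eh hN hq].
apply: le_trans (low _ Eh hN) _.
have EK := Kinv_in (n - e).
have -> : Tmu mu h = (lam - mu)%:C *: Kinv (n - e).
  apply: form_inj; [exact: Tmu_in|mem|] => x Ex.
  by rewrite Tmu_ip // hq // (ipZl hE) // Kinv_ip.
rewrite (nmZr hE) // ler_wpM2l //; apply: le_trans (Kinv_bound _) _.
by rewrite ler_pM2l //; case: (feig_proj_le he hne).
Qed.

(** Lets a combination of corrected vectors be estimated as the correction of a single vector. *)
Lemma deflated_lin mu k n e h n' e' h' : deflated mu n e h -> deflated mu n' e' h' ->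
  deflated mu (k *: n + n') (k *: e + e') (k *: h + h').
Proof.
move=> [e1 e2 e3 e4 e5] [f1 f2 f3 f4 f5].
have E6 : k *: n + n' - (k *: e + e') = k *: (n - e) + (n' - e').
  by rewrite scalerBr opprD addrACA.
split; [exact: (sub_lin sN)| |mem| |] => x hx.
- by rewrite E6 (ip_lin hD) // e2 // f2 // mulr0 addr0.
- have Ex : E x by case: hx.
  by rewrite (ip_lin hE) // e4 // f4 // mulr0 addr0.
- rewrite E6 !(ip_lin hD) // (ip_lin hE) // mulrDr opprD addrACA f5 //.
  by rewrite mulrCA -mulrBr e5 // mulrDr mulrCA.
Qed.

Lemma deflated0 mu : deflated mu 0 0 0.
Proof.
split; [exact: (sub0 sN)| |exact: (sub0 sE)| |] => x hx.
- by rewrite subr0 (ip0l hD).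
- by rewrite (ip0l hE) //; case: hx.
- by rewrite subr0 (ip0l hE) // !(ip0l hD) // !mulr0 subr0.
Qed.

Lemma deflated_sum mu m (k : 'I_m -> R[i]) (n e h : 'I_m -> H) :
  (forall i, deflated mu (n i) (e i) (h i)) ->
  deflated mu (\sum_i k i *: n i) (\sum_i k i *: e i) (\sum_i k i *: h i).
Proof.
move=> hd; elim/big_ind3 : _ => [|n1 n2 e1 e2 h1 h2 d1 d2|i _]; first exact: deflated0.
  by have := deflated_lin 1 d1 d2; rewrite !scale1r.
by have := deflated_lin (k i) (hd i) (deflated0 mu); rewrite !addr0.
Qed.

End Deflation.
End Gap.
End Elliptic.

(** * The lower bound on Gs *)

Lemma orth_projection {R : realType} {H : completeNormedModType R[i]} (V W : set H)
    (ip : H -> H -> R[i]) w :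
  prehilbert V ip -> is_subspace W -> W `<=` V -> complete_in ip W W -> V w ->
  exists g, [/\ W g, forall x, W x -> ip g x = ip w x & nm ip g <= nm ip w].
Proof.
move=> hV sW WV cW Vw; have hW := prehilbertS hV sW WV.
have [|||g [Wg gw _]] := @riesz _ _ _ _ _ hW sW (@subset_refl _ W) (rp ip w) (nm ip w) cW.
- by move=> u v /WV ? /WV ?; rewrite (rpDr hV).
- by move=> r u /WV ?; rewrite (rpZr hV).
- by move=> u /WV ?; exact: (rp_le_nm hV).
have Vg := WV _ Wg.
exists g; split=> //; first exact: (rp_eq_ip hV hV sW WV WV Vg Vw gw).
have [->|g0] := eqVneq g 0; first by rewrite (nm0 hV) nm_ge0.
rewrite -(ler_pM2l (nm_gt0 hV Vg g0)) -expr2 (sqr_nm hV) // gw // mulrC.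
exact: (rp_le_nm hV).
Qed.

Section Pair.
Context {R : realType} {H : completeNormedModType R[i]}.
Variable dot : {dot H for @Num.conj R[i]}.
Hypothesis dot_norm : forall u : H, `|u| ^+ 2 = dot u u.
Variables (H1 H01 : set H) (a : H -> H -> R[i]) (ga : R).
Hypotheses (h1 : prehilbert H1 a) (c1 : complete_in a H1 H1) (d1 : dense H1).
Hypotheses (s01 : is_subspace H01) (H01_H1 : H01 `<=` H1).
Hypotheses (c01 : complete_in a H01 H01) (d01 : dense H01).
Hypotheses (ga0 : 0 < ga) (hga : forall u, H1 u -> nm dot u <= ga * nm a u).
Let hD := prehilbert_dot dot.
Let s1 : is_subspace H1. Proof. by case: h1. Qed.
Let h01 : prehilbert H01 a. Proof. exact: (prehilbertS h1 s01 H01_H1). Qed.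
Let hga0 u : H01 u -> nm dot u <= ga * nm a u. Proof. by move=> /H01_H1/hga. Qed.
Local Notation nmH := (nm dot).
Local Notation rpH := (rp dot).
Local Notation nma := (nm a).
Local Notation rpa := (rp a).
Local Notation TN := (Tmu dot H1 a).
Local Notation TD := (Tmu dot H01 a).

Definition Gs (mu : R) : set H :=
  [set u | H1 u /\ forall x, H01 x -> a u x = mu%:C * dot u x].

Lemma Gs_subspace mu : is_subspace (Gs mu).
Proof.
apply: is_subspaceP.
  by split=> [|v /H01_H1 Ev]; [mem|rewrite (ip0l h1) // (ip0l hD) // mulr0].
move=> k u v [Eu hu] [Ev hv]; split=> [|w Ew]; first by mem.
by rewrite (ip_lin h1) // ?(ip_lin hD) // ?hu ?hv // ?mulrDr 1?mulrCA //; exact: H01_H1.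
Qed.

Lemma Gs_sub mu : Gs mu `<=` H1. Proof. by move=> u []. Qed.

Lemma prehilbert_Gs mu : prehilbert (Gs mu) a.
Proof. exact: (prehilbertS h1 (@Gs_subspace mu) (@Gs_sub mu)). Qed.

(** [Gs mu] is the [a]-orthogonal complement in [H1] of the image of [H01] under [TN mu], hence
    closed. *)
Lemma complete_Gs mu : complete_in a (Gs mu) (Gs mu).
Proof.
have BH : TN mu @` H01 `<=` H1.
  by move=> _ [x Hx <-]; exact/(Tmu_in dot_norm h1 c1 d1 hga)/H01_H1.
have := orth_complete h1 BH c1; set Z := [set u | _].
suff -> : Z = Gs mu by [].
have E u x : H1 u -> H01 x -> a u (TN mu x) = a u x - mu%:C * dot u x.
  move=> Hu /H01_H1 Hx.
  by rewrite -(symop_ip h1 (symop_Tmu dot_norm h1 c1 d1 ga0 hga mu)) // (Tmu_ip dot_norm h1 c1 d1 hga).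
apply/seteqP; split=> u [Hu hu]; split=> //.
  move=> x Hx; apply/eqP; rewrite -subr_eq0 -E //; apply/eqP; apply: hu.
  by exists x.
by move=> _ [x Hx <-]; rewrite E // hu // subrr.
Qed.

Section Gaps.
Variables (lam : R) (bN bD : seq H) (cN cD : R).
Hypothesis gN : spectral_gap dot H1 a ga lam bN cN.
Hypothesis gD : spectral_gap dot H01 a ga lam bD cD.
Local Notation N := (feig dot H1 a lam).
Local Notation D := (feig dot H01 a lam).
Let sN := feig_subspace dot h1 lam.
Let sD := feig_subspace dot h01 lam.
Let NH1 n : N n -> H1 n. Proof. by case. Qed.
Let DH01 n : D n -> H01 n. Proof. by case. Qed.
Let TNip := Tmu_ip dot_norm h1 c1 d1 hga.
Let TDip := Tmu_ip dot_norm h01 c01 d01 hga0.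
Let TNsym := symop_Tmu dot_norm h1 c1 d1 ga0 hga.
Let TNin := Tmu_in dot_norm h1 c1 d1 hga.

Lemma rp_dot_bound u v : H1 u -> H1 v -> `|rpH u v| <= ga * ga * (nma u * nma v).
Proof.
move=> Hu Hv; apply: le_trans (normr_rp hD I I) _.
rewrite [leRHS](_ : _ = (ga * nma u) * (ga * nma v)); last by ring.
by apply: ler_pM; rewrite ?nm_ge0 ?hga.
Qed.

Lemma TN_bound mu u : H1 u -> nma (TN mu u) <= (1 + `|mu| * (ga * ga)) * nma u.
Proof.
move=> Hu; have HK := Kinv_in dot_norm h1 c1 d1 hga u.
apply: le_trans (nm_triangleB h1 Hu (subZ s1 _ HK)) _.
rewrite (nmZr h1) // mulrDl mul1r lerD2l -mulrA ler_wpM2l //.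
apply: le_trans (Kinv_bound dot_norm h1 c1 d1 ga0 hga u) _.
by rewrite -mulrA ler_pM2l // hga.
Qed.

(* The test vector [v = TN lam (u - d)] with [d] in [D] is orthogonal, for the
   form of [lam], to [D]; hence its projection on [Gs mu] along [H01] stays
   bounded as [mu] tends to [lam]. *)
Lemma test_vector u : H1 u -> (forall n, N n -> a u n = 0) ->
  (forall x, D x -> a u x = 0) ->
  exists v, [/\ H1 v, cN * nma u <= nma v, a (TN lam u) v = a v v &
    forall x, D x -> a v x = lam%:C * dot v x].
Proof.
move=> Hu uN uD; have [obN bNN hbN cN0 hN] := gN; have [obD bDD hbD cD0 hD'] := gD.
have DH1 x : D x -> H1 x by move=> /DH01/H01_H1.
have HTu := TNin lam Hu.
have rH g : g \in map (TN lam) bD -> H1 g.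
  by move=> /mapP[x /bDD/DH1 Hx ->]; exact: TNin.
have [y yr hy] := fin_proj h1 rH HTu.
have [d Dd Ty] : (TN lam @` D) y.
  apply: (linspan_sub _ _ yr).
    apply: is_subspaceP; first by exists 0; [exact: (sub0 sD)|exact: (symop0 h1 (TNsym lam))].
    move=> k _ _ [p Dp <-] [q Dq <-]; exists (k *: p + q); first exact: (sub_lin sD).
    by case: (TNsym lam) => _ -> //; exact: DH1.
  by move=> g /mapP[x xb ->]; exists x => //; exact: bDD.
have Hd := DH1 _ Dd; have HTd := TNin lam Hd.
have vT : TN lam (u - d) = TN lam u - TN lam d by exact: (symopB h1 (TNsym lam)).
have Hud : H1 (u - d) by mem.
have Hv := TNin lam Hud.
have vorth x : D x -> a (TN lam (u - d)) (TN lam x) = 0.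
  move=> Dx; suff [] : [set x | H1 x /\ a (TN lam (u - d)) (TN lam x) = 0] x by [].
  apply: (linspan_sub _ _ (feig_linspan h01 gD Dx)).
  - apply: is_subspaceP.
      by split; [mem|rewrite (symop0 h1 (TNsym lam)) (ip0r h1)].
    move=> k p q [Hp hp] [Hq hq]; split; first by mem.
    have HTp := TNin lam Hp; have HTq := TNin lam Hq.
    case: (TNsym lam) => _ -> // _ _.
    by rewrite (ipDr h1) ?(ipZr h1) ?hp ?hq ?mulr0 ?addr0 //; mem.
  - move=> z zb; split; first exact: DH1 (bDD _ zb).
    by rewrite vT Ty; apply: hy; exact: map_f.
exists (TN lam (u - d)); split=> //.
(* The projection [n] of [u - d] on [N] is killed by [TN lam], so the gap applies to [u - d - n].
   Its norm is at least that of [u], because [u] is orthogonal to [d + n]. *)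
- have [n Nn hn] := feig_proj h1 gN (u - d); have Hn := NH1 Nn.
  have Tn : TN lam n = 0 by apply/(Tmu_eq0 dot_norm h1 c1 d1 hga).
  have Hz : H1 (u - d - n) by mem.
  have -> : TN lam (u - d) = TN lam (u - d - n).
    by rewrite [RHS](symopB h1 (TNsym lam)) // Tn subr0.
  have hm : `|lam - lam| * (ga * ga) <= cN by rewrite subrr normr0 mul0r ltW.
  have [low _] := hN lam hm.
  apply: le_trans (low _ Hz _); last first.
    by move=> m Nm; apply/(feig_orth h1 Nm Hz); exact: hn.
  rewrite ler_pM2l //.
  have Hdn : H1 (d + n) by mem.
  have o : rpa u (d + n) = 0 by rewrite (rpDr h1) // !rpE uD // uN // addr0.
  rewrite -(@ler_pXn2r _ 2) ?nnegrE ?nm_ge0 // !(sqr_nm h1) //.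
  rewrite -addrA -opprD (rpBl h1) ?(rpBr h1) //; try by mem.
  by rewrite (rpC h1 Hdn Hu) o; have := rp_ge0 h1 Hdn; lra.
- have -> : TN lam u = TN lam (u - d) + TN lam d by rewrite vT subrK.
  by rewrite (ipDl h1) // (ip_eq0C h1 Hv HTd (vorth _ Dd)) addr0.
- move=> x Dx; have Hx := DH1 _ Dx.
  apply/eqP; rewrite -subr_eq0 -TNip // (symop_ip h1 (TNsym lam)) //; apply/eqP.
  exact: vorth.
Qed.

(** [b] is paired with some [z] in [Gs mu] that differs from the test vector [v] by an element of
    [H01], to which [u] is $q_\mu$-orthogonal. This gives $\mathrm{Re}\, a[b,z] = \|v\|^2 +
    (\lambda-\mu)\mathrm{Re}(u,v)$, and $\|z\| \le C\|v\|$ with [cN * nma u <= nma v] concludes. *)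
Lemma G_lower : exists c d, [/\ 0 < c, 0 < d &
  forall mu u b, `|lam - mu| < d -> Gs mu u -> Gs mu b ->
    (forall v, Gs mu v -> a b v = a u v - mu%:C * dot u v) ->
    (forall n, N n -> dot u n = 0) -> (forall x, D x -> dot u x = 0) ->
    c * nma u <= nma b].
Proof.
have [obN bNN hbN cN0 hN] := gN; have [obD bDD hbD cD0 hD'] := gD.
pose g2 := ga * ga.
have g20 : 0 < g2 by exact: mulr_gt0.
(* [L] bounds $\|e\|/\|v\|$, [B] the norm of [TN mu] for $|\mu| \le |\lambda|+1$, and [C] the ratio
   $\|z\|/\|v\|$. The three terms of [d] keep [mu] in that range, make [TD mu] invertible off [D],
   and absorb $(\lambda-\mu)(u,v)$. *)
pose L := 1 + `|lam| * g2.
have lam0 := normr_ge0 lam.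
have L1 : 1 <= L by rewrite lerDl mulr_ge0 // ltW.
pose B := 1 + (`|lam| + 1) * g2.
have B1 : 1 <= B by rewrite lerDl mulr_ge0 ?addr_ge0 // ltW.
pose C := (1 + L) * (1 + cD^-1 * B).
have cDi : 0 < cD^-1 by rewrite invr_gt0.
have C0 : 0 < C by rewrite mulr_gt0 // ltr_wpDr //; lra || (rewrite mulr_ge0 ?ltW //; lra).
pose d := Num.min 1 (Num.min (cD / g2) (cN / 2 / g2)).
have d0 : 0 < d by rewrite !lt_min ltr01 /= !divr_gt0.
exists (cN / 2 / C), d; split=> //; first by rewrite !divr_gt0.
move=> mu u b; rewrite !lt_min => /and3P[m1 m2 m3] Gu Gb bE uN uD.
have [Hu hu] := Gu; have [Hb _] := Gb.
have uN' n : N n -> a u n = 0 by move=> Nn; apply/(feig_orth h1 Nn Hu)/uN.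
have uD' x : D x -> a u x = 0 by move=> Dx; rewrite hu ?uD ?mulr0 //; exact: DH01.
have [v [Hv cv Tv vD]] := test_vector Hu uN' uD'.
have [e De ve] := feig_proj h01 gD v.
have H0e := DH01 De; have He := H01_H1 H0e.
have Hve : H1 (v - e) by mem.
have HT := TNin mu Hve.
have [g [H0g gx ng]] := orth_projection h1 s01 H01_H1 c01 HT.
(* Both [v] and [e] satisfy the eigenvalue equation against [D], and [v - e] is [H]-orthogonal to
   [D]; so [g] falls into the complement on which [TD mu] is onto. *)
have gD' x : D x -> a g x = 0.
  move=> Dx; have H0x := DH01 Dx; have Hx := H01_H1 H0x.
  have [_ eD] := De.
  rewrite gx // TNip // ve // mulr0 subr0 (ipBl h1) // vD // eD //.
  by rewrite -mulrBr -(ipBl hD) // ve // mulr0.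
have m2' : `|lam - mu| * g2 <= cD by move: m2; rewrite ltr_pdivlMr // => /ltW.
have m3' : `|lam - mu| * g2 <= cN / 2 by move: m3; rewrite ltr_pdivlMr // => /ltW.
have [low surj] := hD' mu m2'.
have [h [H0h hhD Th]] := surj _ H0g gD'.
have Hh := H01_H1 H0h.
pose z := v - e - h.
have Hz : H1 z by rewrite /z; mem.
have Gz : Gs mu z.
  split=> // x H0x; have Hx := H01_H1 H0x.
  have E1 : a h x - mu%:C * dot h x = a (v - e) x - mu%:C * dot (v - e) x.
    by rewrite -TDip // Th gx // TNip.
  rewrite /z (ipBl h1) // (ipBl hD (u := v - e)) // mulrBr.
  by apply/eqP; rewrite -subr_eq0; apply/eqP; move: E1 => /eqP; rewrite -subr_eq0 => /eqP E1;
    rewrite -[RHS]oppr0 -E1; ring.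
have E2 : rpa b z = nma v ^+ 2 + (lam - mu) * rpH u v.
  have Heh : H1 (e + h) by mem.
  have H0eh : H01 (e + h) by mem.
  have HTmu := TNin mu Hu.
  have -> : rpa b z = rpa (TN mu u) v.
    rewrite rpE bE // -TNip // -rpE /z -addrA -opprD (rpBr h1) //.
    have -> : rpa (TN mu u) (e + h) = 0 by rewrite rpE TNip // hu // subrr.
    by rewrite subr0.
  have HK := Kinv_in dot_norm h1 c1 d1 hga u.
  have HTu := TNin lam Hu.
  rewrite (Tmu_diff _ _ _ mu lam) (rpDl h1) //; last by mem.
  rewrite (rpZl h1) // !rpE Tv (Kinv_ip dot_norm h1 c1 d1 hga) //.
  by rewrite (sqr_nm h1) // rpE.
have ne : nma e <= L * nma v.
  have [_ eE] := De.
  have h3 : nma e ^+ 2 <= (L * nma v) ^+ 2.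
    rewrite (sqr_nm h1) // rpE eE //.
    have -> : complex.Re (lam%:C * dot e e) = lam * nmH e ^+ 2.
      by rewrite (sqr_nm hD) // rpE; case: (dot e e) => x y /=; ring.
    have [h4 _] := feig_proj_le De ve.
    have h5 : nmH e ^+ 2 <= g2 * nma v ^+ 2.
      rewrite (_ : g2 * _ = (ga * nma v) ^+ 2); last by rewrite /g2; ring.
      rewrite ler_pXn2r ?nnegrE ?nm_ge0 ?mulr_ge0 ?nm_ge0 ?(ltW ga0) //.
      exact: le_trans h4 (hga Hv).
    apply: (@le_trans _ _ (`|lam| * (g2 * nma v ^+ 2))).
      apply: (@le_trans _ _ (`|lam| * nmH e ^+ 2)); last by rewrite ler_wpM2l.
      by rewrite ler_wpM2r ?sqr_ge0 // ler_norm.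
    rewrite exprMn mulrA ler_wpM2r ?sqr_ge0 // /L.
    have := mulr_ge0 lam0 (ltW g20); set q := _ * _ => q0.
    by nra.
  by rewrite -(@ler_pXn2r _ 2) ?nnegrE ?nm_ge0 ?mulr_ge0 ?nm_ge0 //; lra.
have nve : nma (v - e) <= (1 + L) * nma v.
  by apply: le_trans (nm_triangleB h1 Hv He) _; rewrite mulrDl mul1r lerD2l.
have nh : nma h <= cD^-1 * B * ((1 + L) * nma v).
  rewrite -mulrA ler_pdivlMl //; apply: le_trans (low _ H0h hhD) _.
  rewrite Th; apply: le_trans ng (le_trans (TN_bound mu Hve) _).
  apply: ler_pM; rewrite ?nm_ge0 //.
    by rewrite addr_ge0 // mulr_ge0 // ltW.
  rewrite /B lerD2l ler_wpM2r ?(ltW g20) //.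
  by have := ler_dist_dist mu lam; rewrite distrC => /(le_trans (ler_norm _)); lra.
have nz : nma z <= C * nma v.
  apply: le_trans (nm_triangleB h1 Hve Hh) _.
  apply: le_trans (lerD nve nh) _.
  by rewrite /C le_eqVlt; apply/orP; left; apply/eqP; ring.
have m4 : - (`|lam - mu| * g2 * (nma u * nma v)) <= (lam - mu) * rpH u v.
  rewrite lerNl -mulrN; apply: le_trans (ler_norm _) _.
  by rewrite normrM normrN -mulrA ler_wpM2l // rp_dot_bound.
have m5 := rp_le_nm h1 Hb Hz.
rewrite E2 in m5.
have nu0 := nm_ge0 a u; have nv0 := nm_ge0 a v; have nb0 := nm_ge0 a b.
have m6 : nma v ^+ 2 - cN / 2 * (nma u * nma v) <= nma b * (C * nma v).
  have := ler_wpM2l nb0 nz; have := ler_wpM2r (mulr_ge0 nu0 nv0) m3'; lra.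
rewrite mulrAC ler_pdivrMr //.
move: nv0; rewrite le_eqVlt => /orP[/eqP v0|v0].
  move: cv; rewrite -v0 => cv.
  by have := mulr_ge0 nb0 (ltW C0); have := mulr_ge0 (ltW cN0) nu0; lra.
rewrite -(ler_pM2r v0); have := ler_wpM2r (ltW v0) cv; lra.
Qed.

End Gaps.
End Pair.

(** * Eigenvectors continued to Gs *)

Lemma hdim_le {R : realType} {H : lmodType R[i]} (W W' : set H) : W `<=` W' ->
  (hdim W <= hdim W')%E.
Proof.
move=> WW; apply: le_ereal_sup => _ [n [f Wf lf] <-]; exists n => //.
by exists f => // i; exact/WW.
Qed.

Section Complement.
Context {R : realType} {H : completeNormedModType R[i]}.
Variable dot : {dot H for @Num.conj R[i]}.
Hypothesis dot_norm : forall u : H, `|u| ^+ 2 = dot u u.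
Variables (E : set H) (a : H -> H -> R[i]) (ga : R).
Hypotheses (hE : prehilbert E a) (cE : complete_in a E E) (dE : dense E).
Hypotheses (ga0 : 0 < ga) (hga : forall u, E u -> nm dot u <= ga * nm a u).
Variable lam : R.
Local Notation N := (feig dot E a lam).
Hypothesis finN : (hdim N < +oo)%E.
Variables (F : set H) (bF : seq H).
Hypotheses (sF : is_subspace F) (obF : onseq setT dot bF).
Hypotheses (bFF : forall x, x \in bF -> F x).
Hypothesis hbF : forall u, F u -> (forall x, x \in bF -> dot u x = 0) -> u = 0.
Let hD := prehilbert_dot dot.
Let sE : is_subspace E. Proof. by case: hE. Qed.
Let sN := feig_subspace dot hE lam.

(** With [F] the eigenspace of the other operator, this is the part of the eigenspace counted by
    [n_N] or [n_D], as [image_N] and [image_D] show. *)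
Definition feig_minus : set H :=
  [set n | N n /\ forall x, N x -> F x -> dot n x = 0].

Lemma feig_minus_subspace : is_subspace feig_minus.
Proof.
apply: is_subspaceP.
  by split=> [|x _ _]; [exact: (sub0 sN)|rewrite (ip0l hD)].
move=> k u v [Nu hu] [Nv hv]; split=> [|x Nx Fx]; first exact: (sub_lin sN).
by rewrite (ip_lin hD) // hu // hv // mulr0 addr0.
Qed.

Lemma feig_minus_onseq : exists b, [/\ onseq setT dot b,
  forall x, x \in b -> feig_minus x &
  forall u, feig_minus u -> (forall x, x \in b -> dot u x = 0) -> u = 0].
Proof.
apply: (hdim_fin_onseq hD (@subsetT _ _) feig_minus_subspace).
by apply: le_lt_trans finN; apply: hdim_le => u [].
Qed.

(** Seen as an orthogonal complement: the range of [Tmu lam] cuts out [N], and the vectors common to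
    [N] and [F] cut out the rest. *)
Let complete_minus : complete_in a feig_minus feig_minus.
Proof.
pose B := (Tmu dot E a lam @` E) `|` [set x | N x /\ F x].
have TE := Tmu_in dot_norm hE cE dE hga lam.
have BE : B `<=` E by move=> _ [[x Ex <-]|[[Ex _] _]] //; exact: TE.
have := orth_complete hE BE cE; set Z := [set u | _].
suff -> : Z = feig_minus by [].
have TT u x : E u -> E x -> a u (Tmu dot E a lam x) = a (Tmu dot E a lam u) x.
  by move=> Eu Ex; rewrite (symop_ip hE (symop_Tmu dot_norm hE cE dE ga0 hga lam)).
apply/seteqP; split=> u.
  move=> [Eu hu]; split.
    split=> // v Ev; apply/eqP; rewrite -subr_eq0.
    rewrite -(Tmu_ip dot_norm hE cE dE hga) // -TT //; apply/eqP; apply: hu.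
    by left; exists v.
  by move=> x Nx Fx; apply/(feig_orth hE Nx Eu); exact: (hu x (or_intror (conj Nx Fx))).
move=> [Nu hu]; have [Eu _] := Nu; split=> // g [[x Ex <-]|[Ng Fg]].
  rewrite TT // (_ : Tmu _ _ _ _ _ = 0) ?(ip0l hE) //.
  by apply/(Tmu_eq0 dot_norm hE cE dE hga).
by apply/(feig_orth hE Ng Eu); exact: hu.
Qed.

Lemma fourier_lin k u v :
  fourier dot bF (k *: u + v) = k *: fourier dot bF u + fourier dot bF v.
Proof.
rewrite /fourier scaler_sumr -big_split /=; apply: eq_bigr => x _.
by rewrite (ip_lin hD) // scalerDl scalerA.
Qed.

Lemma fourier_orth u x : F x -> dot (u - fourier dot bF u) x = 0.
Proof.
move=> Fx; rewrite (onseq_expansion hD (@subsetT _ _) sF obF bFF hbF Fx).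
rewrite (onseq_ip_sumr hD _ obF) // big_seq big1 // => y yb.
by case: (fourier_perp hD obF (I : setT u)) => _ ->; rewrite ?mulr0.
Qed.

(** If [n - e] vanishes then [n] lies in [F] and is orthogonal to itself. Finite dimension turns
    injectivity into a bound: [bdd_below_finite_codim] is used with [r] a basis, so its starting
    hypothesis concerns only the zero vector. *)
Lemma feig_minus_lower : exists2 k, 0 < k & forall n e, feig_minus n -> F e ->
  (forall x, F x -> dot (n - e) x = 0) -> k * nm a n <= nm dot (n - e).
Proof.
have [b [ob bS hb]] := feig_minus_onseq.
have SE u : feig_minus u -> E u by case=> -[].
have hS := prehilbertS hE feig_minus_subspace SE.
have Ff u : F (fourier dot bF u).
  by rewrite /fourier big_seq; apply: (sub_sum sF) => x /bFF; exact: (subZ sF).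
have [|||||k k0 hk] := @bdd_below_finite_codim _ _ _ setT a dot
    (fun n => n - fourier dot bF n) hS hD complete_minus (fun _ _ => I) _ _ [::] b _ bS.
- move=> k u v _ _; rewrite fourier_lin scalerBr opprD addrACA //.
- exists ga => // u Su; apply: le_trans (hga (SE _ Su)).
  have -> : nm dot u = nm dot (u - fourier dot bF u + fourier dot bF u) by rewrite subrK.
  rewrite (nm_le_orth hD) // rpE.
  by rewrite fourier_orth.
- by [].
- move=> u [[Nu hu] _] /eqP; rewrite subr_eq0 => /eqP uf.
  apply: (nm_eq0 hD) => //; apply/eqP; rewrite -sqrf_eq0 (sqr_nm hD) // rpE hu //.
  by rewrite uf.
- exists 1 => // u [Su ub]; rewrite (hb u Su) ?(nm0 hE) ?mulr0 ?nm_ge0 // => x xb.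
  have [Nx _] := bS _ xb; apply/(feig_orth hE Nx (SE _ Su)).
  by apply: ub; rewrite mem_cat xb.
exists k => // n e Sn Fe ne.
suff <- : n - fourier dot bF n = n - e by apply: hk.
congr (_ - _); apply/eqP; rewrite -subr_eq0; apply/eqP.
have Fd : F (fourier dot bF n - e) by exact: (subB sF).
apply: hbF => // x /bFF Fx.
have -> : fourier dot bF n - e = (n - e) - (n - fourier dot bF n).
  by rewrite opprB [RHS]addrC addrA subrK.
by rewrite (ipBl hD) // ne // fourier_orth // subrr.
Qed.

End Complement.

(** * Test vectors in [Gs mu] and their estimates *)

Section Witness.
Context {R : realType} {H : completeNormedModType R[i]}.
Variable dot : {dot H for @Num.conj R[i]}.
Hypothesis dot_norm : forall u : H, `|u| ^+ 2 = dot u u.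
Variables (H1 H01 : set H) (a : H -> H -> R[i]) (ga : R).
Hypotheses (h1 : prehilbert H1 a) (H01_H1 : H01 `<=` H1) (s01 : is_subspace H01).
Hypotheses (ga0 : 0 < ga) (hga : forall u, H1 u -> nm dot u <= ga * nm a u).
Let hD := prehilbert_dot dot.
Let s1 : is_subspace H1. Proof. by case: h1. Qed.
Local Notation Gs := (Gs dot H1 H01 a).
Local Notation nma := (nm a).
Local Notation rpa := (rp a).
Local Notation nmH := (nm dot).
Local Notation rpH := (rp dot).

Lemma Gs_conj mu x y : H01 x -> Gs mu y -> a x y = mu%:C * dot x y.
Proof.
move=> H0x [Hy hy]; have Hx := H01_H1 H0x.
rewrite (ipC h1) // hy // [dot x y](ipC hD) //.
by rewrite (rmorphM (@conjc R)); congr (_ * _); exact: conjc_real.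
Qed.

(** $q_\mu(n,\cdot) = (\lambda-\mu)(n,\cdot)$ on all of [H1], while [e] and [h] lie in [H01] and are
    $q_\mu$-orthogonal to [Gs mu], so they do not change this value. *)
Lemma deflated_Dirichlet lam mu n e h : feig dot H1 a lam n ->
  deflated dot H01 a lam mu n e h -> Gs mu (n - e - h) /\
  forall y, Gs mu y -> a (n - e - h) y - mu%:C * dot (n - e - h) y =
    (lam - mu)%:C * dot n y.
Proof.
move=> [Hn hn] [[H0e he] _ H0h _ hh].
have He := H01_H1 H0e; have Hh := H01_H1 H0h.
have Hne : H1 (n - e) by mem.
have Hw : H1 (n - e - h) by mem.
split.
  split=> // x H0x; have Hx := H01_H1 H0x.
  have := hh x H0x; rewrite !(ipBl hD) // !(ipBl h1) // hn // he // rmorphB /=.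
  move=> E; apply/eqP; rewrite -subr_eq0; apply/eqP.
  have -> : a h x = (lam%:C - mu%:C) * (dot n x - dot e x) + mu%:C * dot h x.
    by rewrite -E subrK.
  by ring.
move=> y Gy; have [Hy _] := Gy.
rewrite !(ipBl hD) // !(ipBl h1) // hn // (Gs_conj H0e Gy) (Gs_conj H0h Gy) rmorphB /=.
by ring.
Qed.

(** Here [n] itself is in [H01] and invisible to [Gs mu]. The value comes from the subtracted
    vectors, $q_\mu(e,y) = (\lambda-\mu)(e,y)$ and $q_\mu(h,y) = (\lambda-\mu)(n-e,y)$, whence the
    opposite sign. *)
Lemma deflated_Neumann lam mu n e h : feig dot H01 a lam n ->
  deflated dot H1 a lam mu n e h -> Gs mu (n - e - h) /\
  forall y, Gs mu y -> a (n - e - h) y - mu%:C * dot (n - e - h) y =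
    (- (lam - mu))%:C * dot n y.
Proof.
move=> [H0n hn] [[He he] _ Hh _ hh].
have Hn := H01_H1 H0n.
have Hne : H1 (n - e) by mem.
have Hw : H1 (n - e - h) by mem.
have E x : H1 x -> a h x = (lam%:C - mu%:C) * (dot n x - dot e x) + mu%:C * dot h x.
  by move=> Hx; rewrite -rmorphB -(ipBl hD) // -hh // subrK.
split.
  split=> // x H0x; have Hx := H01_H1 H0x.
  rewrite !(ipBl hD) // !(ipBl h1) // hn // he // E //; ring.
move=> y Gy; have [Hy _] := Gy.
rewrite !(ipBl hD) // !(ipBl h1) // he // (Gs_conj H0n Gy) E // rmorphN rmorphB /=.
by ring.
Qed.

(** Testing [b] with itself gives $\|b\| = O(|t|\|n\|)$; testing it with $w = n-e-h$ gives
    $|t|(n,w)$ up to the sign [s], where $(n,w) = \|n-e\|^2 - (n,h)$ is at least $k^2\|n\|^2 -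
    O(|t|\|n\|^2)$. The smallness hypothesis is the resulting comparison divided by $|t|\|n\|^2$. *)
Lemma witness_estimate mu (t s k C eps : R) n e h b :
  H1 n -> H1 e -> H1 h -> dot (n - e) e = 0 -> n != 0 -> t != 0 ->
  `|t| = s * t -> 0 < k -> k * nma n <= nmH (n - e) ->
  0 <= C -> nma h <= C * (`|t| * nma n) -> 0 < eps ->
  `|t| * (ga ^+ 4 + eps * (ga ^+ 2 * C)) < eps * k ^+ 2 ->
  Gs mu (n - e - h) -> Gs mu b -> (forall y, Gs mu y -> a b y = t%:C * dot n y) ->
  nma b ^+ 2 < eps * (s * rpa b (n - e - h)).
Proof.
move=> Hn He Hh ne n0 t0 ts k0 kn C0 hC eps0 small Gw Gb bE.
have [Hb _] := Gb.
have rb y : Gs mu y -> rpa b y = t * rpH n y.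
  by move=> Gy; rewrite !rpE bE //; case: (dot n y) => p q /=; ring.
have tp : 0 < `|t| by rewrite normr_gt0.
have np := nm_gt0 h1 Hn n0.
have dotb u v : H1 u -> H1 v -> `|rpH u v| <= ga ^+ 2 * (nma u * nma v).
  by rewrite expr2; exact: rp_dot_bound.
have nb : nma b <= `|t| * (ga ^+ 2 * nma n).
  have [->|b0] := eqVneq b 0.
    by rewrite (nm0 h1) mulr_ge0 // mulr_ge0 ?nm_ge0 // sqr_ge0.
  rewrite -(ler_pM2r (nm_gt0 h1 Hb b0)) -expr2 (sqr_nm h1) // rb //.
  apply: le_trans (ler_norm _) _; rewrite normrM -!mulrA ler_pM2l //.
  by rewrite mulrA; exact: dotb.
have nb2 : nma b ^+ 2 <= `|t| ^+ 2 * ga ^+ 4 * nma n ^+ 2.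
  have -> : `|t| ^+ 2 * ga ^+ 4 * nma n ^+ 2 = (`|t| * (ga ^+ 2 * nma n)) ^+ 2 by ring.
  rewrite ler_pXn2r ?nnegrE ?nm_ge0 //.
  by rewrite mulr_ge0 // mulr_ge0 ?nm_ge0 // sqr_ge0.
have w1 : rpH n (n - e - h) = nmH (n - e) ^+ 2 - rpH n h.
  rewrite (rpBr hD) //; congr (_ - _).
  rewrite (sqr_nm hD) // [RHS](rpBl hD) // (rpC hD (u := e) (v := n - e)) //.
  by rewrite [rpH (n - e) e]rpE ne /= subr0.
have l1 : (k * nma n) ^+ 2 <= nmH (n - e) ^+ 2.
  by rewrite ler_pXn2r ?nnegrE ?nm_ge0 ?mulr_ge0 ?nm_ge0 ?(ltW k0).
have l2 : rpH n h <= ga ^+ 2 * (nma n * (C * (`|t| * nma n))).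
  apply: le_trans (ler_norm _) _; apply: le_trans (dotb _ _ Hn Hh) _.
  rewrite ler_wpM2l ?sqr_ge0 // ler_wpM2l // ltW //.
have l3 : (k ^+ 2 - ga ^+ 2 * C * `|t|) * nma n ^+ 2 <= rpH n (n - e - h).
  rewrite w1; move: l1 l2; rewrite exprMn; lra.
rewrite rb // (mulrA s) -ts.
apply: le_lt_trans nb2 _.
have np2 : 0 < nma n ^+ 2 by exact: exprn_gt0.
apply: (@lt_le_trans _ _ (eps * (`|t| * ((k ^+ 2 - ga ^+ 2 * C * `|t|) * nma n ^+ 2)))).
  have -> : `|t| ^+ 2 * ga ^+ 4 * nma n ^+ 2 = (`|t| * nma n ^+ 2) * (`|t| * ga ^+ 4) by ring.
  have -> : eps * (`|t| * ((k ^+ 2 - ga ^+ 2 * C * `|t|) * nma n ^+ 2)) =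
    (`|t| * nma n ^+ 2) * (eps * k ^+ 2 - `|t| * (eps * (ga ^+ 2 * C))) by ring.
  rewrite ltr_pM2l ?mulr_gt0 //; lra.
by rewrite ler_pM2l // ler_pM2l.
Qed.

Section Family.
Variables (E : set H) (lam sg k c : R) (b bS : seq H) (S : set H).
Hypotheses (EH1 : E `<=` H1) (hE : prehilbert E a) (cE : complete_in a E E) (dE : dense E).
Hypotheses (gE : spectral_gap dot E a ga lam b c) (sgE : `|sg| = 1).
Hypotheses (SH1 : S `<=` H1) (sS : is_subspace S).
Hypotheses (obS : onseq setT dot bS) (bSS : forall x, x \in bS -> S x).
Hypothesis k0 : 0 < k.
Hypothesis kS : forall n e, S n -> feig dot E a lam e ->
  (forall x, feig dot E a lam x -> dot (n - e) x = 0) -> k * nma n <= nmH (n - e).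
Hypothesis defl : forall mu n e h, S n -> deflated dot E a lam mu n e h ->
  Gs mu (n - e - h) /\ forall y, Gs mu y -> a (n - e - h) y - mu%:C * dot (n - e - h) y =
    (sg * (lam - mu))%:C * dot n y.

Lemma witness_family eps : 0 < eps -> exists2 d, 0 < d &
  forall mu, 0 < `|lam - mu| < d -> exists w : 'I_(size bS) -> H,
    (forall i, Gs mu (w i)) /\
    forall q : 'I_(size bS) -> R[i], (exists i, q i != 0) ->
    let u := \sum_i q i *: w i in forall v, Gs mu v ->
      (forall y, Gs mu y -> a v y = a u y - mu%:C * dot u y) ->
      nma v ^+ 2 < eps * (sg * Num.sg (lam - mu) * rpa v u).
Proof.
move=> eps0; have [_ _ _ c0 _] := gE.
have hgaE u : E u -> nmH u <= ga * nma u by move=> /EH1/hga.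
(* [C] comes from [deflated_bound], and [M] is the coefficient of $|t|$ in the smallness hypothesis
   of [witness_estimate]. *)
pose C := c^-1 * ga ^+ 2.
have C0 : 0 <= C by rewrite mulr_ge0 ?sqr_ge0 // invr_ge0 ltW.
pose M := ga ^+ 4 + eps * (ga ^+ 2 * C).
have M0 : 0 < M.
  by rewrite ltr_wpDr ?exprn_gt0 // mulr_ge0 ?(ltW eps0) // mulr_ge0 ?sqr_ge0.
exists (Num.min (c / (ga * ga)) (eps * k ^+ 2 / M)).
  by rewrite lt_min !divr_gt0 ?mulr_gt0 ?exprn_gt0.
move=> mu /andP[lm]; rewrite lt_min => /andP[m1 m2].
have m1' : `|lam - mu| * (ga * ga) <= c.
  by move: m1; rewrite ltr_pdivlMr ?mulr_gt0 // => /ltW.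
rewrite ltr_pdivlMr // in m2.
have bi (i : 'I_(size bS)) : bS`_i \in bS by exact: mem_nth.
have /choice[e he] (i : 'I_(size bS)) : exists e, exists h, deflated dot E a lam mu bS`_i e h.
  by have [e [h d]] := deflated_exists dot_norm hE cE dE hgaE gE bS`_i m1'; exists e, h.
have /choice[h hh] (i : 'I_(size bS)) := he i.
exists (fun i : 'I_(size bS) => bS`_i - e i - h i); split=> [i|q q0 u v Gv vE].
  by have [] := defl (bSS (bi i)) (hh i).
pose n := \sum_(i < size bS) q i *: bS`_i; pose e' := \sum_(i < size bS) q i *: e i.
pose h' := \sum_(i < size bS) q i *: h i.
have hd : deflated dot E a lam mu n e' h' := deflated_sum hE q hh.
have uE : u = n - e' - h'.
  rewrite /u /n /e' /h' -!sumrB; apply: eq_bigr => i _.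
  by rewrite !scalerBr.
have Sn : S n by apply: (sub_sum sS) => i _; apply: (subZ sS); exact: bSS.
have Hn := SH1 Sn.
have n0 : n != 0.
  apply/eqP => n0; case: q0 => i; rewrite (onseq_lin_indep hD obS n0) eqxx //.
have [Gw hw] := defl Sn hd.
have [Ne hne Eh hN _] := hd.
have t0 : lam - mu != 0 by rewrite -normr_gt0.
rewrite uE; apply: (witness_estimate (mu := mu) (t := sg * (lam - mu)) (k := k) (C := C)) => //.
- by case: Ne => /EH1.
- exact: EH1.
- exact: hne.
- by rewrite mulf_neq0 // -normr_gt0 sgE.
- rewrite normrM sgE mul1r mulrACA -expr2 -real_normK ?num_real // sgE expr1n mul1r.
  by rewrite normrEsg.
- exact: kS.
- rewrite normrM sgE mul1r /C -mulrA ler_pdivlMl //.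
  apply: le_trans (deflated_bound dot_norm hE cE dE ga0 hgaE gE m1' hd) _.
  rewrite [leRHS]mulrCA ler_wpM2l // expr2 -mulrA ler_pM2l //.
  exact: hga.
- by rewrite normrM sgE mul1r.
- by move=> y Gy; rewrite vE // uE hw.
Qed.

End Family.
End Witness.

(** * The operator calB *)

Section Split.
Context {R : realType} {H : lmodType R[i]}.

Definition split_family m n (f : 'I_m -> H) (g : 'I_n -> H) : 'I_(m + n) -> H :=
  fun i => match fintype.split i with inl j => f j | inr j => g j end.

Lemma split_family_in (W : set H) m n (f : 'I_m -> H) (g : 'I_n -> H) :
  (forall i, W (f i)) -> (forall i, W (g i)) -> forall i, W (split_family f g i).
Proof. by move=> Wf Wg i; rewrite /split_family; case: (fintype.split i). Qed.

Lemma lin_indep_split (W1 W2 : set H) m n (f : 'I_m -> H) (g : 'I_n -> H) :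
  is_subspace W1 -> is_subspace W2 -> (forall u, W1 u -> W2 u -> u = 0) ->
  (forall i, W1 (f i)) -> (forall i, W2 (g i)) -> lin_indep f -> lin_indep g ->
  lin_indep (split_family f g).
Proof.
move=> s1 s2 W12 Wf Wg lf lg c; rewrite big_split_ord /=.
have El i : split_family f g (lshift n i) = f i.
  by rewrite /split_family -[lshift n i]/(unsplit (inl i)) unsplitK.
have Er i : split_family f g (rshift m i) = g i.
  by rewrite /split_family -[rshift m i]/(unsplit (inr i)) unsplitK.
under eq_bigr do rewrite El.
under [X in _ + X]eq_bigr do rewrite Er.
set F := \sum_i _; set G := \sum_i _ => FG.
have F1 : W1 F by apply: (sub_sum s1) => i _; apply: (subZ s1).
have G2 : W2 G by apply: (sub_sum s2) => i _; apply: (subZ s2).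
have FE : F = - G by apply/eqP; rewrite -addr_eq0 FG.
have F0 : F = 0 by apply: W12 => //; rewrite FE; exact: (subN s2).
have G0 : G = 0 by move: FG; rewrite F0 add0r.
move=> i; rewrite -(splitK i); case: (fintype.split i) => j /=.
  exact: (lf _ F0).
exact: (lg _ G0).
Qed.

End Split.

(** * The form domain as a Hilbert space *)

Section FormSpaces.
Context {R : realType} {H : completeNormedModType R[i]}.
Variable dot : {dot H for @Num.conj R[i]}.
Hypothesis dot_norm : forall u : H, `|u| ^+ 2 = dot u u.
Variables (H1 : set H) (a : H -> H -> R[i]).
Hypotheses (s1 : is_subspace H1) (a_hermitian : hermitian_on H1 a).
Hypotheses (a_positive : positive_on H1 a) (a_closed : closed_form H1 a).
Let hD := prehilbert_dot dot.

Lemma prehilbert_form : prehilbert H1 a.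
Proof.
split=> // u Hu u0; have [c c0 hc] := a_positive.
apply: lt_le_trans (hc _ Hu); rewrite mulr_gt0 ?ltcR // exprn_gt0 // normr_gt0 //.
Qed.
Let h1 := prehilbert_form.

Lemma form_embedding : exists2 ga, 0 < ga & forall u, H1 u -> nm dot u <= ga * nm a u.
Proof.
have [c c0 hc] := a_positive.
have q0 : 0 < Num.sqrt c by rewrite sqrtr_gt0.
exists (Num.sqrt c)^-1; first by rewrite invr_gt0.
move=> u Hu; rewrite ler_pdivlMl //.
rewrite -(@ler_pXn2r _ 2) ?nnegrE ?nm_ge0 ?mulr_ge0 ?nm_ge0 ?(ltW q0) //.
rewrite exprMn sqr_sqrtr ?(ltW c0) // (sqr_nm hD) // (sqr_nm h1) //.
by have := hc _ Hu; rewrite dot_norm (ipE hD) // (ipE h1) // -rmorphM lecR.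
Qed.

Lemma form_cvgP (x : nat -> H) u : (forall n, H1 (x n)) -> H1 u -> form_cvg a x u <->
  forall e, 0 < e -> exists N, forall n, (N <= n)%N -> nm a (x n - u) < e.
Proof.
move=> Hx Hu; have Hxu n : H1 (x n - u) by have := Hx n => Hn; mem.
have E n : `|a (x n - u) (x n - u)| = (nm a (x n - u) ^+ 2)%:C.
  by rewrite (ipE h1) // normc_def /= expr0n /= addr0 sqrtr_sqr ger0_norm ?(rp_ge0 h1) ?(sqr_nm h1).
split.
  move/cvgrPdist_lt => h e e0; have : 0 < (e ^+ 2)%:C by rewrite ltcR exprn_gt0.
  move=> /h [N _ hN]; exists N => n /hN; rewrite sub0r normrN E ltcR.
  by rewrite ltr_pXn2r ?nnegrE ?nm_ge0 ?(ltW e0).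
move=> h; apply/cvgrPdist_lt => e /gt0_complexP[r r0 ->].
have q0 : 0 < Num.sqrt r by rewrite sqrtr_gt0.
have [N hN] := h _ q0; exists N => // n /= Nn.
rewrite sub0r normrN E ltcR -[ltRHS](sqr_sqrtr (ltW r0)).
by rewrite ltr_pXn2r ?nnegrE ?nm_ge0 ?(ltW q0) //; exact: hN.
Qed.

Lemma complete_form : complete_in a H1 H1.
Proof.
have [ga ga0 hga] := form_embedding.
move=> x Hx xC.
have Hxx m n : H1 (x m - x n) by have := Hx n; have := Hx m => ? ?; mem.
have [u _ xu] : exists2 u, [set: H] u & forall e, 0 < e ->
    exists N, forall n, (N <= n)%N -> nm dot (x n - u) < e.
  apply: (complete_dot dot_norm (E := setT)) => // e e0.
  have [N hN] := xC _ (divr_gt0 e0 ga0); exists N => m n Nm Nn.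
  apply: le_lt_trans (hga _ (Hxx m n)) _.
  by have := hN m n Nm Nn; rewrite ltr_pdivlMr // mulrC.
have xu' : x @ \oo --> u by apply/(cvg_nmH dot_norm).
have xC' : form_cauchy a x.
  move=> e e0; have q0 : 0 < Num.sqrt e by rewrite sqrtr_gt0.
  have [N hN] := xC _ q0.
  exists ([set m | (N <= m)%N], [set m | (N <= m)%N]); first by split; exists N.
  move=> [m n] /= [Nm Nn]; rewrite (ipE h1) // ltcR -(sqr_nm h1) //.
  rewrite -[ltRHS](sqr_sqrtr (ltW e0)).
  by rewrite ltr_pXn2r ?nnegrE ?nm_ge0 ?(ltW q0) //; exact: hN.
have [Hu cu] := a_closed Hx xu' xC'.
by exists u => //; apply/form_cvgP.
Qed.

Lemma complete_subform (H01 : set H) : H01 `<=` H1 -> form_closed_subset H1 a H01 ->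
  complete_in a H01 H01.
Proof.
move=> sub cl x Hx xC; have Hx1 n : H1 (x n) by exact: sub.
have [u Hu xu] := complete_form Hx1 xC.
by exists u => //; apply: (cl x) => //; apply/form_cvgP.
Qed.

End FormSpaces.

(** * [calB] as a bounded symmetric operator on [Gs mu] *)

Section Assembly.
Context {R : realType} {H : completeNormedModType R[i]}.
Variable dot : {dot H for @Num.conj R[i]}.
Hypothesis dot_norm : forall u : H, `|u| ^+ 2 = dot u u.
Variables (H1 H01 : set H) (a : H -> H -> R[i]) (ga : R).
Hypotheses (h1 : prehilbert H1 a) (c1 : complete_in a H1 H1) (d1 : dense H1).
Hypotheses (s01 : is_subspace H01) (H01_H1 : H01 `<=` H1).
Hypotheses (c01 : complete_in a H01 H01) (d01 : dense H01).
Hypotheses (ga0 : 0 < ga) (hga : forall u, H1 u -> nm dot u <= ga * nm a u).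
Let hD := prehilbert_dot dot.
Let s1 : is_subspace H1. Proof. by case: h1. Qed.
Let h01 : prehilbert H01 a. Proof. exact: (prehilbertS h1 s01 H01_H1). Qed.
Let hga0 u : H01 u -> nm dot u <= ga * nm a u. Proof. by move=> /H01_H1/hga. Qed.
Local Notation Gs := (Gs dot H1 H01 a).
Local Notation nma := (nm a).
Local Notation rpa := (rp a).

Lemma G_eigE mu : G_eig dot H1 H01 a mu = Gs mu.
Proof.
apply/seteqP; split=> u.
  move=> /(form_operatorP dot_norm h1 (@subset_refl _ H1) H01_H1 s01 d01)[Hu hu].
  by split=> // x /hu <-; rewrite (ipZl hD).
move=> [Hu hu]; apply/(form_operatorP dot_norm h1 (@subset_refl _ H1) H01_H1 s01 d01).
by split=> // x Hx; rewrite hu // (ipZl hD).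
Qed.

Section Operator.
Variable mu : R.
Let hG := prehilbert_Gs dot h1 H01_H1 mu.
Let cG : complete_in a (Gs mu) (Gs mu).
Proof. exact: (complete_Gs dot_norm h1 c1 d1 H01_H1 ga0 hga). Qed.
Let sG := Gs_subspace dot h1 H01_H1 mu.
Local Notation B := (calB dot H1 H01 a mu).

Lemma calBP u : Gs mu u -> Gs mu (B u) /\
  forall v, Gs mu v -> a (B u) v = a u v - mu%:C * dot u v.
Proof.
move=> Gu; have [Hu hu] := Gu.
have HK := Kinv_in dot_norm h1 c1 d1 hga u.
have [g [Gg gx _]] := orth_projection h1 sG (@Gs_sub _ _ _ _ _ _ mu) cG HK.
have Hg := Gs_sub Gg.
have : [set g | G_eig dot H1 H01 a mu g /\
    forall v, G_eig dot H1 H01 a mu v -> a (Kinv dot H1 a u - g) v = 0] g.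
  rewrite G_eigE; split=> // v Gv; have [Hv _] := Gv.
  by rewrite (ipBl h1) // gx // subrr.
move=> hg; have [] := @xgetPex _ 0 _ (ex_intro _ g hg).
rewrite -/(orth_proj a _ _) /= -/(Kinv dot H1 a u).
set p := orth_proj _ _ _; rewrite G_eigE => Gp ph.
have Hp := Gs_sub Gp.
split; first by mem.
move=> v Gv; have [Hv _] := Gv.
have Hup : H1 (mu%:C *: p) by mem.
rewrite (ipBl h1) // (ipZl h1) //; congr (_ - _ * _).
rewrite -(Kinv_ip dot_norm h1 c1 d1 hga) //.
by apply/eqP; rewrite eq_sym -subr_eq0 -(ipBl h1) // ph.
Qed.

Lemma calB_symop : symop (Gs mu) a B.
Proof.
split.
- by move=> u /calBP[].
- move=> k u v Gu Gv; have [GBu hBu] := calBP Gu; have [GBv hBv] := calBP Gv.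
  have Gk := sub_lin sG k Gu Gv; have [GBk hBk] := calBP Gk.
  have Hu := Gs_sub Gu; have Hv := Gs_sub Gv.
  apply: (form_inj hG) => //; first exact: (sub_lin sG).
  move=> w Gw; have Hw := Gs_sub Gw.
  rewrite hBk // (ip_lin hG) // hBu // hBv // (ip_lin h1) // (ip_lin hD) //; ring.
- move=> u v Gu Gv; have [GBu hBu] := calBP Gu; have [GBv hBv] := calBP Gv.
  have Hu := Gs_sub Gu; have Hv := Gs_sub Gv.
  rewrite [RHS](rpC hG) // !rpE hBu // hBv // (ipC h1 Hu Hv) (ipC hD (u := u) (v := v)) //.
  by case: (a u v) => x y; case: (dot u v) => z t /=; ring.
- exists (1 + `|mu| * (ga * ga)); first by rewrite ltr_wpDr // !mulr_ge0 // ltW.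
  move=> u Gu; have [GBu hBu] := calBP Gu; have Hu := Gs_sub Gu; have HBu := Gs_sub GBu.
  have [->|b0] := eqVneq (B u) 0.
    by rewrite (nm0 hG) mulr_ge0 ?nm_ge0 // addr_ge0 // !mulr_ge0 // ltW.
  rewrite -(ler_pM2r (nm_gt0 hG GBu b0)) -expr2 (sqr_nm hG) //.
  have -> : rpa (B u) (B u) = rpa u (B u) - mu * rp dot u (B u).
    by rewrite !rpE hBu //; case: (a u _) => x y; case: (dot u _) => z t /=; ring.
  have l1 := rp_le_nm h1 Hu HBu.
  have l2 := rp_dot_bound hga Hu HBu.
  have l3 : - (mu * rp dot u (B u)) <= `|mu| * (ga * ga * (nma u * nma (B u))).
    by apply: le_trans (ler_norm _) _; rewrite normrN normrM ler_wpM2l.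
  lra.
Qed.

(** Turns conditions [dot u n = 0] into [a]-orthogonality to vectors of [Gs mu], as
    [spectrum_near0_count] expects of its constraints. *)
Lemma Gs_repr : exists f : H -> H, forall n, Gs mu (f n) /\
  forall v, Gs mu v -> dot n v = a (f n) v.
Proof.
have /choice[f hf] n : exists g, Gs mu g /\ forall v, Gs mu v -> dot n v = a g v.
  by apply: (form_repr hG cG (ga := ga)) => u /Gs_sub/hga.
by exists f.
Qed.

End Operator.
End Assembly.

(** * Multiplicities and conclusion *)

Section Counting.
Context {R : realType} {H : completeNormedModType R[i]}.
Variable dot : {dot H for @Num.conj R[i]}.
Hypothesis dot_norm : forall u : H, `|u| ^+ 2 = dot u u.
Variables (H1 H01 : set H) (a : H -> H -> R[i]) (ga : R).
Hypotheses (h1 : prehilbert H1 a) (c1 : complete_in a H1 H1) (d1 : dense H1).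
Hypotheses (s01 : is_subspace H01) (H01_H1 : H01 `<=` H1).
Hypotheses (c01 : complete_in a H01 H01) (d01 : dense H01).
Hypotheses (ga0 : 0 < ga) (hga : forall u, H1 u -> nm dot u <= ga * nm a u).
Let hD := prehilbert_dot dot.
Let s1 : is_subspace H1. Proof. by case: h1. Qed.
Let h01 : prehilbert H01 a. Proof. exact: (prehilbertS h1 s01 H01_H1). Qed.
Let hga0 u : H01 u -> nm dot u <= ga * nm a u. Proof. by move=> /H01_H1/hga. Qed.
Local Notation Gs := (Gs dot H1 H01 a).
Local Notation nma := (nm a).
Local Notation rpa := (rp a).
Variables (lam : R) (bN bD : seq H) (cN cD : R).
Hypothesis gN : spectral_gap dot H1 a ga lam bN cN.
Hypothesis gD : spectral_gap dot H01 a ga lam bD cD.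
Local Notation N := (feig dot H1 a lam).
Local Notation D := (feig dot H01 a lam).
Let sN := feig_subspace dot h1 lam.
Let sD := feig_subspace dot h01 lam.
Local Notation C := [set u | N u /\ D u].
Local Notation SN := (feig_minus dot H1 a lam D).
Local Notation SD := (feig_minus dot H01 a lam N).
Local Notation calH0 := (calH0 dot H1 H01 a).
Local Notation calH := (calH dot H1 H01 a).

Let sC : is_subspace C.
Proof.
apply: is_subspaceP; first by split; [exact: (sub0 sN)|exact: (sub0 sD)].
by move=> k u v [Nu Du] [Nv Dv]; split; [exact: (sub_lin sN)|exact: (sub_lin sD)].
Qed.

Let finN : (hdim N < +oo)%E.
Proof.
case: gN => ob bN' hb _ _.
by rewrite (hdim_onseq hD (@subsetT _ _) sN ob bN' hb) ltry.
Qed.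

Let finD : (hdim D < +oo)%E.
Proof.
case: gD => ob bD' hb _ _.
by rewrite (hdim_onseq hD (@subsetT _ _) sD ob bD' hb) ltry.
Qed.

Lemma common_onseq : exists b, [/\ onseq setT dot b, forall x, x \in b -> C x &
  forall u, C u -> (forall x, x \in b -> dot u x = 0) -> u = 0].
Proof.
apply: (hdim_fin_onseq hD (@subsetT _ _) sC).
by apply: le_lt_trans finN; apply: hdim_le => u [].
Qed.

Let split_C (W : set H) n : is_subspace W -> C `<=` W -> W n ->
  exists p r, [/\ C p, W r, forall x, C x -> dot r x = 0 & n = p + r].
Proof.
move=> sW CW Wn; have [b [ob bC hb]] := common_onseq.
have Cf : C (fourier dot b n).
  by rewrite /fourier big_seq; apply: (sub_sum sC) => x /bC; exact: (subZ sC).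
exists (fourier dot b n), (n - fourier dot b n); split=> //.
- by apply: (subB sW) => //; exact: CW.
- by move=> x; exact: (fourier_orth sC ob bC hb).
- by rewrite addrC subrK.
Qed.

Let split_N n : N n -> exists p r, [/\ C p, SN r & n = p + r].
Proof.
move=> Nn; have [|p [r [Cp Nr rC ->]]] := split_C sN _ Nn; first by move=> u [].
by exists p, r; split=> //; split=> // x Nx Dx; exact: rC.
Qed.

Let split_D n : D n -> exists p r, [/\ C p, SD r & n = p + r].
Proof.
move=> Dn; have [|p [r [Cp Dr rC ->]]] := split_C sD _ Dn; first by move=> u [].
by exists p, r; split=> //; split=> // x Dx Nx; exact: rC.
Qed.

Let C_calH0 : C `<=` calH0.
Proof.
move=> c [Nc Dc]; apply: subset_closure.
have [->|c0] := eqVneq c 0; first exact: (sub0 (linspan_subspace _)).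
apply: linspan_gen; split; split=> //; exists lam%:C.
  by rewrite (op_eigenspaceE dot_norm h1 d1).
by rewrite (op_eigenspaceE dot_norm h01 d01).
Qed.

Let common_eigenvector w : op_eigenvector (A_N dot H1 a) w ->
  op_eigenvector (A_D dot H01 a) w -> exists z : R[i],
  H01 w /\ forall x, H1 x -> a w x = z * dot w x.
Proof.
have P1 := form_operatorP dot_norm h1 (@subset_refl _ H1) (@subset_refl _ H1) s1 d1.
have P2 := form_operatorP dot_norm h01 (@subset_refl _ H01) (@subset_refl _ H01) s01 d01.
move=> [w0 [z1 /P1[Hw h]]] [_ [z2 /P2[H0w _]]].
by exists z1; split=> // x Hx; rewrite -h // (ipZl hD).
Qed.

(** Since [w] lies in [H01], the equation for [n] against [H01] can be evaluated at [w]; this covers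
    [SN] and [SD] alike. If the eigenvalue of [w] is [lam] then [w] is in [C]; otherwise two values
    of the form at the pair are compared. *)
Let orth_common n w : H1 n -> (forall x, H01 x -> a n x = lam%:C * dot n x) ->
  (forall c, C c -> dot n c = 0) -> op_eigenvector (A_N dot H1 a) w ->
  op_eigenvector (A_D dot H01 a) w -> dot w n = 0.
Proof.
move=> Hn hn nC wN wD; have [z [H0w hw]] := common_eigenvector wN wD.
have Hw := H01_H1 H0w.
have [zl|zl] := eqVneq z lam%:C.
  rewrite (ip_eq0C hD (u := n)) // nC //; split; split=> // x.
    by rewrite -zl; exact: hw.
  by move=> /H01_H1 Hx; rewrite -zl; exact: hw.
have := hw n Hn; rewrite (ipC h1) // hn // [dot w n](ipC hD) //.
rewrite (rmorphM (@conjc R)) -[X in X * _]/(lam%:C^*%C) conjc_real => /eqP.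
rewrite -subr_eq0 -mulrBl mulf_eq0 subr_eq0 eq_sym (negbTE zl) /= => /eqP.
by [].
Qed.

Let calH_orth n : (forall w, op_eigenvector (A_N dot H1 a) w ->
  op_eigenvector (A_D dot H01 a) w -> dot w n = 0) -> calH n.
Proof.
move=> h v vc; rewrite (ip_eq0C hD (u := v)) //.
apply: (closure_orth dot_norm vc) => w.
apply: (@linspan_sub _ _ _ [set w | dot w n = 0]).
  apply: is_subspaceP; first by rewrite /= (ip0l hD).
  by move=> k p q /= hp hq; rewrite (ip_lin hD) // hp hq mulr0 addr0.
by move=> p [pN pD]; exact: h.
Qed.

Let SN_calH : SN `<=` calH.
Proof.
move=> n [[Hn hn] nC]; apply: calH_orth => w wN wD.
by apply: (orth_common Hn _ _ wN wD) => [x /H01_H1/hn //|c [Nc Dc]]; exact: nC.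
Qed.

Let SD_calH : SD `<=` calH.
Proof.
move=> n [[Hn hn] nC]; apply: calH_orth => w wN wD.
by apply: (orth_common (H01_H1 Hn) hn _ wN wD) => c [Nc Dc]; exact: nC.
Qed.

Let E_projP (W : set H) (T : operator H) : op_eigenspace T lam%:C = W -> is_subspace W ->
  (forall u, exists2 e, W e & forall x, W x -> dot (u - e) x = 0) ->
  (forall u, W (E_proj dot T lam u) /\ forall x, W x -> dot (u - E_proj dot T lam u) x = 0) /\
  forall u, W u -> E_proj dot T lam u = u.
Proof.
move=> TW sW hW.
have ex u : W (E_proj dot T lam u) /\ forall x, W x -> dot (u - E_proj dot T lam u) x = 0.
  have [e We he] := hW u.
  have : [set g | W g /\ forall v, W v -> dot (u - g) v = 0] e by [].
  by move=> h; rewrite /E_proj TW; have := @xgetPex _ 0 _ (ex_intro _ e h).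
split=> // u Wu; have [WE hE] := ex u.
apply/eqP; rewrite eq_sym -subr_eq0; apply/eqP.
apply: (nm_eq0 hD) => //; apply/eqP; rewrite -sqrf_eq0 (sqr_nm hD) // rpE hE //.
exact: (subB sW).
Qed.

Let E_N_P := E_projP (op_eigenspaceE dot_norm h1 d1 lam) sN (feig_proj h1 gN).
Let E_D_P := E_projP (op_eigenspaceE dot_norm h01 d01 lam) sD (feig_proj h01 gD).

(** Projecting changes [u] by a vector orthogonal to [W], hence to [C], and [u] in [calH] is already
    orthogonal to [C]; so the image stays orthogonal to [C]. Conversely, [S] is fixed by the
    projection. *)
Let E_image (W : set H) (T : operator H) (S : set H) :
  (forall u, W (E_proj dot T lam u) /\ forall x, W x -> dot (u - E_proj dot T lam u) x = 0) ->
  (forall u, W u -> E_proj dot T lam u = u) -> C `<=` W ->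
  (forall n, S n <-> W n /\ forall c, C c -> dot n c = 0) -> S `<=` calH ->
  E_proj dot T lam @` calH = S.
Proof.
move=> h1' h2 CW SE Sc; apply/seteqP; split=> [_ [u cu <-]|n Sn].
  have [WE hE] := h1' u; apply/SE; split=> // c Cc.
  have := hE _ (CW _ Cc); rewrite (ipBl hD) // (cu c (C_calH0 Cc)) sub0r.
  by move/eqP; rewrite oppr_eq0 => /eqP.
by exists n; [exact: Sc|apply: h2; case/SE: Sn].
Qed.

Lemma image_N : E_proj dot (A_N dot H1 a) lam @` calH = SN.
Proof.
have [p1 p2] := E_N_P; apply: (E_image p1 p2) SN_calH; first by move=> u [].
move=> n; split=> [[Nn h]|[Nn h]]; split=> //.
  by move=> c [Nc Dc]; exact: h.
by move=> x Nx Dx; exact: h.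
Qed.

Lemma image_D : E_proj dot (A_D dot H01 a) lam @` calH = SD.
Proof.
have [p1 p2] := E_D_P; apply: (E_image p1 p2) SD_calH; first by move=> u [].
move=> n; split=> [[Nn h]|[Nn h]]; split=> //.
  by move=> c [Nc Dc]; exact: h.
by move=> x Nx Dx; exact: h.
Qed.

(** The component [r] in [SN] of the projection [g] of [u] satisfies $(g,r) = (u,r) = 0$, as [r]
    lies in [calH] and [u] in [calH0]. *)
Lemma image_C : E_proj dot (A_N dot H1 a) lam @` calH0 = C.
Proof.
have [p1 p2] := E_N_P; apply/seteqP; split=> [_ [u cu <-]|c Cc]; last first.
  by exists c; [exact: C_calH0|apply: p2; case: Cc].
have [NE hE] := p1 u; set g := E_proj _ _ _ u in NE hE *.
have [p [r [Cp Sr gE]]] := split_N NE.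
have [Nr rC] := Sr.
suff r0 : r = 0 by rewrite gE r0 addr0.
have gr : dot g r = 0.
  have ur : dot u r = 0 := ip_eq0C hD (u := r) I I (SN_calH Sr cu).
  by have := hE _ Nr; rewrite (ipBl hD) // ur sub0r => /eqP; rewrite oppr_eq0 => /eqP.
apply: (nm_eq0 hD) => //; apply/eqP; rewrite -sqrf_eq0 (sqr_nm hD) // rpE.
have -> : dot r r = dot g r - dot p r by rewrite gE (ipDl hD) // addrAC subrr add0r.
rewrite gr (ip_eq0C hD (u := r) (v := p)) ?subr0 //.
by case: Cp => Np Dp; exact: rC.
Qed.

(** * Multiplicities and the count for given [mu] *)

Section Bases.
Variables (sn sd sc : seq H).
Hypotheses (osn : onseq setT dot sn) (snS : forall x, x \in sn -> SN x).
Hypothesis snB : forall u, SN u -> (forall x, x \in sn -> dot u x = 0) -> u = 0.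
Hypotheses (osd : onseq setT dot sd) (sdS : forall x, x \in sd -> SD x).
Hypothesis sdB : forall u, SD u -> (forall x, x \in sd -> dot u x = 0) -> u = 0.
Hypotheses (osc : onseq setT dot sc) (scC : forall x, x \in sc -> C x).
Hypothesis scB : forall u, C u -> (forall x, x \in sc -> dot u x = 0) -> u = 0.
Let sSN := feig_minus_subspace dot h1 lam D.
Let sSD := feig_minus_subspace dot h01 lam N.

Lemma n_NE : n_N dot H1 H01 a lam = (size sn)%:R%:E.
Proof. by rewrite /n_N image_N (hdim_onseq hD (@subsetT _ _) sSN osn snS snB). Qed.

Lemma n_DE : n_D dot H1 H01 a lam = (size sd)%:R%:E.
Proof. by rewrite /n_D image_D (hdim_onseq hD (@subsetT _ _) sSD osd sdS sdB). Qed.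

Lemma n_NDE : n_ND dot H1 H01 a lam = (size sc)%:R%:E.
Proof. by rewrite /n_ND image_C (hdim_onseq hD (@subsetT _ _) sC osc scC scB). Qed.

Let orth_basis (W : set H) b u : is_subspace W -> onseq setT dot b ->
  (forall x, x \in b -> W x) ->
  (forall u, W u -> (forall x, x \in b -> dot u x = 0) -> u = 0) ->
  (forall x, x \in b -> dot u x = 0) -> forall n, W n -> dot u n = 0.
Proof.
move=> sW ob bW hb ub n Wn; rewrite (onseq_expansion hD (@subsetT _ _) sW ob bW hb Wn).
rewrite (onseq_ip_sumr hD _ ob) // big_seq big1 // => x xb.
by rewrite ub // mulr0.
Qed.

Variables (c0 d0 : R).
Hypothesis lower : forall mu u b, `|lam - mu| < d0 -> Gs mu u -> Gs mu b ->
    (forall v, Gs mu v -> a b v = a u v - mu%:C * dot u v) ->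
    (forall n, N n -> dot u n = 0) -> (forall x, D x -> dot u x = 0) ->
    c0 * nma u <= nma b.

Let calBP' mu := @calBP _ _ dot dot_norm H1 H01 a ga h1 c1 d1 s01 H01_H1 d01 ga0 hga mu.

Let near0_count mu e (s : seq H) p0 n0 z0 (wp : 'I_p0 -> H) (wn : 'I_n0 -> H)
    (wz : 'I_z0 -> H) :
  `|lam - mu| < d0 -> 0 < e < c0 ->
  (forall u, Gs mu u -> (forall x, x \in s -> dot u x = 0) ->
    (forall n, N n -> dot u n = 0) /\ (forall x, D x -> dot u x = 0)) ->
  (forall i, Gs mu (wp i)) -> (forall i, Gs mu (wn i)) -> (forall i, Gs mu (wz i)) ->
  (forall k : 'I_p0 -> R[i], (exists i, k i != 0) -> let u := \sum_i k i *: wp i in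
    forall v, Gs mu v -> (forall y, Gs mu y -> a v y = a u y - mu%:C * dot u y) ->
    nma v ^+ 2 < e * rpa v u) ->
  (forall k : 'I_n0 -> R[i], (exists i, k i != 0) -> let u := \sum_i k i *: wn i in
    forall v, Gs mu v -> (forall y, Gs mu y -> a v y = a u y - mu%:C * dot u y) ->
    nma v ^+ 2 < e * - rpa v u) ->
  (forall k : 'I_z0 -> R[i], (exists i, k i != 0) -> let u := \sum_i k i *: wz i in
    u != 0 /\ forall y, Gs mu y -> a u y = mu%:C * dot u y) ->
  (size s <= p0 + n0 + z0)%N ->
  calB_spectrum_near0 dot H1 H01 a mu e n0%:R%:E z0%:R%:E p0%:R%:E.
Proof.
move=> ml /andP[e0 ec] sND wpG wnG wzG wpP wnP wzP ss.
have hG := prehilbert_Gs dot h1 H01_H1 mu.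
have cG : complete_in a (Gs mu) (Gs mu) := @complete_Gs _ _ dot dot_norm H1 H01 a ga h1 c1 d1 H01_H1 ga0 hga mu.
have sG := Gs_subspace dot h1 H01_H1 mu.
have [f hf] := Gs_repr dot_norm h1 c1 d1 H01_H1 ga0 hga mu.
have GE := G_eigE dot_norm h1 s01 H01_H1 d01 mu.
rewrite /calB_spectrum_near0 GE.
have inG m (w : 'I_m -> H) (k : 'I_m -> R[i]) : (forall i, Gs mu (w i)) ->
    Gs mu (\sum_i k i *: w i).
  by move=> wG; apply: (sub_sum sG) => i _; exact: (subZ sG).
apply: (@spectrum_near0_count _ _ _ _ (calB dot H1 H01 a mu) hG cG _ _ e c0 (map f s) e0 ec _ _
  _ _ _ wp wn wz) => //.
- exact: (calB_symop dot_norm h1 c1 d1 s01 H01_H1 d01 ga0 hga).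
- by move=> g /mapP[x _ ->]; case: (hf x).
- move=> u [Gu hu]; have [GB hB] := calBP' Gu.
  have us x : x \in s -> dot u x = 0.
    move=> xs; rewrite (ip_eq0C hD (u := x)) //; have [Gf hfx] := hf x.
    by rewrite hfx // (ip_eq0C hG Gu Gf) // hu // map_f.
  have [uN uD] := sND u Gu us.
  exact: (lower ml Gu GB hB uN uD).
- by move=> k k0 /=; have Gu := inG _ _ k wpG; have [GB hB] := calBP' Gu; exact: wpP.
- by move=> k k0 /=; have Gu := inG _ _ k wnG; have [GB hB] := calBP' Gu; exact: wnP.
- move=> k k0 /=; have Gu := inG _ _ k wzG; have [GB hB] := calBP' Gu.
  have [u0 uE] := wzP k k0; split=> //.
  apply: (form_inj hG) => //; first exact: (sub0 sG).
  by move=> v Gv; rewrite hB // uE // subrr (ip0l hG).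
- by rewrite size_map.
Qed.

Lemma near0_at e : 0 < d0 -> 0 < e < c0 ->
  calB_spectrum_near0 dot H1 H01 a lam e 0%E
    (n_N dot H1 H01 a lam + n_D dot H1 H01 a lam + n_ND dot H1 H01 a lam)%E 0%E.
Proof.
move=> dp ec; rewrite n_NE n_DE n_NDE -!EFinD -!natrD.
pose Z := [set u | Gs lam u /\ forall y, Gs lam y -> a u y = lam%:C * dot u y].
have sG := Gs_subspace dot h1 H01_H1 lam.
have sZ : is_subspace Z.
  apply: is_subspaceP.
    split=> [|y Gy]; first exact: (sub0 sG).
    by rewrite (ip0l h1) ?(ip0l hD) ?mulr0 //; exact: Gs_sub Gy.
  move=> k u v [Gu hu] [Gv hv]; split=> [|y Gy]; first exact: (sub_lin sG).
  have Hu := Gs_sub Gu; have Hv := Gs_sub Gv; have Hy := Gs_sub Gy.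
  by rewrite (ip_lin h1) // hu // hv // (ip_lin hD) // mulrDr mulrCA.
have NZ n : N n -> Z n.
  move=> [Hn hn]; split=> [|y /Gs_sub/hn //].
  by split=> // x /H01_H1/hn.
have DZ n : D n -> Z n.
  move=> [Hn hn]; split=> [|y Gy]; last exact: (Gs_conj h1 H01_H1 Hn Gy).
  by split=> //; exact: H01_H1.
pose fam (b : seq H) (i : 'I_(size b)) := b`_i.
have famP (b : seq H) (W : set H) : (forall x, x \in b -> W x) -> forall i, W (fam b i).
  by move=> bW i; apply: bW; exact: mem_nth.
have SS0 u : SN u -> SD u -> u = 0.
  move=> [Nu uD] [Du _]; apply: (nm_eq0 hD) => //; apply/eqP.
  by rewrite -sqrf_eq0 (sqr_nm hD) // rpE uD.
pose SND := [set u | exists n d, [/\ SN n, SD d & u = n + d]].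
have sSND : is_subspace SND.
  apply: is_subspaceP.
    by exists 0, 0; split; [exact: (sub0 sSN)|exact: (sub0 sSD)|rewrite addr0].
  move=> k _ _ [n [d [Sn Sd ->]]] [n' [d' [Sn' Sd' ->]]].
  exists (k *: n + n'), (k *: d + d'); split; [exact: (sub_lin sSN)|exact: (sub_lin sSD)|].
  by rewrite scalerDr addrACA.
(* If $n+d$ is in [C] then [d] is in [N] too, so it is common and orthogonal to the common vectors,
   hence zero; the same then applies to [n]. *)
have SC0 u : SND u -> C u -> u = 0.
  move=> [n [d [Sn Sd ->]]] [Nu Du].
  have Dd : D d by case: Sd.
  have Nd : N d by rewrite -(addKr n d) addrC; apply: (subB sN) => //; case: Sn.
  have d_0 : d = 0 by apply: SS0 => //; split=> // x Nx Dx; case: Sd => _; exact.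
  rewrite d_0 addr0 in Nu Du *.
  apply: SS0 => //; split=> // x Dx Nx; case: Sn => _; exact.
pose w := split_family (split_family (fam sn) (fam sd)) (fam sc).
have wli : lin_indep w.
  apply: (lin_indep_split sSND sC SC0); last 2 first.
  - apply: (lin_indep_split sSN sSD SS0); [exact: famP|exact: famP| |].
      exact: (onseq_lin_indep hD osn).
    exact: (onseq_lin_indep hD osd).
  - exact: (onseq_lin_indep hD osc).
  - apply: split_family_in; apply: famP => x xb.
      by exists x, 0; split; [exact: snS|exact: (sub0 sSD)|rewrite addr0].
    by exists 0, x; split; [exact: (sub0 sSN)|exact: sdS|rewrite add0r].
  - exact: famP.
have wZ i : Z (w i).
  apply: split_family_in; first apply: split_family_in; apply: famP => x.
  - by move=> /snS[/NZ].
  - by move=> /sdS[/DZ].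
  - by move=> /scC[/NZ].
apply: (@near0_count lam e (sn ++ sd ++ sc) 0 0 _ (fun=> 0) (fun=> 0) w) => //.
- by rewrite subrr normr0.
- move=> u Gu hu.
  have uC : forall x, C x -> dot u x = 0.
    by apply: (orth_basis sC osc scC scB) => x xs; apply: hu; rewrite !mem_cat xs !orbT.
  have uSN : forall x, SN x -> dot u x = 0.
    by apply: (orth_basis sSN osn snS snB) => x xs; apply: hu; rewrite !mem_cat xs.
  have uSD : forall x, SD x -> dot u x = 0.
    by apply: (orth_basis sSD osd sdS sdB) => x xs; apply: hu; rewrite !mem_cat xs orbT.
  split=> n.
    by move=> /split_N[p [r [Cp Sr ->]]]; rewrite (ipDr hD) // uC // uSN // addr0.
  by move=> /split_D[p [r [Cp Sr ->]]]; rewrite (ipDr hD) // uC // uSD // addr0.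
- by case.
- by case.
- by move=> i; case: (wZ i).
- by move=> k [[]].
- by move=> k [[]].
- move=> k [i ki] u; have Zu : Z u by apply: (sub_sum sZ) => j _; exact: (subZ sZ).
  split; last by case: Zu.
  by apply/eqP => /(wli k)/(_ i) ki0; rewrite ki0 eqxx in ki.
- by rewrite !size_cat addnA.
Qed.

(** For [x] in [C] and [u] in [Gs mu], $a[x,u]$ equals both $\lambda(x,u)$ and $\mu(x,u)$. So the
    constraints from [C] hold by themselves off [lam], and [n_ND] leaves the count. *)
Let orth_off mu u : mu != lam -> Gs mu u -> (forall x, x \in sn ++ sd -> dot u x = 0) ->
  (forall n, N n -> dot u n = 0) /\ (forall x, D x -> dot u x = 0).
Proof.
move=> ml Gu hu.
have uC x : C x -> dot u x = 0.
  move=> [[Hx hx] [H0x _]]; have [Hu hu'] := Gu.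
  have := Gs_conj h1 H01_H1 H0x Gu; rewrite hx // => /eqP.
  rewrite -subr_eq0 -mulrBl -rmorphB mulf_eq0 => /orP[/eqP/complexI/eqP|/eqP h].
    by rewrite subr_eq0 eq_sym (negbTE ml).
  by rewrite (ip_eq0C hD (u := x)).
have uSN : forall x, SN x -> dot u x = 0.
  by apply: (orth_basis sSN osn snS snB) => x xs; apply: hu; rewrite !mem_cat xs.
have uSD : forall x, SD x -> dot u x = 0.
  by apply: (orth_basis sSD osd sdS sdB) => x xs; apply: hu; rewrite !mem_cat xs orbT.
split=> n.
  by move=> /split_N[p [r [Cp Sr ->]]]; rewrite (ipDr hD) // uC // uSN // addr0.
by move=> /split_D[p [r [Cp Sr ->]]]; rewrite (ipDr hD) // uC // uSD // addr0.
Qed.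

Lemma near0_off e : 0 < d0 -> 0 < e < c0 -> exists2 d, 0 < d & forall mu,
  (lam - d < mu < lam -> calB_spectrum_near0 dot H1 H01 a mu e
    (n_D dot H1 H01 a lam) 0%E (n_N dot H1 H01 a lam)) /\
  (lam < mu < lam + d -> calB_spectrum_near0 dot H1 H01 a mu e
    (n_N dot H1 H01 a lam) 0%E (n_D dot H1 H01 a lam)).
Proof.
move=> dp ec; have /andP[e0 _] := ec; rewrite n_NE n_DE.
have [obN bNN hbN _ _] := gN; have [obD bDD hbD _ _] := gD.
have [kN kN0 hkN] := feig_minus_lower dot_norm h1 c1 d1 ga0 hga finN sD obD bDD hbD.
have [kD kD0 hkD] := feig_minus_lower dot_norm h01 c01 d01 ga0 hga0 finD sN obN bNN hbN.
have SNH1 : SN `<=` H1 by move=> u [[]].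
have SDH1 : SD `<=` H1 by move=> u [[/H01_H1]].
have deflN mu n e1 h : SN n -> deflated dot H01 a lam mu n e1 h ->
    Gs mu (n - e1 - h) /\ forall y, Gs mu y ->
    a (n - e1 - h) y - mu%:C * dot (n - e1 - h) y = (1 * (lam - mu))%:C * dot n y.
  by move=> [Nn _]; rewrite mul1r; exact: deflated_Dirichlet.
have deflD mu n e1 h : SD n -> deflated dot H1 a lam mu n e1 h ->
    Gs mu (n - e1 - h) /\ forall y, Gs mu y ->
    a (n - e1 - h) y - mu%:C * dot (n - e1 - h) y = (-1 * (lam - mu))%:C * dot n y.
  by move=> [Nn _]; rewrite mulN1r; exact: deflated_Neumann.
(* [SN] is corrected inside [H01] with sign $+1$, [SD] inside [H1] with sign $-1$. *)
have [dN dN0 hdN] := @witness_family _ _ dot dot_norm H1 H01 a ga h1 ga0 hga H01 lam 1 kN cD bD sn SN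
  H01_H1 h01 c01 d01 gD (normr1 _) SNH1 sSN osn snS kN0 hkN
  deflN e e0.
have [dD dD0 hdD] := @witness_family _ _ dot dot_norm H1 H01 a ga h1 ga0 hga H1 lam (-1) kD cN bN sd SD
  (@subset_refl _ _) h1 c1 d1 gN (normrN1 _) SDH1 sSD osd sdS kD0 hkD
  deflD e e0.
exists (Num.min d0 (Num.min dN dD)); first by rewrite !lt_min dp dN0 dD0.
have main mu : 0 < `|lam - mu| < Num.min d0 (Num.min dN dD) ->
    [/\ `|lam - mu| < d0, 0 < `|lam - mu| < dN & 0 < `|lam - mu| < dD].
  by rewrite !lt_min => /andP[-> /and3P[-> -> ->]].
move=> mu; split=> /andP[m1 m2].
(* Here $\lambda-\mu>0$, so [SN] yields the positive test vectors and [SD] the negative ones; beyond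
   [lam] the roles are exchanged. *)
- have lm : `|lam - mu| = lam - mu by rewrite gtr0_norm // subr_gt0.
  have sg1 : Num.sg (lam - mu) = 1 by rewrite gtr0_sg // subr_gt0.
  have [|m3 m4 m5] := main mu; first by rewrite lm; apply/andP; split; lra.
  have [wN [wNG wNP]] := hdN mu m4; have [wD [wDG wDP]] := hdD mu m5.
  apply: (@near0_count mu e (sn ++ sd) _ _ 0 wN wD (fun=> 0)) => //.
  + by move=> u; apply: orth_off; rewrite lt_eqF.
  + by case.
  + by move=> k k0 u v Gv hv; have := wNP k k0 v Gv hv; rewrite sg1 !mul1r.
  + by move=> k k0 u v Gv hv; have := wDP k k0 v Gv hv; rewrite sg1 mulr1 mulN1r.
  + by move=> k [[]].
  + by rewrite size_cat addn0.
- have lm : `|lam - mu| = mu - lam by rewrite ltr0_norm ?opprB // subr_lt0.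
  have sg1 : Num.sg (lam - mu) = -1 by rewrite ltr0_sg // subr_lt0.
  have [|m3 m4 m5] := main mu; first by rewrite lm; apply/andP; split; lra.
  have [wN [wNG wNP]] := hdN mu m4; have [wD [wDG wDP]] := hdD mu m5.
  apply: (@near0_count mu e (sn ++ sd) _ _ 0 wD wN (fun=> 0)) => //.
  + by move=> u; apply: orth_off; rewrite gt_eqF.
  + by case.
  + by move=> k k0 u v Gv hv; have := wDP k k0 v Gv hv; rewrite sg1 mulrNN !mul1r.
  + by move=> k k0 u v Gv hv; have := wNP k k0 v Gv hv; rewrite sg1 mul1r mulN1r.
  + by move=> k [[]].
  + by rewrite size_cat addn0 addnC.
Qed.

End Bases.
End Counting.

Theorem theorem1p3 (R : realType) (H : completeNormedModType R[i])
    (dot : {dot H for @Num.conj R[i]})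
    (dot_norm : forall u : H, `|u| ^+ 2 = dot u u)
    (H_infinite_dim : hdim [set: H] = +oo%E)
    (H_separable : separable_space H)
    (H1 : set H) (H1_subspace : is_subspace H1) (H1_dense : dense H1)
    (a : H -> H -> R[i])
    (a_hermitian : hermitian_on H1 a) (a_positive : positive_on H1 a)
    (a_closed : closed_form H1 a)
    (H01 : set H) (H01_subspace : is_subspace H01) (H01_sub_H1 : H01 `<=` H1)
    (H01_closed : form_closed_subset H1 a H01) (H01_dense : dense H01)
    (lam : R)
    (lam_notin_ess : ~ (sigma_ess dot (A_N dot H1 a)
                        `|` sigma_ess dot (A_D dot H01 a)) lam%:C) :
  let nN := n_N dot H1 H01 a in
  let nD := n_D dot H1 H01 a in
  let nND := n_ND dot H1 H01 a in
  let near0 := calB_spectrum_near0 dot H1 H01 a in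
  exists2 e0 : R, 0 < e0 & forall e : R, 0 < e < e0 ->
  exists2 d : R, 0 < d & forall mu : R,
    [/\ mu = lam ->
          near0 mu e 0%E (nN mu + nD mu + nND mu)%E 0%E,
        lam - d < mu < lam ->
          near0 mu e (nD lam) 0%E (nN lam) &
        lam < mu < lam + d ->
          near0 mu e (nN lam) 0%E (nD lam)].
Proof.
have h1 := prehilbert_form H1_subspace a_hermitian a_positive.
have c1 : complete_in a H1 H1 :=
  @complete_form _ _ dot dot_norm H1 a H1_subspace a_hermitian a_positive a_closed.
have c01 : complete_in a H01 H01 :=
  @complete_subform _ _ dot dot_norm H1 a H1_subspace a_hermitian a_positive a_closed H01
    H01_sub_H1 H01_closed.
have [ga ga0 hga] := form_embedding dot_norm H1_subspace a_hermitian a_positive.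
have h01 := prehilbertS h1 H01_subspace H01_sub_H1.
have hga0 u : H01 u -> nm dot u <= ga * nm a u by move=> /H01_sub_H1/hga.
have [bN [cN gN]] : exists b c, spectral_gap dot H1 a ga lam b c.
  by apply: (form_gap dot_norm h1 c1 H1_dense ga0 hga) => h; apply: lam_notin_ess; left.
have [bD [cD gD]] : exists b c, spectral_gap dot H01 a ga lam b c.
  by apply: (form_gap dot_norm h01 c01 H01_dense ga0 hga0) => h; apply: lam_notin_ess; right.
have [c0 [d0 [c0_gt0 d0_gt0 low]]] :=
  G_lower dot_norm h1 c1 H1_dense H01_subspace H01_sub_H1 c01 H01_dense ga0 hga gN gD.
have finN : (hdim (feig dot H1 a lam) < +oo)%E.
  case: gN => ob bN' hb _ _.
  by rewrite (hdim_onseq (prehilbert_dot dot) (@subsetT _ _) (feig_subspace dot h1 lam) ob bN' hb) ltry.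
have finD : (hdim (feig dot H01 a lam) < +oo)%E.
  case: gD => ob bD' hb _ _.
  by rewrite (hdim_onseq (prehilbert_dot dot) (@subsetT _ _) (feig_subspace dot h01 lam) ob bD' hb) ltry.
have [sn [osn snS snB]] := feig_minus_onseq h1 finN (feig dot H01 a lam).
have [sd [osd sdS sdB]] := feig_minus_onseq h01 finD (feig dot H1 a lam).
have [sc [osc scC scB]] := common_onseq h1 H01_subspace H01_sub_H1 gN.
(* The window must stay below the lower bound [c0] of [G_lower]; the radius [d] then depends on [e]
   through the test vectors. *)
exists c0 => // e ec.
have [d d_gt0 hd] := near0_off dot_norm h1 c1 H1_dense H01_subspace H01_sub_H1 c01 H01_dense
  ga0 hga gN gD osn snS snB osd sdS sdB low d0_gt0 ec.
exists d => // mu; have [hm1 hm2] := hd mu; split=> [->|hmu|hmu].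
- exact: (near0_at dot_norm h1 c1 H1_dense H01_subspace H01_sub_H1 H01_dense
    ga0 hga gN gD osn snS snB osd sdS sdB osc scC scB low d0_gt0 ec).
- exact: hm1.
- exact: hm2.
Qed.
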